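(* Let $(\alpha_n)$ be a Riemann sequence and let $Z_\alpha(s)=\sum_{n=1}^\infty\alpha_n^{-s}$ for $\operatorname{Re}s>1$, where $\alpha_n^{-s}$ is defined by the principal value of $\log\alpha_n$. Then $Z_\alpha(s)$ extends to a meromorphic function on $\mathbb{C}$. It has a double pole at $s=1$ with residue $-\frac{\log2\pi}{2\pi}$ and principal part $$\frac{1}{2\pi(s-1)^2}-\frac{\log2\pi}{2\pi(s-1)}.$$ It has simple poles at the odd negative integers $s=-(2n-1)$, $n=1,2,3,\dots$, with principal part $$(-1)^n\frac{a_{2n}}{\pi(s+2n-1)}=(-1)^n\frac{(1-2^{1-2n})}{2\pi}\frac{B_{2n}}{2n}\frac{1}{s+2n-1}.$$ The function $Z_\alpha(s)$ has no other poles. Finally, for $n=0,1,2,\dots$, $$Z_\alpha(-2n)=(-1)^n\frac{a_{2n+1}}{2}=(-1)^n\frac{8-E_{2n}}{2^{2n+3}}.$$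
   Context: Asymptotic notation: for a function $f(z)$ defined on a half-plane $\operatorname{Re}z>a$, one writes $f(z)\simeq\sum_{n=0}^\infty\frac{b_n}{z^n}$ if for each natural number $N$ and any $0<\varepsilon<\frac{\pi}{2}$ we have $\lim_{z\to\infty}\bigl(f(z)-\sum_{n=0}^N\frac{b_n}{z^n}\bigr)z^N=0$ for $|\arg z|\le\frac{\pi}{2}-\varepsilon$; and $f\simeq g+\sum_n b_nz^{-n}$ means $f-g\simeq\sum_n b_nz^{-n}$. Coefficients: $a_{2n+1}=\frac{8-E_{2n}}{2^{2n+2}}$ ($n\ge0$), $a_{2n}=\bigl(1-\frac{1}{2^{2n-1}}\bigr)\frac{B_{2n}}{4n}$ ($n\ge1$), with $\frac{2e^t}{e^{2t}+1}=\sum_{n\ge0} E_n\frac{t^n}{n!}$, $\frac{t}{e^t-1}=\sum_{n\ge0} B_n\frac{t^n}{n!}$. Riemann sequence: a sequence of complex numbers $(\alpha_n)_{n\ge1}$ is a Riemann sequence if: (a) $1<\operatorname{Re}\alpha_1\le\operatorname{Re}\alpha_2\le\cdots$; (b) each complex number $\alpha$ has finite multiplicity $\nu(\alpha)=\operatorname{card}\{n:\alpha_n=\alpha\}$, and $\nu(\alpha)=\nu(\overline\alpha)$ if $\alpha$ is not real; (c) there is a constant $C$ with $|\operatorname{Im}\alpha_n|<C$ for all $n$; (d) $|\arg\alpha_n|<\pi/4$, i.e. $|\operatorname{Im}\alpha_n|<\operatorname{Re}\alpha_n$, for all $n$; (e) $\sum_{k=1}^\infty\frac{2z}{z^2+\alpha_k^2}\simeq\frac12\log\frac{z}{2\pi}+\sum_{n=1}^\infty\frac{a_n}{z^n}$.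 *)

(* Defs.v *)
(* Stdlib real numbers, with Coquelicot's complex numbers, limits and series. *)
From Stdlib Require Export Reals Factorial List.
From Coquelicot Require Export Coquelicot.

Open Scope R_scope.

(* Principal argument, in (-PI, PI]; junk at 0. *)
Definition Carg (z : C) : R :=
  if Rle_dec 0 (Im z) then acos (Re z / Cmod z) else - acos (Re z / Cmod z).

Definition Cexp (z : C) : C :=
  (exp (Re z) * cos (Im z), exp (Re z) * sin (Im z)).

Definition Clog (z : C) : C := (ln (Cmod z), Carg z).

(* Coquelicot's [Cpow] only allows exponents in [nat]. *)
Definition Cpower (z s : C) : C := Cexp (s * Clog z)%C.

(* Germs at 0 of the real generating functions; the values of the coefficients
   do not depend on the radius [r]. *)
Definition is_Euler_numbers (E : nat -> R) : Prop :=
  exists r : R, 0 < r /\ forall t : R, Rabs t < r ->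
    is_pseries (fun n => E n / INR (fact n)) t
      (2 * exp t / (exp (2 * t) + 1)).

Definition is_Bernoulli_numbers (B : nat -> R) : Prop :=
  exists r : R, 0 < r /\ forall t : R, 0 < Rabs t < r ->
    is_pseries (fun n => B n / INR (fact n)) t (t / (exp t - 1)).

Definition coef_odd (E : nat -> R) (n : nat) : R :=
  (8 - E (2 * n)%nat) / 2 ^ (2 * n + 2).

Definition coef_even (B : nat -> R) (n : nat) : R :=
  (1 - 1 / 2 ^ (2 * n - 1)) * (B (2 * n)%nat / (4 * INR n)).

(* There is no constant term, hence the value 0 at index 0. *)
Definition coef (E B : nat -> R) (m : nat) : R :=
  if Nat.odd m then coef_odd E (Nat.div2 m)
  else if Nat.eqb m 0 then 0
  else coef_even B (Nat.div2 m).

Definition C_infty (P : C -> Prop) : Prop :=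
  exists M : R, forall z : C, M < Cmod z -> P z.

(* [f] is a total function, but only its values on some half-plane Re z > a
   matter: each sector below is eventually contained in it. *)
Definition asymp (f : C -> C) (b : nat -> C) : Prop :=
  forall (N : nat) (eps : R), 0 < eps < PI / 2 ->
    filterlim
      (fun z : C => ((f z - sum_n (fun n => b n / z ^ n) N) * z ^ N)%C)
      (within (fun z : C => Rabs (Carg z) <= PI / 2 - eps) C_infty)
      (locally (RtoC 0)).

Definition is_Cseries (a : nat -> C) (l : C) : Prop :=
  @is_series C_AbsRing C_NormedModule a l.

Definition is_multiplicity (alpha : nat -> C) (z : C) (k : nat) : Prop :=
  exists l : list nat,
    NoDup l /\ (forall n, In n l <-> alpha n = z) /\ length l = k.

(* Indices are shifted: [alpha n] is the (n+1)-st term of the sequence. *)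
Record is_Riemann_sequence (E B : nat -> R) (alpha : nat -> C) : Prop := {
  Rs_gt1 : 1 < Re (alpha O);
  Rs_incr : forall n, Re (alpha n) <= Re (alpha (S n));
  Rs_fin : forall z : C, exists k, is_multiplicity alpha z k;
  Rs_conj : forall (z : C) (k : nat), Im z <> 0 ->
    is_multiplicity alpha z k -> is_multiplicity alpha (Cconj z) k;
  Rs_strip : exists M : R, forall n, Rabs (Im (alpha n)) < M;
  Rs_arg : forall n, Rabs (Carg (alpha n)) < PI / 4;
  Rs_asymp : exists (a : R) (f : C -> C),
    (forall z : C, a < Re z ->
       is_Cseries (fun k => (2 * z / (z ^ 2 + alpha k ^ 2))%C) (f z)) /\
    asymp (fun z => (f z - / 2 * Clog (z / (2 * PI)))%C)
      (fun n => RtoC (coef E B n))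
}.

Definition holomorphic_at (f : C -> C) (z : C) : Prop :=
  locally z (fun s => @ex_derive C_AbsRing C_NormedModule f s).

(* Empty, hence zero, when [m = 0]. *)
Definition polar_sum (z : C) (m : nat) (c : nat -> C) (s : C) : C :=
  sum_n_m (fun k => (c k / (s - z) ^ k)%C) 1 m.

Definition has_principal_part (f : C -> C) (z : C) (p : C -> C) : Prop :=
  (exists (m : nat) (c : nat -> C),
     forall s : C, s <> z -> p s = polar_sum z m c s) /\
  exists g : C -> C,
    holomorphic_at g z /\ locally' z (fun s => f s = (p s + g s)%C).

Definition is_pole_of_order (f : C -> C) (z : C) (m : nat) : Prop :=
  (1 <= m)%nat /\ exists c : nat -> C,
    c m <> RtoC 0 /\ has_principal_part f z (polar_sum z m c).

Definition is_pole (f : C -> C) (z : C) : Prop :=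
  exists m : nat, is_pole_of_order f z m.

Definition is_residue (f : C -> C) (z r : C) : Prop :=
  exists (m : nat) (c : nat -> C),
    (1 <= m)%nat /\ has_principal_part f z (polar_sum z m c) /\ c 1%nat = r.

(* The value of [f] at a pole is arbitrary. *)
Definition meromorphic (f : C -> C) : Prop :=
  forall z : C, holomorphic_at f z \/ is_pole f z.

(* Main.v *)
(* With F(u) = sum_k 2 e^u / (e^(2u) + alpha_k^2), the Mellin transform gives, for 1 < Re s < 2,
   sin(pi s / 2) * int_R F(u) e^((1-s)u) du = pi * Z(s); only the real-axis case of the asymptotic
   expansion is needed. The part u < 0 is holomorphic for Re s < 2 since F(u) = O(e^u), and on u > 0
   subtracting N terms of the expansion leaves a Laplace transform holomorphic for Re s > 1 - N, plus
   1/2 (s-1)^-2 - 1/2 ln(2 pi) (s-1)^-1 + sum_n a_n / (s - 1 + n). The poles at s = 1 - n with n odd are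
   cancelled by the zeros of sin(pi s / 2), which leaves the values Z(-2m).
   Convergence of Z for Re s > 1: at x > 0 every term of the series in (e) has nonnegative real part,
   at least 1 / (2x) if |alpha_k| <= x, so at most O(x ln x) of the alpha_k have modulus <= x.
   A pole at 1 - 2n is genuine because B_(2n) <> 0, by Euler's quadratic recurrence. *)
Require Import Defs.
From Stdlib Require Import Lra Lia ClassicalEpsilon.

(** No contour integral and no identity theorem is used. The Mellin transform [Q b] of
    [2 x / (x^2 + b)] satisfies [b Q' = - s / 2 Q] in the parameter [b], so it equals
    [b^(- s / 2) Q 1]. Splitting [2 y / (y^2 + 1)] into its polar parts at [i] and [- i] then
    compares [Q 1] at [s] with [Q 1] at [s / 2]; iterating down to [s = 0], where [Q 1] is close to
    [2 / s], yields [Q 1 = pi / sin (pi s / 2)]. The formulas for the continuation on different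
    half-planes agree because moving one term of the expansion out of the remainder changes the
    Laplace transform by an explicit integral. The variable [u = ln x] turns every estimate into a
    comparison with exponentials, and differentiation under an integral or a sum comes from
    second-order Taylor bounds. Condition (d) puts [alpha_k^2] in the right half-plane; hence
    [|x^2 + alpha_k^2|] dominates both [x^2] and [|alpha_k|^2], which controls both ends of the
    line. *)

(** * Elementary facts about complex numbers *)

Lemma Ceq (x y : C) : Re x = Re y -> Im x = Im y -> x = y.
Proof. intros H1 H2. apply injective_projections; assumption. Qed.

Ltac Csimpl_goal := unfold Ci, Cminus, Cdiv, Cplus, Copp, Cmult, RtoC, Re, Im in *; simpl in *.
Ltac Ceq_ring := apply Ceq; Csimpl_goal; ring.

Lemma Cmod_le_Re_Im (z : C) : Cmod z <= Rabs (Re z) + Rabs (Im z).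
Proof.
  replace (Cmod z) with (Cmod (RtoC (Re z) + Ci * RtoC (Im z))%C) by (f_equal; Ceq_ring).
  eapply Rle_trans; [apply Cmod_triangle|].
  rewrite Cmod_mult, Cmod_Ci, !Cmod_R. lra.
Qed.

Lemma im_le_Cmod (z : C) : Rabs (Im z) <= Cmod z.
Proof. eapply Rle_trans; [apply Rmax_r|apply Rmax_Cmod]. Qed.

Lemma Cmod_sub_sym (x y : C) : Cmod (x - y) = Cmod (y - x).
Proof. rewrite <- Cmod_opp. f_equal. ring. Qed.

Lemma Cmod_triangle_sub (x y : C) : Cmod x - Cmod y <= Cmod (x - y).
Proof.
  assert (H := Cmod_triangle (x - y) y).
  replace (x - y + y)%C with x in H by ring. lra.
Qed.

(** * The complex exponential *)

Lemma Cexp_plus (x y : C) : Cexp (x + y) = (Cexp x * Cexp y)%C.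
Proof.
  apply Ceq; unfold Cexp; Csimpl_goal; rewrite exp_plus, ?cos_plus, ?sin_plus; ring.
Qed.

Lemma Cexp_R (x : R) : Cexp x = RtoC (exp x).
Proof. apply Ceq; unfold Cexp; simpl; rewrite ?cos_0, ?sin_0; ring. Qed.

Lemma Cexp_0 : Cexp 0 = 1.
Proof. rewrite Cexp_R, exp_0. reflexivity. Qed.

Lemma Cmod_Cexp (z : C) : Cmod (Cexp z) = exp (Re z).
Proof.
  assert (H : Cmod (Cexp z) ^ 2 = exp (Re z) ^ 2).
  { rewrite Cmod2_alt. unfold Cexp; simpl.
    assert (H := sin2_cos2 (Im z)). unfold Rsqr in H. simpl. nra. }
  assert (H0 := Cmod_ge_0 (Cexp z)). assert (H1 := exp_pos (Re z)).
  nra.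
Qed.

Lemma Cexp_neq_0 (z : C) : Cexp z <> 0.
Proof. apply Cmod_gt_0. rewrite Cmod_Cexp. apply exp_pos. Qed.

Lemma Cexp_opp (z : C) : Cexp (- z) = (/ Cexp z)%C.
Proof.
  assert (H : (Cexp (- z) * Cexp z)%C = 1).
  { rewrite <- Cexp_plus. replace (- z + z)%C with (RtoC 0) by ring. apply Cexp_0. }
  replace (Cexp (- z)) with (Cexp (- z) * Cexp z * / Cexp z)%C.
  - rewrite H. ring.
  - field. apply Cexp_neq_0.
Qed.

(** * Complex derivatives *)

(** The library derivative over [C] with its quantifiers explicit and no division by [h], so that
    the rules below reduce to the triangle inequality. Only [is_Cder_is_derive] and
    [holomorphic_at_continuous] pass between the two notions. *)
Definition is_Cder (F : C -> C) (s D : C) : Prop :=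
  forall eps : R, 0 < eps -> exists delta : R, 0 < delta /\
    forall h : C, Cmod h < delta ->
      Cmod (F (s + h)%C - F s - h * D)%C <= eps * Cmod h.

Definition Cdiffable (F : C -> C) (s : C) : Prop := exists D, is_Cder F s D.

Lemma is_Cder_is_derive (F : C -> C) (s D : C) :
  is_Cder F s D -> @is_derive C_AbsRing C_NormedModule F s D.
Proof.
  intros H. split.
  - apply @is_linear_scal_l.
  - intros x Hx. apply @is_filter_lim_locally_unique in Hx. subst x.
    intros eps. destruct (H eps (cond_pos eps)) as [d [Hd Hb]].
    exists (mkposreal d Hd). intros y Hy.
    change (Cmod (y - s)%C < d) in Hy.
    specialize (Hb (y - s)%C Hy).
    assert (E : forall x : C, (s + (x - s))%C = x) by (intros x; ring).
    rewrite E in Hb. exact Hb.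
Qed.

(** The entry point for derivatives that no calculus rule provides: the exponential, the inverse,
    the cardinal sine at 0, and parameters of integrals and series. *)
Lemma is_Cder_quadratic (F : C -> C) (s D : C) (K d : R) : 0 < d ->
  (forall h, Cmod h < d -> Cmod (F (s + h)%C - F s - h * D)%C <= K * Cmod h ^ 2) ->
  is_Cder F s D.
Proof.
  intros Hd H eps He.
  (* This makes [K * Cmod h] at most [eps]; [Rabs K + 1] is positive whatever the sign of [K]. *)
  exists (Rmin d (eps / (Rabs K + 1))).
  assert (HK := Rabs_pos K).
  split. { apply Rmin_pos; [assumption|]. apply Rdiv_lt_0_compat; lra. }
  intros h Hh.
  eapply Rle_trans; [apply H|].
  { eapply Rlt_le_trans; [exact Hh|apply Rmin_l]. }
  assert (Hh2 : Cmod h < eps / (Rabs K + 1)) by (eapply Rlt_le_trans; [exact Hh|apply Rmin_r]).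
  assert (Hm := Cmod_ge_0 h).
  assert (HKa := Rle_abs K).
  assert (Cmod h * (Rabs K + 1) < eps).
  { apply Rmult_lt_compat_r with (r := Rabs K + 1) in Hh2; [|lra].
    replace (eps / (Rabs K + 1) * (Rabs K + 1)) with eps in Hh2 by (field; lra). exact Hh2. }
  replace (K * Cmod h ^ 2) with (Cmod h * K * Cmod h) by ring.
  apply Rmult_le_compat_r; [lra|]. nra.
Qed.

Lemma is_Cder_ext_loc (F G : C -> C) (s D : C) (d : R) : 0 < d ->
  (forall h, Cmod h < d -> F (s + h)%C = G (s + h)%C) ->
  is_Cder F s D -> is_Cder G s D.
Proof.
  intros Hd HFG HF eps He. destruct (HF eps He) as [d' [Hd' Hb]].
  exists (Rmin d d'). split; [apply Rmin_pos; assumption|].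
  intros h Hh.
  rewrite <- HFG by (eapply Rlt_le_trans; [exact Hh|apply Rmin_l]).
  assert (E : F s = G s).
  { specialize (HFG 0). rewrite Cplus_0_r in HFG. apply HFG. rewrite Cmod_0. exact Hd. }
  rewrite <- E. apply Hb. eapply Rlt_le_trans; [exact Hh|apply Rmin_r].
Qed.

Lemma is_Cder_ext (F G : C -> C) (s D : C) :
  (forall z, F z = G z) -> is_Cder F s D -> is_Cder G s D.
Proof. intros H. apply is_Cder_ext_loc with 1; [lra|]. intros h _. apply H. Qed.

Lemma is_Cder_const (c s : C) : is_Cder (fun _ => c) s 0.
Proof.
  intros eps He. exists 1. split; [lra|]. intros h _.
  replace (c - c - h * 0)%C with (RtoC 0) by ring.
  rewrite Cmod_0. apply Rmult_le_pos; [lra|apply Cmod_ge_0].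
Qed.

Lemma is_Cder_id (s : C) : is_Cder (fun z => z) s 1.
Proof.
  intros eps He. exists 1. split; [lra|]. intros h _.
  replace (s + h - s - h * 1)%C with (RtoC 0) by ring.
  rewrite Cmod_0. apply Rmult_le_pos; [lra|apply Cmod_ge_0].
Qed.

Lemma is_Cder_plus (F G : C -> C) (s D E : C) :
  is_Cder F s D -> is_Cder G s E -> is_Cder (fun z => F z + G z)%C s (D + E)%C.
Proof.
  intros HF HG eps He.
  destruct (HF (eps / 2) ltac:(lra)) as [d1 [Hd1 H1]].
  destruct (HG (eps / 2) ltac:(lra)) as [d2 [Hd2 H2]].
  exists (Rmin d1 d2). split; [apply Rmin_pos; assumption|].
  intros h Hh.
  specialize (H1 h (Rlt_le_trans _ _ _ Hh (Rmin_l _ _))).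
  specialize (H2 h (Rlt_le_trans _ _ _ Hh (Rmin_r _ _))).
  replace (F (s + h)%C + G (s + h)%C - (F s + G s) - h * (D + E))%C
    with ((F (s + h)%C - F s - h * D) + (G (s + h)%C - G s - h * E))%C by ring.
  eapply Rle_trans; [apply Cmod_triangle|]. lra.
Qed.

Lemma is_Cder_continuous (F : C -> C) (s D : C) : is_Cder F s D ->
  forall eps, 0 < eps -> exists delta, 0 < delta /\
    forall h, Cmod h < delta -> Cmod (F (s + h)%C - F s)%C < eps.
Proof.
  intros HF eps He. destruct (HF 1 Rlt_0_1) as [d [Hd H]].
  assert (HD := Cmod_ge_0 D).
  exists (Rmin d (eps / (Cmod D + 2))). split.
  { apply Rmin_pos; [assumption|]. apply Rdiv_lt_0_compat; lra. }
  intros h Hh.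
  specialize (H h (Rlt_le_trans _ _ _ Hh (Rmin_l _ _))).
  assert (Hh2 := Rlt_le_trans _ _ _ Hh (Rmin_r _ _)).
  assert (Hm := Cmod_ge_0 h).
  assert (Cmod h * (Cmod D + 2) < eps).
  { apply Rmult_lt_compat_r with (r := Cmod D + 2) in Hh2; [|lra].
    replace (eps / (Cmod D + 2) * (Cmod D + 2)) with eps in Hh2 by (field; lra). exact Hh2. }
  replace (F (s + h)%C - F s)%C with ((F (s + h)%C - F s - h * D) + h * D)%C by ring.
  eapply Rle_lt_trans; [apply Cmod_triangle|]. rewrite Cmod_mult. nra.
Qed.

Lemma is_Cder_mult (F G : C -> C) (s D E : C) :
  is_Cder F s D -> is_Cder G s E ->
  is_Cder (fun z => F z * G z)%C s (D * G s + F s * E)%C.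
Proof.
  intros HF HG eps He.
  assert (Hg := Cmod_ge_0 (G s)). assert (Hf := Cmod_ge_0 (F s)). assert (HD := Cmod_ge_0 D).
  destruct (HF (eps / 3 / (Cmod (G s) + 1))) as [d1 [Hd1 H1]].
  { apply Rdiv_lt_0_compat; lra. }
  destruct (HG (eps / 3 / (Cmod (F s) + 1))) as [d2 [Hd2 H2]].
  { apply Rdiv_lt_0_compat; lra. }
  destruct (is_Cder_continuous G s E HG (Rmin 1 (eps / 3 / (Cmod D + 1)))) as [d3 [Hd3 H3]].
  { apply Rmin_pos; [lra|]. apply Rdiv_lt_0_compat; lra. }
  exists (Rmin d1 (Rmin d2 d3)). split; [repeat apply Rmin_pos; assumption|].
  intros h Hh.
  assert (h1 := Rlt_le_trans _ _ _ Hh (Rmin_l _ _)).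
  assert (h0 := Rlt_le_trans _ _ _ Hh (Rmin_r _ _)).
  assert (h2 := Rlt_le_trans _ _ _ h0 (Rmin_l _ _)).
  assert (h3 := Rlt_le_trans _ _ _ h0 (Rmin_r _ _)).
  specialize (H1 h h1). specialize (H2 h h2). specialize (H3 h h3).
  assert (H4 := Rlt_le_trans _ _ _ H3 (Rmin_l _ _)).
  assert (H5 := Rlt_le_trans _ _ _ H3 (Rmin_r _ _)).
  assert (Hm := Cmod_ge_0 h).
  (* Each of the three summands will be at most [eps / 3 * Cmod h]; the last one by continuity of
     [G] alone. *)
  replace (F (s + h)%C * G (s + h)%C - F s * G s - h * (D * G s + F s * E))%C
    with ((F (s + h)%C - F s - h * D) * G (s + h)%C + F s * (G (s + h)%C - G s - h * E)
          + h * D * (G (s + h)%C - G s))%C by ring.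
  eapply Rle_trans; [apply Cmod_triangle|].
  eapply Rle_trans; [apply Rplus_le_compat_r; apply Cmod_triangle|].
  rewrite !Cmod_mult.
  assert (H6 : Cmod (G (s + h)%C) <= Cmod (G s) + 1).
  { assert (T := Cmod_triangle_sub (G (s + h)%C) (G s)). lra. }
  assert (A1 : Cmod (F (s + h)%C - F s - h * D) * Cmod (G (s + h)%C) <= eps / 3 * Cmod h).
  { eapply Rle_trans.
    - apply Rmult_le_compat; [apply Cmod_ge_0|apply Cmod_ge_0|exact H1|exact H6].
    - right. field. lra. }
  assert (A2 : Cmod (F s) * Cmod (G (s + h)%C - G s - h * E) <= eps / 3 * Cmod h).
  { eapply Rle_trans with ((Cmod (F s) + 1) * (eps / 3 / (Cmod (F s) + 1) * Cmod h)).
    - apply Rmult_le_compat; [apply Cmod_ge_0|apply Cmod_ge_0|lra|exact H2].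
    - right. field. lra. }
  assert (A3 : Cmod h * Cmod D * Cmod (G (s + h)%C - G s) <= eps / 3 * Cmod h).
  { eapply Rle_trans with (Cmod h * (Cmod D + 1) * (eps / 3 / (Cmod D + 1))).
    - apply Rmult_le_compat; [apply Rmult_le_pos; lra|apply Cmod_ge_0| |lra].
      apply Rmult_le_compat_l; lra.
    - right. field. lra. }
  lra.
Qed.

Lemma is_Cder_comp (F G : C -> C) (s D E : C) :
  is_Cder G s E -> is_Cder F (G s) D -> is_Cder (fun z => F (G z)) s (D * E)%C.
Proof.
  intros HG HF eps He.
  assert (HD := Cmod_ge_0 D). assert (HE := Cmod_ge_0 E).
  destruct (HF (eps / 2 / (Cmod E + 1))) as [d1 [Hd1 H1]].
  { apply Rdiv_lt_0_compat; lra. }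
  destruct (is_Cder_continuous G s E HG d1 Hd1) as [d2 [Hd2 H2]].
  destruct (HG (Rmin 1 (eps / 2 / (Cmod D + 1)))) as [d3 [Hd3 H3]].
  { apply Rmin_pos; [lra|]. apply Rdiv_lt_0_compat; lra. }
  exists (Rmin d2 d3). split; [apply Rmin_pos; assumption|].
  intros h Hh.
  specialize (H2 h (Rlt_le_trans _ _ _ Hh (Rmin_l _ _))).
  specialize (H3 h (Rlt_le_trans _ _ _ Hh (Rmin_r _ _))).
  specialize (H1 _ H2).
  replace (G s + (G (s + h)%C - G s))%C with (G (s + h)%C) in H1 by ring.
  assert (Hm := Cmod_ge_0 h).
  assert (H4 : Cmod (G (s + h)%C - G s - h * E) <= 1 * Cmod h).
  { eapply Rle_trans; [exact H3|]. apply Rmult_le_compat_r; [lra|apply Rmin_l]. }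
  assert (H5 : Cmod (G (s + h)%C - G s - h * E) <= eps / 2 / (Cmod D + 1) * Cmod h).
  { eapply Rle_trans; [exact H3|]. apply Rmult_le_compat_r; [lra|apply Rmin_r]. }
  assert (H6 : Cmod (G (s + h)%C - G s) <= (Cmod E + 1) * Cmod h).
  { replace (G (s + h)%C - G s)%C with ((G (s + h)%C - G s - h * E) + h * E)%C by ring.
    eapply Rle_trans; [apply Cmod_triangle|]. rewrite Cmod_mult. lra. }
  replace (F (G (s + h)%C) - F (G s) - h * (D * E))%C
    with ((F (G (s + h)%C) - F (G s) - (G (s + h)%C - G s) * D)
          + D * (G (s + h)%C - G s - h * E))%C by ring.
  eapply Rle_trans; [apply Cmod_triangle|]. rewrite Cmod_mult.
  assert (A1 : Cmod (F (G (s + h)%C) - F (G s) - (G (s + h)%C - G s) * D) <= eps / 2 * Cmod h).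
  { eapply Rle_trans; [exact H1|].
    eapply Rle_trans; [apply Rmult_le_compat_l; [|exact H6]|].
    - apply Rlt_le, Rdiv_lt_0_compat; lra.
    - right. field. lra. }
  assert (A2 : Cmod D * Cmod (G (s + h)%C - G s - h * E) <= eps / 2 * Cmod h).
  { eapply Rle_trans with ((Cmod D + 1) * (eps / 2 / (Cmod D + 1) * Cmod h)).
    - apply Rmult_le_compat; [apply Cmod_ge_0|apply Cmod_ge_0|lra|exact H5].
    - right. field. lra. }
  lra.
Qed.

Lemma is_Cder_inv (s : C) : s <> 0 -> is_Cder Cinv s (- / (s * s))%C.
Proof.
  intros Hs. assert (Hp := proj1 (Cmod_gt_0 s) Hs).
  apply is_Cder_quadratic with (K := 2 / Cmod s ^ 3) (d := Cmod s / 2); [lra|].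
  intros h Hh.
  assert (Hl : Cmod s / 2 <= Cmod (s + h)).
  { assert (T := Cmod_triangle_sub s (- h)). rewrite Cmod_opp in T.
    replace (s - - h)%C with (s + h)%C in T by ring. lra. }
  assert (Hsh : (s + h)%C <> 0). { apply Cmod_gt_0. lra. }
  replace (/ (s + h) - / s - h * - / (s * s))%C with (h * h / (s * s * (s + h)))%C
    by (field; auto).
  rewrite Cmod_div by (repeat apply Cmult_neq_0; auto). rewrite !Cmod_mult.
  apply Rle_trans with (Cmod h * Cmod h / (Cmod s * Cmod s * (Cmod s / 2))).
  - apply Rmult_le_compat_l; [apply Rmult_le_pos; apply Cmod_ge_0|].
    apply Rinv_le_contravar; [repeat apply Rmult_lt_0_compat; lra|].
    apply Rmult_le_compat_l; [nra|lra].
  - right. field. lra.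
Qed.

(** * Functions of a real variable with complex values *)

(** Continuity on all of [R], even for integrands used on a half-line only: integrability on every
    interval then has no side condition. *)
Definition Ccont (g : R -> C) : Prop :=
  forall u eps, 0 < eps -> exists delta, 0 < delta /\
    forall v, Rabs (v - u) < delta -> Cmod (g v - g u)%C < eps.

Lemma Ccont_Re (g : R -> C) : Ccont g -> forall u, continuous (fun v => Re (g v)) u.
Proof.
  intros Hg u. apply continuity_pt_filterlim. apply continuity_pt_locally. intros eps.
  destruct (Hg u eps (cond_pos eps)) as [d [Hd H]].
  exists (mkposreal d Hd). intros v Hv. specialize (H v Hv).
  eapply Rle_lt_trans; [|exact H].
  replace (Re (g v) - Re (g u)) with (Re (g v - g u)%C) by (Csimpl_goal; ring).
  apply re_le_Cmod.
Qed.

Lemma Ccont_Im (g : R -> C) : Ccont g -> forall u, continuous (fun v => Im (g v)) u.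
Proof.
  intros Hg u. apply continuity_pt_filterlim. apply continuity_pt_locally. intros eps.
  destruct (Hg u eps (cond_pos eps)) as [d [Hd H]].
  exists (mkposreal d Hd). intros v Hv. specialize (H v Hv).
  eapply Rle_lt_trans; [|exact H].
  replace (Im (g v) - Im (g u)) with (Im (g v - g u)%C) by (Csimpl_goal; ring).
  apply im_le_Cmod.
Qed.

Lemma Ccont_of_Re_Im (g : R -> C) :
  (forall u, continuous (fun v => Re (g v)) u) -> (forall u, continuous (fun v => Im (g v)) u) ->
  Ccont g.
Proof.
  intros H1 H2 u eps He.
  specialize (H1 u). specialize (H2 u).
  apply continuity_pt_filterlim in H1. apply continuity_pt_filterlim in H2.
  rewrite continuity_pt_locally in H1, H2.
  assert (He2 : 0 < eps / 2) by lra.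
  destruct (H1 (mkposreal _ He2)) as [d1 Hd1].
  destruct (H2 (mkposreal _ He2)) as [d2 Hd2].
  exists (Rmin d1 d2). split; [apply Rmin_pos; apply cond_pos|].
  intros v Hv.
  specialize (Hd1 v (Rlt_le_trans _ _ _ Hv (Rmin_l _ _))).
  specialize (Hd2 v (Rlt_le_trans _ _ _ Hv (Rmin_r _ _))). simpl in Hd1, Hd2.
  eapply Rle_lt_trans; [apply Cmod_le_Re_Im|].
  replace (Re (g v - g u)%C) with (Re (g v) - Re (g u)) by (Csimpl_goal; ring).
  replace (Im (g v - g u)%C) with (Im (g v) - Im (g u)) by (Csimpl_goal; ring).
  lra.
Qed.

Lemma Ccont_of_Cdiffable (F : C -> C) :
  (forall u : R, Cdiffable F (RtoC u)) -> Ccont (fun u => F (RtoC u)).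
Proof.
  intros H u eps He. destruct (H u) as [D HD].
  destruct (is_Cder_continuous F _ D HD eps He) as [d [Hd Hb]].
  exists d. split; [exact Hd|]. intros v Hv.
  specialize (Hb (RtoC (v - u))). rewrite Cmod_R in Hb.
  replace (RtoC u + RtoC (v - u))%C with (RtoC v) in Hb by Ceq_ring.
  apply Hb, Hv.
Qed.

Lemma Ccont_ext (f g : R -> C) : (forall u, f u = g u) -> Ccont f -> Ccont g.
Proof.
  intros E H u eps He. destruct (H u eps He) as [d [Hd Hb]]. exists d. split; [exact Hd|].
  intros v Hv. rewrite <- !E. apply Hb, Hv.
Qed.

Lemma Ccont_plus (f g : R -> C) : Ccont f -> Ccont g -> Ccont (fun u => f u + g u)%C.
Proof.
  intros Hf Hg. apply Ccont_of_Re_Im; intros u.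
  - apply (continuous_plus (fun v => Re (f v)) (fun v => Re (g v))); apply Ccont_Re; assumption.
  - apply (continuous_plus (fun v => Im (f v)) (fun v => Im (g v))); apply Ccont_Im; assumption.
Qed.

Lemma Ccont_mult (f g : R -> C) : Ccont f -> Ccont g -> Ccont (fun u => f u * g u)%C.
Proof.
  intros Hf Hg.
  assert (A := Ccont_Re f Hf). assert (B := Ccont_Im f Hf).
  assert (A' := Ccont_Re g Hg). assert (B' := Ccont_Im g Hg).
  apply Ccont_of_Re_Im; intros u.
  - apply (continuous_minus (fun v => Re (f v) * Re (g v)) (fun v => Im (f v) * Im (g v)));
      apply @continuous_mult; auto.
  - apply (continuous_plus (fun v => Re (f v) * Im (g v)) (fun v => Im (f v) * Re (g v)));
      apply @continuous_mult; auto.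
Qed.

Lemma Ccont_const (c : C) : Ccont (fun _ => c).
Proof.
  intros u eps He. exists 1. split; [lra|]. intros v _.
  replace (c - c)%C with (RtoC 0) by ring. rewrite Cmod_0. exact He.
Qed.

Lemma Ccont_opp_arg (g : R -> C) : Ccont g -> Ccont (fun u => g (- u)).
Proof.
  intros Hg u eps He. destruct (Hg (- u) eps He) as [d [Hd Hb]].
  exists d. split; [exact Hd|]. intros v Hv. apply Hb.
  replace (- v - - u) with (- (v - u)) by ring. rewrite Rabs_Ropp. exact Hv.
Qed.

Lemma is_Cder_Re (F : C -> C) (u : R) (D : C) : is_Cder F (RtoC u) D ->
  is_derive (fun v : R => Re (F (RtoC v))) u (Re D).
Proof.
  intros H. apply is_derive_Reals. intros eps He.
  destruct (H (eps / 2)) as [d [Hd Hb]]; [lra|].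
  exists (mkposreal d Hd). intros h Hh0 Hh. simpl in Hh.
  specialize (Hb (RtoC h)). rewrite Cmod_R in Hb. specialize (Hb Hh).
  replace (RtoC u + RtoC h)%C with (RtoC (u + h)) in Hb by Ceq_ring.
  assert (Hp := Rabs_pos_lt h Hh0).
  replace ((Re (F (RtoC (u + h))) - Re (F (RtoC u))) / h - Re D)
    with (Re (F (RtoC (u + h)) - F (RtoC u) - RtoC h * D)%C / h)
    by (Csimpl_goal; field; exact Hh0).
  unfold Rdiv. rewrite Rabs_mult, Rabs_inv.
  apply Rle_lt_trans with (eps / 2 * Rabs h * / Rabs h).
  - apply Rmult_le_compat_r; [apply Rlt_le, Rinv_0_lt_compat, Hp|].
    eapply Rle_trans; [apply re_le_Cmod|exact Hb].
  - rewrite Rmult_assoc, Rinv_r by lra. lra.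
Qed.

Lemma is_Cder_scal_l (c : C) (F : C -> C) (s D : C) :
  is_Cder F s D -> is_Cder (fun z => c * F z)%C s (c * D)%C.
Proof.
  intros H. assert (T := is_Cder_mult _ _ s _ _ (is_Cder_const c s) H).
  replace (c * D)%C with (0 * F s + c * D)%C by ring. exact T.
Qed.

(** Reduced to the real part by [Im w = Re (- i w)]. *)
Lemma is_Cder_Im (F : C -> C) (u : R) (D : C) : is_Cder F (RtoC u) D ->
  is_derive (fun v : R => Im (F (RtoC v))) u (Im D).
Proof.
  intros H. assert (T := is_Cder_Re _ _ _ (is_Cder_scal_l (- Ci)%C _ _ _ H)).
  replace (Im D) with (Re (- Ci * D)%C) by (Csimpl_goal; ring).
  eapply is_derive_ext; [|exact T].
  intros t. Csimpl_goal; ring.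
Qed.

(** * Derivatives in a real parameter and the mean value inequality *)

Definition is_RCder (g : R -> C) (t : R) (D : C) : Prop :=
  is_derive (fun v => Re (g v)) t (Re D) /\ is_derive (fun v => Im (g v)) t (Im D).

Lemma is_RCder_of_Cder (F : C -> C) (u : R) (D : C) :
  is_Cder F (RtoC u) D -> is_RCder (fun v => F (RtoC v)) u D.
Proof. intros H. split; [apply is_Cder_Re|apply is_Cder_Im]; exact H. Qed.

(* The real mean value theorem in the direction [g 1 - g 0]. *)
Lemma Cmean_value (g dg : R -> C) (M : R) :
  (forall t : R, 0 <= t <= 1 -> is_RCder g t (dg t)) ->
  (forall t : R, 0 <= t <= 1 -> Cmod (dg t) <= M) ->
  Cmod (g 1 - g 0)%C <= M.
Proof.
  intros HD HM.
  set (w := (g 1 - g 0)%C).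
  set (p := fun t => Re w * Re (g t) + Im w * Im (g t)).
  assert (Hp : forall t, 0 <= t <= 1 ->
    is_derive p t (Re w * Re (dg t) + Im w * Im (dg t))).
  { intros t Ht. destruct (HD t Ht) as [H1 H2].
    apply (is_derive_plus (fun t => Re w * Re (g t)) (fun t => Im w * Im (g t)));
      apply is_derive_scal; assumption. }
  destruct (MVT_gen p 0 1 (fun t => Re w * Re (dg t) + Im w * Im (dg t))) as [c [Hc E]].
  - intros t Ht. rewrite Rmin_left, Rmax_right in Ht by lra. apply Hp; lra.
  - intros t Ht. rewrite Rmin_left, Rmax_right in Ht by lra.
    apply continuity_pt_filterlim. apply (ex_derive_continuous p).
    eexists. apply Hp; lra.
  - rewrite Rmin_left, Rmax_right in Hc by lra.
    assert (E2 : Cmod w ^ 2 = Re (Cconj w * dg c)%C).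
    { replace (Re (Cconj w * dg c)%C) with (Re w * Re (dg c) + Im w * Im (dg c))
        by (unfold Cconj; Csimpl_goal; ring).
      rewrite Rminus_0_r, Rmult_1_r in E. rewrite <- E, Cmod2_alt.
      unfold p, w. Csimpl_goal. ring. }
    assert (E3 : Re (Cconj w * dg c)%C <= Cmod w * M).
    { eapply Rle_trans; [apply Rle_abs|]. eapply Rle_trans; [apply re_le_Cmod|].
      rewrite Cmod_mult, Cmod_conj. apply Rmult_le_compat_l; [apply Cmod_ge_0|apply HM, Hc]. }
    assert (Hw := Cmod_ge_0 w).
    destruct (Req_dec (Cmod w) 0) as [E0|E0].
    + rewrite E0. eapply Rle_trans; [apply Cmod_ge_0|apply (HM 0); lra].
    + nra.
Qed.

(** * Taylor remainders of the exponential *)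

Lemma exp_scal_Re_le (z : C) (t : R) : 0 <= t <= 1 -> exp (t * Re z) <= exp (Cmod z).
Proof.
  intros Ht. assert (H := re_le_Cmod z). assert (H0 := Rle_abs (Re z)).
  assert (Hm := Cmod_ge_0 z).
  destruct (Rle_lt_or_eq_dec (t * Re z) (Cmod z)) as [L|L]; [|left; apply exp_increasing, L|right; now rewrite L].
  destruct (Rle_dec 0 (Re z)); nra.
Qed.

Lemma is_RCder_minus (f g : R -> C) (t : R) (D E : C) :
  is_RCder f t D -> is_RCder g t E -> is_RCder (fun v => f v - g v)%C t (D - E)%C.
Proof.
  intros [A B] [A' B']. split.
  - apply (is_derive_minus (fun v => Re (f v)) (fun v => Re (g v))); assumption.
  - apply (is_derive_minus (fun v => Im (f v)) (fun v => Im (g v))); assumption.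
Qed.

Lemma is_RCder_scal (p : R -> R) (t dp : R) (c : C) :
  is_derive p t dp -> is_RCder (fun v => RtoC (p v) * c)%C t (RtoC dp * c)%C.
Proof.
  intros H. split.
  - apply is_derive_ext with (fun v => Re c * p v); [intros; Csimpl_goal; ring|].
    replace (Re (RtoC dp * c)%C) with (Re c * dp) by (Csimpl_goal; ring).
    apply is_derive_scal, H.
  - apply is_derive_ext with (fun v => Im c * p v); [intros; Csimpl_goal; ring|].
    replace (Im (RtoC dp * c)%C) with (Im c * dp) by (Csimpl_goal; ring).
    apply is_derive_scal, H.
Qed.

Lemma Cexp_line (z : C) (t : R) : is_RCder (fun t => Cexp (RtoC t * z)) t (z * Cexp (RtoC t * z))%C.
Proof.
  assert (E : forall v, (RtoC v * z)%C = (v * Re z, v * Im z)) by (intros; Ceq_ring).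
  rewrite E. split.
  - apply is_derive_ext with (fun v => exp (v * Re z) * cos (v * Im z)).
    + intros v. rewrite E. reflexivity.
    + auto_derive; auto. unfold Cexp, Cmult, Re, Im. simpl. ring.
  - apply is_derive_ext with (fun v => exp (v * Re z) * sin (v * Im z)).
    + intros v. rewrite E. reflexivity.
    + auto_derive; auto. unfold Cexp, Cmult, Re, Im. simpl. ring.
Qed.

(** Along [t -> t z], the derivative of each Taylor remainder is [z] times the preceding remainder
    at [t z]. The three bounds therefore follow from one another by [Cmean_value]; the factorials
    are given up, since only the orders matter. *)
Lemma Cexp_taylor1 (z : C) : Cmod (Cexp z - 1) <= Cmod z * exp (Cmod z).
Proof.
  replace (Cexp z - 1)%C with (Cexp (RtoC 1 * z) - Cexp (RtoC 0 * z))%C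
    by (rewrite Cmult_1_l, Cmult_0_l, Cexp_0; reflexivity).
  apply (Cmean_value (fun t => Cexp (RtoC t * z)) (fun t => z * Cexp (RtoC t * z))%C).
  - intros t _. apply Cexp_line.
  - intros t Ht. rewrite Cmod_mult, Cmod_Cexp. apply Rmult_le_compat_l; [apply Cmod_ge_0|].
    replace (Re (RtoC t * z)%C) with (t * Re z) by (Csimpl_goal; ring).
    apply exp_scal_Re_le, Ht.
Qed.

Lemma Cmod_scal_le (z : C) (t : R) : 0 <= t <= 1 -> Cmod (RtoC t * z) <= Cmod z.
Proof.
  intros Ht. rewrite Cmod_mult, Cmod_R, Rabs_right by lra. assert (H := Cmod_ge_0 z). nra.
Qed.

Lemma exp_le_compat (x y : R) : x <= y -> exp x <= exp y.
Proof. intros [H|H]; [left; apply exp_increasing, H|right; now rewrite H]. Qed.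

Lemma Cexp_taylor2 (z : C) : Cmod (Cexp z - 1 - z) <= Cmod z ^ 2 * exp (Cmod z).
Proof.
  replace (Cexp z - 1 - z)%C
    with ((Cexp (RtoC 1 * z) - RtoC 1 * z) - (Cexp (RtoC 0 * z) - RtoC 0 * z))%C
    by (rewrite !Cmult_1_l, !Cmult_0_l, Cexp_0; ring).
  apply (Cmean_value (fun t => Cexp (RtoC t * z) - RtoC t * z)%C
           (fun t => z * (Cexp (RtoC t * z) - 1))%C).
  - intros t _.
    replace (z * (Cexp (RtoC t * z) - 1))%C with (z * Cexp (RtoC t * z) - 1 * z)%C by ring.
    apply is_RCder_minus; [apply Cexp_line|].
    apply (is_RCder_scal (fun t => t)). auto_derive; auto.
  - intros t Ht. rewrite Cmod_mult. simpl. rewrite Rmult_1_r, Rmult_assoc.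
    apply Rmult_le_compat_l; [apply Cmod_ge_0|].
    eapply Rle_trans; [apply Cexp_taylor1|].
    assert (H := Cmod_scal_le z t Ht).
    apply Rmult_le_compat; [apply Cmod_ge_0|apply Rlt_le, exp_pos|exact H|apply exp_le_compat, H].
Qed.

Lemma Cexp_taylor3 (z : C) :
  Cmod (Cexp z - 1 - z - RtoC (/ 2) * (z * z)) <= Cmod z ^ 3 * exp (Cmod z).
Proof.
  replace (Cexp z - 1 - z - RtoC (/ 2) * (z * z))%C
    with ((Cexp (RtoC 1 * z) - RtoC 1 * z - RtoC (/ 2 * (1 * 1)) * (z * z))
          - (Cexp (RtoC 0 * z) - RtoC 0 * z - RtoC (/ 2 * (0 * 0)) * (z * z)))%C
    by (rewrite !Cmult_1_l, !Cmult_0_l, Cexp_0, !Rmult_0_r, !Rmult_1_r; ring).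
  apply (Cmean_value (fun t => Cexp (RtoC t * z) - RtoC t * z - RtoC (/ 2 * (t * t)) * (z * z))%C
           (fun t => z * (Cexp (RtoC t * z) - 1 - RtoC t * z))%C).
  - intros t _.
    replace (z * (Cexp (RtoC t * z) - 1 - RtoC t * z))%C
      with (z * Cexp (RtoC t * z) - 1 * z - RtoC t * (z * z))%C by ring.
    repeat apply is_RCder_minus; [apply Cexp_line| |].
    + apply (is_RCder_scal (fun t => t)). auto_derive; auto.
    + apply (is_RCder_scal (fun t => / 2 * (t * t))). auto_derive; auto. field.
  - intros t Ht. rewrite Cmod_mult.
    replace (Cmod z ^ 3 * exp (Cmod z)) with (Cmod z * (Cmod z ^ 2 * exp (Cmod z))) by ring.
    apply Rmult_le_compat_l; [apply Cmod_ge_0|].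
    eapply Rle_trans; [apply Cexp_taylor2|].
    assert (H := Cmod_scal_le z t Ht).
    apply Rmult_le_compat; [apply pow_le, Cmod_ge_0|apply Rlt_le, exp_pos| |apply exp_le_compat, H].
    apply pow_incr. split; [apply Cmod_ge_0|exact H].
Qed.

Lemma is_Cder_Cexp (s : C) : is_Cder Cexp s (Cexp s).
Proof.
  apply is_Cder_quadratic with (K := Cmod (Cexp s) * exp 1) (d := 1); [lra|].
  intros h Hh. rewrite Cexp_plus.
  replace (Cexp s * Cexp h - Cexp s - h * Cexp s)%C with (Cexp s * (Cexp h - 1 - h))%C by ring.
  rewrite Cmod_mult, Rmult_assoc. apply Rmult_le_compat_l; [apply Cmod_ge_0|].
  eapply Rle_trans; [apply Cexp_taylor2|]. rewrite Rmult_comm.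
  apply Rmult_le_compat_r; [apply pow_le, Cmod_ge_0|apply exp_le_compat; lra].
Qed.

(** * Calculus of differentiable functions *)

Lemma Cdiffable_const (c s : C) : Cdiffable (fun _ => c) s.
Proof. eexists. apply is_Cder_const. Qed.

Lemma Cdiffable_id (s : C) : Cdiffable (fun z => z) s.
Proof. eexists. apply is_Cder_id. Qed.

Lemma Cdiffable_plus (F G : C -> C) (s : C) :
  Cdiffable F s -> Cdiffable G s -> Cdiffable (fun z => F z + G z)%C s.
Proof. intros [D HD] [E HE]. eexists. apply is_Cder_plus; eassumption. Qed.

Lemma Cdiffable_mult (F G : C -> C) (s : C) :
  Cdiffable F s -> Cdiffable G s -> Cdiffable (fun z => F z * G z)%C s.
Proof. intros [D HD] [E HE]. eexists. apply is_Cder_mult; eassumption. Qed.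

Lemma is_Cder_opp (F : C -> C) (s D : C) : is_Cder F s D -> is_Cder (fun z => - F z)%C s (- D)%C.
Proof.
  intros H. apply (is_Cder_scal_l (- (1))%C) in H.
  replace (- D)%C with (- (1) * D)%C by ring.
  eapply is_Cder_ext; [|exact H]. intros z; simpl. ring.
Qed.

Lemma Cdiffable_opp (F : C -> C) (s : C) : Cdiffable F s -> Cdiffable (fun z => - F z)%C s.
Proof. intros [D HD]. eexists. apply is_Cder_opp; eassumption. Qed.

Lemma Cdiffable_minus (F G : C -> C) (s : C) :
  Cdiffable F s -> Cdiffable G s -> Cdiffable (fun z => F z - G z)%C s.
Proof. intros HF HG. apply Cdiffable_plus; [|apply Cdiffable_opp]; assumption. Qed.

Lemma Cdiffable_Cexp (F : C -> C) (s : C) : Cdiffable F s -> Cdiffable (fun z => Cexp (F z)) s.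
Proof. intros [D HD]. eexists. apply is_Cder_comp; [exact HD|apply is_Cder_Cexp]. Qed.

Lemma Cdiffable_inv (F : C -> C) (s : C) :
  F s <> 0 -> Cdiffable F s -> Cdiffable (fun z => / F z)%C s.
Proof. intros H0 [D HD]. eexists. apply is_Cder_comp; [exact HD|apply is_Cder_inv, H0]. Qed.

Lemma Cdiffable_div (F G : C -> C) (s : C) :
  G s <> 0 -> Cdiffable F s -> Cdiffable G s -> Cdiffable (fun z => F z / G z)%C s.
Proof. intros H0 HF HG. apply Cdiffable_mult; [|apply Cdiffable_inv]; assumption. Qed.

Lemma Cdiffable_comp (F G : C -> C) (s : C) :
  Cdiffable G s -> Cdiffable F (G s) -> Cdiffable (fun z => F (G z)) s.
Proof. intros [D HD] [E HE]. eexists. apply is_Cder_comp; eassumption. Qed.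

Lemma Cdiffable_ext (F G : C -> C) (s : C) :
  (forall z, F z = G z) -> Cdiffable F s -> Cdiffable G s.
Proof. intros H [D HD]. exists D. eapply is_Cder_ext; eassumption. Qed.

Lemma Cdiffable_ex_derive (F : C -> C) (s : C) :
  Cdiffable F s -> @ex_derive C_AbsRing C_NormedModule F s.
Proof. intros [D HD]. exists D. apply is_Cder_is_derive, HD. Qed.

(** Peels off the outermost operation by second-order matching. [Cdiff] leaves the non-vanishing of
    denominators and the functions it does not recognise. *)
Ltac Cdiff_step := match goal with
  | |- Cdiffable (fun _ => ?c) _ => apply (Cdiffable_const c)
  | |- Cdiffable (fun z => z) _ => apply Cdiffable_id
  | |- Cdiffable (fun z => @?f z + @?g z)%C _ => apply (Cdiffable_plus f g)
  | |- Cdiffable (fun z => @?f z - @?g z)%C _ => apply (Cdiffable_minus f g)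
  | |- Cdiffable (fun z => - @?f z)%C _ => apply (Cdiffable_opp f)
  | |- Cdiffable (fun z => @?f z * @?g z)%C _ => apply (Cdiffable_mult f g)
  | |- Cdiffable (fun z => @?f z / @?g z)%C _ => apply (Cdiffable_div f g)
  | |- Cdiffable (fun z => / @?f z)%C _ => apply (Cdiffable_inv f)
  | |- Cdiffable (fun z => Cexp (@?f z)) _ => apply (Cdiffable_Cexp f)
  end.
Ltac Cdiff := repeat Cdiff_step.

(** * Sine and cardinal sine *)

Definition Csin (z : C) : C := ((Cexp (Ci * z) - Cexp (- (Ci * z))) / (2 * Ci))%C.
Definition Ccos (z : C) : C := ((Cexp (Ci * z) + Cexp (- (Ci * z))) / 2)%C.

(** The value 1 at 0 makes [Csin z = z * Csinc z] hold everywhere with [Csinc] entire, so the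
    cancellation of a pole by a zero of the sine becomes an identity free of singularities. *)
Definition Csinc (z : C) : C :=
  if excluded_middle_informative (z = 0) then 1 else (Csin z / z)%C.

Lemma Csinc_0 : Csinc 0 = 1.
Proof. unfold Csinc. destruct (excluded_middle_informative (RtoC 0 = 0)) as [_|N]; [reflexivity|now elim N]. Qed.

Lemma Ci_neq_0 : Ci <> 0.
Proof. intros H. apply (f_equal Im) in H. simpl in H. lra. Qed.

Lemma Ctwo_neq_0 : RtoC 2 <> 0.
Proof. intros H. apply (f_equal Re) in H. simpl in H. lra. Qed.

Lemma RtoC_neq_0 (x : R) : x <> 0 -> RtoC x <> 0.
Proof. intros H E. apply H. exact (f_equal Re E). Qed.

Lemma Ci_sqr : (Ci * Ci)%C = (- (1))%C.
Proof. Ceq_ring. Qed.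

Lemma Csin_diffable (s : C) : Cdiffable Csin s.
Proof. unfold Csin. Cdiff. apply Cmult_neq_0; [apply Ctwo_neq_0|apply Ci_neq_0]. Qed.

(** The even terms of the two exponentials cancel. What is left is two third-order remainders
    divided by [2 i], hence the constant 1. *)
Lemma Csin_taylor (z : C) : Cmod (Csin z - z) <= Cmod z ^ 3 * exp (Cmod z).
Proof.
  set (w := (Ci * z)%C).
  assert (Hw : Cmod w = Cmod z) by (unfold w; rewrite Cmod_mult, Cmod_Ci; ring).
  assert (E : (Csin z - z)%C =
    (((Cexp w - 1 - w - RtoC (/ 2) * (w * w))
      - (Cexp (- w) - 1 - - w - RtoC (/ 2) * (- w * - w))) / (2 * Ci))%C).
  { unfold Csin. fold w. replace z with (2 * w / (2 * Ci))%C at 1.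
    - field; repeat split; auto using Ci_neq_0, Ctwo_neq_0.
    - unfold w. field; repeat split; auto using Ci_neq_0, Ctwo_neq_0. }
  rewrite E, Cmod_div by (apply Cmult_neq_0; [apply Ctwo_neq_0|apply Ci_neq_0]).
  rewrite Cmod_mult, Cmod_Ci, Cmod_R, Rabs_right, Rmult_1_r by lra.
  assert (H1 := Cexp_taylor3 w). assert (H2 := Cexp_taylor3 (- w)).
  rewrite Cmod_opp, Hw in H2. rewrite Hw in H1.
  assert (H3 := Cmod_triangle (Cexp w - 1 - w - RtoC (/ 2) * (w * w))
                 (- (Cexp (- w) - 1 - - w - RtoC (/ 2) * (- w * - w)))).
  rewrite Cmod_opp in H3. unfold Cminus at 1. lra.
Qed.

Lemma Csin_sinc (z : C) : Csin z = (z * Csinc z)%C.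
Proof.
  unfold Csinc. destruct (excluded_middle_informative (z = 0)) as [E|E].
  - subst z. unfold Csin. rewrite Cmult_0_r. replace (- 0)%C with (RtoC 0) by ring.
    unfold Cdiv. ring.
  - field. exact E.
Qed.

(** At 0 the third-order bound on [Csin h - h], divided by [h], is still quadratic, so the
    derivative there is 0. Elsewhere the quotient formula holds on the disc of radius [Cmod s],
    which avoids 0. *)
Lemma Csinc_diffable (s : C) : Cdiffable Csinc s.
Proof.
  destruct (excluded_middle_informative (s = 0)) as [E|E].
  - subst s. exists 0. apply is_Cder_quadratic with (K := exp 1) (d := 1); [lra|].
    intros h Hh. rewrite Cplus_0_l.
    unfold Csinc at 2. destruct (excluded_middle_informative _) as [_|N]; [|now elim N].
    unfold Csinc. destruct (excluded_middle_informative (h = 0)) as [E|E].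
    + subst h. replace (1 - 1 - 0 * 0)%C with (RtoC 0) by ring. rewrite Cmod_0.
      rewrite pow_i by lia. lra.
    + replace (Csin h / h - 1 - h * 0)%C with ((Csin h - h) / h)%C by (field; exact E).
      rewrite Cmod_div by exact E. assert (Hp := proj1 (Cmod_gt_0 h) E).
      apply Rmult_le_reg_r with (Cmod h); [exact Hp|].
      replace (Cmod (Csin h - h) / Cmod h * Cmod h) with (Cmod (Csin h - h)) by (field; lra).
      eapply Rle_trans; [apply Csin_taylor|].
      replace (exp 1 * Cmod h ^ 2 * Cmod h) with (Cmod h ^ 3 * exp 1) by ring.
      apply Rmult_le_compat_l; [apply pow_le; lra|apply exp_le_compat; lra].
  - assert (Hp := proj1 (Cmod_gt_0 s) E).
    destruct (Cdiffable_div Csin (fun z => z) s E (Csin_diffable s) (Cdiffable_id s)) as [D HD].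
    exists D. eapply is_Cder_ext_loc with (d := Cmod s); [exact Hp| |exact HD].
    intros h Hh. simpl. unfold Csinc.
    destruct (excluded_middle_informative (s + h = 0)%C) as [E2|E2]; [|reflexivity].
    exfalso. assert (H := Cmod_triangle_sub s (s + h)). rewrite E2, Cmod_0 in H.
    replace (s - 0)%C with (- h)%C in H by (rewrite <- E2; ring). rewrite Cmod_opp in H. lra.
Qed.

Lemma Csin_plus (x y : C) : Csin (x + y) = (Csin x * Ccos y + Ccos x * Csin y)%C.
Proof.
  unfold Csin, Ccos.
  replace (Ci * (x + y))%C with (Ci * x + Ci * y)%C by ring.
  replace (- (Ci * x + Ci * y))%C with (- (Ci * x) + - (Ci * y))%C by ring.
  rewrite !Cexp_plus. field; repeat split; auto using Ci_neq_0, Ctwo_neq_0.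
Qed.

Lemma Ccos_double (x : C) : Ccos (2 * x) = (1 - 2 * (Csin x * Csin x))%C.
Proof.
  unfold Csin, Ccos.
  replace (Ci * (2 * x))%C with (Ci * x + Ci * x)%C by ring.
  replace (- (Ci * x + Ci * x))%C with (- (Ci * x) + - (Ci * x))%C by ring.
  rewrite !Cexp_plus, !Cexp_opp.
  assert (H := Cexp_neq_0 (Ci * x)).
  set (e := Cexp (Ci * x)) in *.
  replace ((e - / e) / (2 * Ci) * ((e - / e) / (2 * Ci)))%C
    with ((e - / e) * (e - / e) / (4 * (Ci * Ci)))%C.
  - rewrite Ci_sqr. field. repeat split; auto; apply RtoC_neq_0; lra.
  - field. repeat split; auto using Ci_neq_0; apply RtoC_neq_0; lra.
Qed.

Lemma Csin_R (x : R) : Csin (RtoC x) = RtoC (sin x).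
Proof.
  unfold Csin, Cexp. Csimpl_goal.
  replace (0 * x - 1 * 0) with 0 by ring. replace (- (0 * 0 + 1 * x)) with (- x) by ring.
  replace (0 * 0 + 1 * x) with x by ring. rewrite Ropp_0, exp_0, cos_neg, sin_neg.
  apply Ceq; unfold Cinv; Csimpl_goal; field.
Qed.

Lemma Ccos_R (x : R) : Ccos (RtoC x) = RtoC (cos x).
Proof.
  unfold Ccos, Cexp. Csimpl_goal.
  replace (0 * x - 1 * 0) with 0 by ring. replace (- (0 * 0 + 1 * x)) with (- x) by ring.
  replace (0 * 0 + 1 * x) with x by ring. rewrite Ropp_0, exp_0, cos_neg, sin_neg.
  apply Ceq; unfold Cinv; Csimpl_goal; field.
Qed.

(** * Improper integrals over the half-line *)

Definition CInt (g : R -> C) (a b : R) : C :=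
  (RInt (fun u => Re (g u)) a b, RInt (fun u => Im (g u)) a b).

(** Continuity is part of the definition so that linearity needs no further integrability
    hypotheses. *)
Definition is_IInt (g : R -> C) (l : C) : Prop :=
  Ccont g /\ forall eps, 0 < eps -> exists B, forall b, B <= b -> Cmod (CInt g 0 b - l) < eps.

Lemma ex_RInt_Re (g : R -> C) (a b : R) : Ccont g -> ex_RInt (fun u => Re (g u)) a b.
Proof. intros H. apply @ex_RInt_continuous. intros; apply Ccont_Re, H. Qed.

Lemma ex_RInt_Im (g : R -> C) (a b : R) : Ccont g -> ex_RInt (fun u => Im (g u)) a b.
Proof. intros H. apply @ex_RInt_continuous. intros; apply Ccont_Im, H. Qed.

Lemma CInt_plus (f g : R -> C) (a b : R) : Ccont f -> Ccont g ->
  CInt (fun u => f u + g u)%C a b = (CInt f a b + CInt g a b)%C.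
Proof.
  intros Hf Hg. unfold CInt. apply Ceq; simpl.
  - apply (RInt_plus (fun u => Re (f u)) (fun u => Re (g u))); apply ex_RInt_Re; assumption.
  - apply (RInt_plus (fun u => Im (f u)) (fun u => Im (g u))); apply ex_RInt_Im; assumption.
Qed.

Lemma CInt_ext (f g : R -> C) (a b : R) :
  (forall u, Rmin a b < u < Rmax a b -> f u = g u) -> CInt f a b = CInt g a b.
Proof.
  intros H. unfold CInt. f_equal; apply RInt_ext; intros u Hu; rewrite H; auto.
Qed.

Lemma CInt_scal (c : C) (g : R -> C) (a b : R) : Ccont g ->
  CInt (fun u => c * g u)%C a b = (c * CInt g a b)%C.
Proof.
  intros Hg.
  assert (H1 := RInt_correct (fun u => Re (g u)) a b (ex_RInt_Re g a b Hg)).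
  assert (H2 := RInt_correct (fun u => Im (g u)) a b (ex_RInt_Im g a b Hg)).
  unfold CInt. apply Ceq; simpl; apply is_RInt_unique.
  - apply (is_RInt_minus (fun u => scal (Re c) (Re (g u))) (fun u => scal (Im c) (Im (g u))));
      apply (@is_RInt_scal R_NormedModule); assumption.
  - apply (is_RInt_plus (fun u => scal (Re c) (Im (g u))) (fun u => scal (Im c) (Re (g u))));
      apply (@is_RInt_scal R_NormedModule); assumption.
Qed.

Lemma CInt_Chasles (g : R -> C) (a b c : R) : Ccont g ->
  (CInt g a b + CInt g b c)%C = CInt g a c.
Proof.
  intros Hg. unfold CInt. apply Ceq; simpl.
  - apply (RInt_Chasles (fun u => Re (g u))); apply ex_RInt_Re; assumption.
  - apply (RInt_Chasles (fun u => Im (g u))); apply ex_RInt_Im; assumption.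
Qed.

(* Reduced to a real integral by projecting on the direction of the integral itself. *)
Lemma Cmod_CInt_le (g : R -> C) (h : R -> R) (a b : R) : a <= b -> Ccont g ->
  (forall u, continuous h u) -> (forall u, a <= u <= b -> Cmod (g u) <= h u) ->
  Cmod (CInt g a b) <= RInt h a b.
Proof.
  intros Hab Hg Hh H.
  set (w := CInt g a b).
  assert (E : Cmod w ^ 2 = Re (CInt (fun u => Cconj w * g u)%C a b)).
  { rewrite CInt_scal by assumption. fold w. rewrite Cmod2_alt.
    unfold Cconj. Csimpl_goal. ring. }
  assert (Hc : Ccont (fun u => Cconj w * g u)%C).
  { apply Ccont_mult; [apply Ccont_const|assumption]. }
  assert (exh : ex_RInt h a b) by (apply @ex_RInt_continuous; intros; apply Hh).
  assert (L : Re (CInt (fun u => Cconj w * g u)%C a b) <= Cmod w * RInt h a b).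
  { change (Cmod w * RInt h a b) with (scal (Cmod w) (RInt h a b)).
    rewrite <- (RInt_scal h) by assumption.
    apply (RInt_le (fun u => Re (Cconj w * g u)%C)).
    - assumption.
    - apply (ex_RInt_Re _ _ _ Hc).
    - apply @ex_RInt_scal; assumption.
    - intros u Hu. eapply Rle_trans; [apply Rle_abs|]. eapply Rle_trans; [apply re_le_Cmod|].
      rewrite Cmod_mult, Cmod_conj.
      apply Rmult_le_compat_l; [apply Cmod_ge_0|apply H; lra]. }
  assert (Hw := Cmod_ge_0 w).
  destruct (Req_dec (Cmod w) 0) as [E0|E0].
  - rewrite E0. apply RInt_ge_0; auto.
    intros u Hu. eapply Rle_trans; [apply Cmod_ge_0|apply H; lra].
  - nra.
Qed.

Lemma RInt_exp (K c a b : R) : 0 < c ->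
  RInt (fun u => K * exp (- c * u)) a b = K / c * (exp (- c * a) - exp (- c * b)).
Proof.
  intros Hc. apply is_RInt_unique.
  replace (K / c * (exp (- c * a) - exp (- c * b)))
    with (minus (- (K / c) * exp (- c * b)) (- (K / c) * exp (- c * a)))
    by (unfold minus, plus, opp; simpl; ring).
  apply (is_RInt_derive (fun u => - (K / c) * exp (- c * u))).
  - intros x _. auto_derive; auto. field. lra.
  - intros x _. apply @ex_derive_continuous. auto_derive. auto.
Qed.

Lemma Cmod_CInt_exp (g : R -> C) (K c a b : R) : 0 <= a <= b -> 0 < c -> Ccont g ->
  (forall u, 0 <= u -> Cmod (g u) <= K * exp (- c * u)) ->
  Cmod (CInt g a b) <= K / c * exp (- c * a).
Proof.
  intros Hab Hc Hg H.
  assert (HK : 0 <= K).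
  { assert (T := H 0 (Rle_refl 0)). assert (T2 := Cmod_ge_0 (g 0)).
    rewrite Rmult_0_r, exp_0 in T. lra. }
  eapply Rle_trans; [apply (Cmod_CInt_le g (fun u => K * exp (- c * u)))|].
  - lra.
  - assumption.
  - intros u. apply @ex_derive_continuous. auto_derive. auto.
  - intros u Hu. apply H. lra.
  - rewrite RInt_exp by assumption. apply Rmult_le_compat_l.
    + apply Rmult_le_pos; [lra|]. apply Rlt_le, Rinv_0_lt_compat, Hc.
    + assert (T := exp_pos (- c * b)). lra.
Qed.

(** From [1 + x <= exp x] at [x = c * b], which also dictates the choice of the threshold. *)
Lemma exp_decay_small (K c : R) : 0 < c ->
  forall eps, 0 < eps -> exists B, 0 <= B /\ forall b, B <= b -> K * exp (- c * b) < eps.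
Proof.
  intros Hc eps He. exists (Rabs K / eps / c).
  assert (HK := Rabs_pos K). assert (HK2 := Rle_abs K).
  split. { repeat apply Rmult_le_pos; try lra; apply Rlt_le, Rinv_0_lt_compat; lra. }
  intros b Hb.
  assert (E : Rabs K <= eps * (c * b)).
  { apply Rmult_le_compat_r with (r := c * eps) in Hb; [|apply Rmult_le_pos; lra].
    replace (Rabs K / eps / c * (c * eps)) with (Rabs K) in Hb by (field; lra). lra. }
  assert (T := exp_ineq1_le (c * b)). assert (Tp := exp_pos (c * b)).
  replace (- c * b) with (- (c * b)) by ring. rewrite exp_Ropp.
  apply Rmult_lt_reg_r with (exp (c * b)); [assumption|].
  rewrite Rmult_assoc, Rinv_l by lra. nra.
Qed.

Lemma ex_IInt_dom (g : R -> C) (K c : R) : 0 < c -> Ccont g ->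
  (forall u, 0 <= u -> Cmod (g u) <= K * exp (- c * u)) -> exists l, is_IInt g l.
Proof.
  intros Hc Hg H.
  assert (Cau : forall eps, 0 < eps -> exists B, 0 <= B /\ forall a b, B <= a -> a <= b ->
            Cmod (CInt g 0 b - CInt g 0 a) < eps).
  { intros eps He. destruct (exp_decay_small (K / c) c Hc eps He) as [B [HB0 HB]].
    exists B. split; [exact HB0|]. intros a b Ha Hab.
    rewrite <- (CInt_Chasles g 0 a b Hg).
    replace (CInt g 0 a + CInt g a b - CInt g 0 a)%C with (CInt g a b) by ring.
    eapply Rle_lt_trans; [apply (Cmod_CInt_exp g K c)|apply HB]; auto; lra. }
  (* Completeness is applied to the integer samples of the primitive, one component at a time; [Cau]
     then carries the limit over to real upper bounds. *)
  assert (Cau' : forall eps, 0 < eps -> exists N, forall n m, (N <= n)%nat -> (N <= m)%nat ->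
            Cmod (CInt g 0 (INR n) - CInt g 0 (INR m)) < eps).
  { intros eps He. destruct (Cau eps He) as [B [HB0 HB]].
    destruct (INR_archimed 1 B) as [N HN]; [lra|]. rewrite Rmult_1_r in HN.
    exists N. intros n m Hn Hm. apply le_INR in Hn. apply le_INR in Hm.
    destruct (Rle_dec (INR n) (INR m)).
    - rewrite Cmod_sub_sym. apply HB; lra.
    - apply HB; lra. }
  assert (Lr : ex_finite_lim_seq (fun n => Re (CInt g 0 (INR n)))).
  { apply ex_lim_seq_cauchy_corr. intros eps.
    destruct (Cau' eps (cond_pos eps)) as [N HN]. exists N. intros n m Hn Hm.
    eapply Rle_lt_trans; [|apply (HN n m Hn Hm)].
    eapply Rle_trans; [|apply re_le_Cmod]. right. f_equal. }
  assert (Li : ex_finite_lim_seq (fun n => Im (CInt g 0 (INR n)))).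
  { apply ex_lim_seq_cauchy_corr. intros eps.
    destruct (Cau' eps (cond_pos eps)) as [N HN]. exists N. intros n m Hn Hm.
    eapply Rle_lt_trans; [|apply (HN n m Hn Hm)].
    eapply Rle_trans; [|apply im_le_Cmod]. right. f_equal. }
  destruct Lr as [lr Lr]. destruct Li as [li Li].
  exists (lr, li). split; [assumption|]. intros eps He.
  apply is_lim_seq_spec in Lr. apply is_lim_seq_spec in Li.
  assert (He3 : 0 < eps / 3) by lra.
  destruct (Lr (mkposreal _ He3)) as [N1 H1]. destruct (Li (mkposreal _ He3)) as [N2 H2].
  destruct (Cau (eps / 3) He3) as [B [HB0 HB]].
  destruct (INR_archimed 1 B) as [N HN]; [lra|]. rewrite Rmult_1_r in HN.
  set (M := (N1 + N2 + N)%nat).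
  specialize (H1 M ltac:(unfold M; lia)). specialize (H2 M ltac:(unfold M; lia)). simpl in H1, H2.
  exists (INR M). intros b Hb.
  assert (HMB : B <= INR M).
  { apply Rlt_le. eapply Rlt_le_trans; [exact HN|]. apply le_INR. unfold M; lia. }
  specialize (HB (INR M) b HMB Hb).
  replace (CInt g 0 b - (lr, li))%C
    with ((CInt g 0 b - CInt g 0 (INR M)) + (CInt g 0 (INR M) - (lr, li)))%C by ring.
  eapply Rle_lt_trans; [apply Cmod_triangle|].
  set (A := CInt g 0 (INR M)) in *.
  assert (T := Cmod_le_Re_Im (A - (lr, li))).
  change (Re (A - (lr, li))%C) with (Re A - lr) in T.
  change (Im (A - (lr, li))%C) with (Im A - li) in T.
  change (Rabs (Re A - lr) < eps / 3) in H1. change (Rabs (Im A - li) < eps / 3) in H2.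
  lra.
Qed.

Lemma is_IInt_bound (g : R -> C) (l : C) (K c : R) : 0 < c ->
  (forall u, 0 <= u -> Cmod (g u) <= K * exp (- c * u)) -> is_IInt g l -> Cmod l <= K / c.
Proof.
  intros Hc H [Hg Hl]. apply Rnot_lt_le. intros N.
  destruct (Hl (Cmod l - K / c)) as [B HB]; [lra|].
  set (b := Rmax 0 B).
  assert (T := HB b (Rmax_r _ _)).
  assert (T2 := Cmod_CInt_exp g K c 0 b ltac:(split; [lra|apply Rmax_l]) Hc Hg H).
  rewrite Rmult_0_r, exp_0, Rmult_1_r in T2.
  rewrite Cmod_sub_sym in T. assert (T3 := Cmod_triangle_sub l (CInt g 0 b)). lra.
Qed.

Lemma is_IInt_ext (f g : R -> C) (l : C) : (forall u, f u = g u) -> is_IInt f l -> is_IInt g l.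
Proof.
  intros E [Hf Hl]. split; [eapply Ccont_ext; eassumption|].
  intros eps He. destruct (Hl eps He) as [B HB]. exists B. intros b Hb.
  rewrite <- (CInt_ext f g) by auto. apply HB, Hb.
Qed.

Lemma is_IInt_plus (f g : R -> C) (l m : C) :
  is_IInt f l -> is_IInt g m -> is_IInt (fun u => f u + g u)%C (l + m)%C.
Proof.
  intros [Hf Hl] [Hg Hm]. split; [apply Ccont_plus; assumption|].
  intros eps He. destruct (Hl (eps / 2)) as [B HB]; [lra|]. destruct (Hm (eps / 2)) as [B' HB']; [lra|].
  exists (Rmax B B'). intros b Hb.
  specialize (HB b (Rle_trans _ _ _ (Rmax_l _ _) Hb)).
  specialize (HB' b (Rle_trans _ _ _ (Rmax_r _ _) Hb)).
  rewrite CInt_plus by assumption.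
  replace (CInt f 0 b + CInt g 0 b - (l + m))%C
    with ((CInt f 0 b - l) + (CInt g 0 b - m))%C by ring.
  eapply Rle_lt_trans; [apply Cmod_triangle|]. lra.
Qed.

Lemma is_IInt_scal (c : C) (g : R -> C) (l : C) :
  is_IInt g l -> is_IInt (fun u => c * g u)%C (c * l)%C.
Proof.
  intros [Hg Hl]. split; [apply Ccont_mult; [apply Ccont_const|assumption]|].
  assert (Hc := Cmod_ge_0 c).
  intros eps He. destruct (Hl (eps / (Cmod c + 1))) as [B HB]; [apply Rdiv_lt_0_compat; lra|].
  exists B. intros b Hb. rewrite CInt_scal by assumption.
  replace (c * CInt g 0 b - c * l)%C with (c * (CInt g 0 b - l))%C by ring.
  rewrite Cmod_mult. specialize (HB b Hb). assert (T := Cmod_ge_0 (CInt g 0 b - l)).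
  apply Rmult_lt_compat_r with (r := Cmod c + 1) in HB; [|lra].
  replace (eps / (Cmod c + 1) * (Cmod c + 1)) with eps in HB by (field; lra). lra.
Qed.

Lemma is_IInt_minus (f g : R -> C) (l m : C) :
  is_IInt f l -> is_IInt g m -> is_IInt (fun u => f u - g u)%C (l - m)%C.
Proof.
  intros H1 H2. apply (is_IInt_scal (- (1))%C) in H2.
  assert (T := is_IInt_plus _ _ _ _ H1 H2).
  replace (l - m)%C with (l + - (1) * m)%C by ring.
  eapply is_IInt_ext; [|exact T]. intros u; simpl. ring.
Qed.

Lemma is_IInt_unique (g : R -> C) (l m : C) : is_IInt g l -> is_IInt g m -> l = m.
Proof.
  intros [_ Hl] [_ Hm]. replace l with ((l + - m) + m)%C by ring.
  enough (E : (l + - m)%C = 0) by (rewrite E; ring).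
  apply Cmod_eq_0. apply Rle_antisym; [|apply Cmod_ge_0].
  apply Rnot_lt_le. intros N. set (e := Cmod (l + - m)) in *.
  destruct (Hl (e / 2)) as [B HB]; [lra|]. destruct (Hm (e / 2)) as [B' HB']; [lra|].
  specialize (HB (Rmax B B') (Rmax_l _ _)). specialize (HB' (Rmax B B') (Rmax_r _ _)).
  assert (T := Cmod_triangle (l - CInt g 0 (Rmax B B')) (CInt g 0 (Rmax B B') - m)).
  replace (l - CInt g 0 (Rmax B B') + (CInt g 0 (Rmax B B') - m))%C with (l + - m)%C in T by ring.
  rewrite (Cmod_sub_sym l) in T. fold e in T. lra.
Qed.

Lemma CInt_FTC (g dg : R -> C) (a b : R) : Ccont dg ->
  (forall u, is_RCder g u (dg u)) -> CInt dg a b = (g b - g a)%C.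
Proof.
  intros Hc H. unfold CInt. apply Ceq; simpl.
  - rewrite (is_RInt_unique _ _ _ (minus (Re (g b)) (Re (g a)))); [reflexivity|].
    apply (is_RInt_derive (fun u => Re (g u))); intros; [apply H|apply Ccont_Re, Hc].
  - rewrite (is_RInt_unique _ _ _ (minus (Im (g b)) (Im (g a)))); [reflexivity|].
    apply (is_RInt_derive (fun u => Im (g u))); intros; [apply H|apply Ccont_Im, Hc].
Qed.

Lemma is_IInt_FTC (g dg : R -> C) (K c : R) : 0 < c -> Ccont dg ->
  (forall u, is_RCder g u (dg u)) ->
  (forall u, 0 <= u -> Cmod (g u) <= K * exp (- c * u)) -> is_IInt dg (- g 0)%C.
Proof.
  intros Hc Hd H Hb. split; [assumption|]. intros eps He.
  destruct (exp_decay_small K c Hc eps He) as [B [HB0 HB]]. exists B. intros b Hbb.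
  rewrite (CInt_FTC g dg) by assumption.
  replace (g b - g 0 - - g 0)%C with (g b) by ring.
  eapply Rle_lt_trans; [apply Hb; lra|apply HB, Hbb].
Qed.

Lemma is_IInt_comp_scal (g : R -> C) (l : C) (k : R) : 0 < k ->
  is_IInt g l -> is_IInt (fun u => RtoC k * g (k * u)%R)%C l.
Proof.
  intros Hk [Hg Hl].
  assert (Hg2 : Ccont (fun u => g (k * u))).
  { intros u eps He. destruct (Hg (k * u) eps He) as [d [Hd H]].
    exists (d / k). split; [apply Rdiv_lt_0_compat; lra|]. intros v Hv. apply H.
    replace (k * v - k * u) with (k * (v - u)) by ring.
    rewrite Rabs_mult, Rabs_right by lra.
    apply Rmult_lt_compat_l with (r := k) in Hv; [|lra].
    replace (k * (d / k)) with d in Hv by (field; lra). exact Hv. }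
  split; [apply Ccont_mult; [apply Ccont_const|exact Hg2]|].
  intros eps He. destruct (Hl eps He) as [B HB]. exists (B / k). intros b Hb.
  assert (HkB : B <= k * b).
  { apply Rmult_le_compat_l with (r := k) in Hb; [|lra].
    replace (k * (B / k)) with B in Hb by (field; lra). exact Hb. }
  replace (CInt (fun u => RtoC k * g (k * u)%R)%C 0 b) with (CInt g 0 (k * b)).
  { apply HB, HkB. }
  unfold CInt. f_equal.
  - assert (T := RInt_comp_lin (fun u => Re (g u)) k 0 0 b).
    rewrite Rmult_0_r, !Rplus_0_r in T. rewrite <- T by (apply ex_RInt_Re; assumption).
    apply RInt_ext. intros u _. rewrite Rplus_0_r. Csimpl_goal. unfold scal. simpl. unfold mult. simpl. ring.
  - assert (T := RInt_comp_lin (fun u => Im (g u)) k 0 0 b).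
    rewrite Rmult_0_r, !Rplus_0_r in T. rewrite <- T by (apply ex_RInt_Im; assumption).
    apply RInt_ext. intros u _. rewrite Rplus_0_r. Csimpl_goal. unfold scal. simpl. unfold mult. simpl. ring.
Qed.

(** * Laplace transforms *)

Lemma Ccont_exp_lin (p : C) : Ccont (fun u => Cexp (RtoC u * p)).
Proof. apply (Ccont_of_Cdiffable (fun z => Cexp (z * p))). intros u. Cdiff. Qed.

Lemma Cmod_exp_lin (p : C) (u : R) : Cmod (Cexp (RtoC u * p)) = exp (u * Re p).
Proof. rewrite Cmod_Cexp. f_equal. Csimpl_goal. ring. Qed.

Lemma is_Cder_exp_lin (p s : C) : is_Cder (fun z => Cexp (z * p)) s (Cexp (s * p) * p)%C.
Proof.
  assert (H := is_Cder_mult (fun z => z) (fun _ => p) s _ _ (is_Cder_id s) (is_Cder_const p s)).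
  cbv beta in H. replace (1 * p + s * 0)%C with p in H by ring.
  exact (is_Cder_comp Cexp (fun z => z * p)%C s _ _ H (is_Cder_Cexp _)).
Qed.

Lemma is_IInt_exp (p : C) : 0 < Re p -> is_IInt (fun u => Cexp (RtoC u * (- p))) (/ p)%C.
Proof.
  intros Hp.
  assert (Hp0 : p <> 0). { intros E. rewrite E in Hp. simpl in Hp. lra. }
  replace (/ p)%C with (- (- / p * Cexp (RtoC 0 * - p)))%C
    by (rewrite Cmult_0_l, Cexp_0; ring).
  apply (is_IInt_FTC (fun u => - / p * Cexp (RtoC u * - p))%C) with (K := Cmod (- / p)) (c := Re p).
  - assumption.
  - apply Ccont_exp_lin.
  - intros u.
    apply (is_RCder_of_Cder (fun z => - / p * Cexp (z * - p))%C).
    replace (Cexp (RtoC u * - p)) with (- / p * (Cexp (RtoC u * - p) * - p))%C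
      by (field; exact Hp0).
    apply is_Cder_scal_l, is_Cder_exp_lin.
  - intros u _. rewrite Cmod_mult, Cmod_exp_lin. right. f_equal. f_equal. Csimpl_goal; ring.
Qed.

Lemma u_exp_le (c u : R) : 0 < c -> 0 <= u -> u <= / c * exp (c * u).
Proof.
  intros Hc Hu. assert (T := exp_ineq1_le (c * u)).
  apply Rmult_le_reg_l with c; [assumption|].
  rewrite <- Rmult_assoc, Rinv_r, Rmult_1_l by lra. nra.
Qed.

Lemma u2_exp_le (c u : R) : 0 < c -> 0 <= u -> u ^ 2 <= (/ c) ^ 2 * exp (2 * c * u).
Proof.
  intros Hc Hu. replace (2 * c * u) with (c * u + c * u) by ring. rewrite exp_plus.
  assert (T := u_exp_le c u Hc Hu).
  replace ((/ c) ^ 2 * (exp (c * u) * exp (c * u))) with ((/ c * exp (c * u)) ^ 2) by ring.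
  apply pow_incr. lra.
Qed.

Lemma is_IInt_u_exp (p : C) : 0 < Re p ->
  is_IInt (fun u => RtoC u * Cexp (RtoC u * (- p)))%C (/ (p * p))%C.
Proof.
  intros Hp.
  assert (Hp0 : p <> 0). { intros E. rewrite E in Hp. simpl in Hp. lra. }
  set (G := fun z => (- / p * (z * Cexp (z * - p)) + - / (p * p) * Cexp (z * - p))%C).
  replace (/ (p * p))%C with (- G (RtoC 0))%C
    by (unfold G; rewrite !Cmult_0_l, Cexp_0; ring).
  apply (is_IInt_FTC (fun u => G (RtoC u)))
    (* Half of the decay rate [Re p] is spent on absorbing the factor [u] of the antiderivative. *)
    with (K := Cmod (/ p) * / (Re p / 2) + Cmod (/ (p * p))) (c := Re p / 2).
  - lra.
  - apply Ccont_mult; [|apply Ccont_exp_lin].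
    apply (Ccont_of_Cdiffable (fun z => z)). intros; apply Cdiffable_id.
  - intros u. apply (is_RCder_of_Cder G).
    assert (D := is_Cder_exp_lin (- p) u).
    unfold G.
    replace (u * Cexp (RtoC u * - p))%C
      with (- / p * (1 * Cexp (u * - p) + u * (Cexp (u * - p) * - p))
            + - / (p * p) * (Cexp (u * - p) * - p))%C
      by (field; exact Hp0).
    apply is_Cder_plus; apply is_Cder_scal_l; [|exact D].
    apply (is_Cder_mult (fun z => z) (fun z => Cexp (z * - p))); [apply is_Cder_id|apply D].
  - intros u Hu. unfold G. eapply Rle_trans; [apply Cmod_triangle|].
    rewrite !Cmod_mult, !Cmod_opp, Cmod_exp_lin, Cmod_R, Rabs_right by lra.
    replace (Re (- p)%C) with (- Re p) by (Csimpl_goal; ring).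
    replace (u * - Re p) with (- (Re p / 2) * u + - (Re p / 2) * u) by field.
    rewrite exp_plus.
    assert (T := u_exp_le (Re p / 2) u ltac:(lra) Hu).
    set (e := exp (- (Re p / 2) * u)).
    assert (E1 : exp (Re p / 2 * u) * e = 1).
    { unfold e. rewrite <- exp_plus. replace (Re p / 2 * u + - (Re p / 2) * u) with 0 by ring. apply exp_0. }
    assert (Ee : 0 < e <= 1).
    { split; [apply exp_pos|]. unfold e. rewrite <- exp_0. apply exp_le_compat. nra. }
    assert (A1 : u * (e * e) <= / (Re p / 2) * e).
    { assert (0 < e * e) by nra.
      apply Rle_trans with (/ (Re p / 2) * exp (Re p / 2 * u) * (e * e)).
      - apply Rmult_le_compat_r; lra.
      - right. transitivity (/ (Re p / 2) * (exp (Re p / 2 * u) * e) * e); [ring|]. rewrite E1. ring. }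
    assert (C1 := Cmod_ge_0 (/ p)). assert (C2 := Cmod_ge_0 (/ (p * p))).
    rewrite Rmult_plus_distr_r. apply Rplus_le_compat.
    + rewrite (Rmult_assoc (Cmod (/ p))). apply Rmult_le_compat_l; assumption.
    + apply Rmult_le_compat_l; [assumption|nra].
Qed.

(** Differentiation under the integral sign: the difference quotient minus the candidate
    [- u r(u) e^(- s u)] is bounded by [Cexp_taylor2] with a majorant that is integrable uniformly
    in [h]. *)
Lemma Laplace_exists (r : R -> C) (K c : R) : Ccont r ->
  (forall u, 0 <= u -> Cmod (r u) <= K * exp (- c * u)) ->
  exists L : C -> C, forall s, - c < Re s ->
    is_IInt (fun u => r u * Cexp (RtoC u * (- s)))%C (L s) /\ Cdiffable L s.
Proof.
  intros Hr HK.
  assert (K0 : 0 <= K).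
  { assert (T := HK 0 (Rle_refl 0)). assert (T2 := Cmod_ge_0 (r 0)).
    rewrite Rmult_0_r, exp_0 in T. lra. }
  assert (Hex : forall s, exists l, - c < Re s -> is_IInt (fun u => r u * Cexp (RtoC u * (- s)))%C l).
  { intros s. destruct (Rlt_dec (- c) (Re s)) as [Hs|Hs]; [|exists 0; intros; lra].
    destruct (ex_IInt_dom (fun u => r u * Cexp (RtoC u * (- s)))%C K (c + Re s)) as [l Hl].
    - lra.
    - apply Ccont_mult; [assumption|apply Ccont_exp_lin].
    - intros u Hu. rewrite Cmod_mult, Cmod_exp_lin.
      replace (- (c + Re s) * u) with (- c * u + u * Re (- s)%C) by (Csimpl_goal; ring).
      rewrite exp_plus, <- Rmult_assoc. apply Rmult_le_compat_r; [apply Rlt_le, exp_pos|auto].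
    - exists l. auto. }
  apply choice in Hex. destruct Hex as [L HL].
  exists L. intros s Hs. split; [apply HL, Hs|].
  (* The available decay rate is [4 q]. The factor [u] of the derivative costs [q], leaving [3 q];
     in the remainder, [u^2] and [e^(u |h|)] cost [q] each, leaving [2 q]. *)
  set (q := (c + Re s) / 4). assert (Hq : 0 < q) by (unfold q; lra).
  assert (Cu : Ccont (fun u => RtoC u)).
  { apply (Ccont_of_Cdiffable (fun z => z)). intros; apply Cdiffable_id. }
  destruct (ex_IInt_dom (fun u => - (1) * (RtoC u * (r u * Cexp (RtoC u * (- s)))))%C (K * / q) (3 * q)) as [D HD].
  - lra.
  - apply Ccont_mult; [apply Ccont_const|]. apply Ccont_mult; [exact Cu|].
    apply Ccont_mult; [assumption|apply Ccont_exp_lin].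
  - intros u Hu. rewrite !Cmod_mult, Cmod_exp_lin, Cmod_opp, Cmod_1, Cmod_R, Rabs_right by lra.
    replace (u * Re (- s)%C) with (c * u + - (4 * q) * u) by (unfold q; Csimpl_goal; field).
    rewrite exp_plus. rewrite Rmult_1_l.
    replace (K * / q * exp (- (3 * q) * u))
      with ((/ q * exp (q * u)) * (K * exp (- c * u) * (exp (c * u) * exp (- (4 * q) * u)))).
    + apply Rmult_le_compat; [assumption| |apply u_exp_le; lra|].
      * apply Rmult_le_pos; [apply Cmod_ge_0|]. apply Rmult_le_pos; apply Rlt_le, exp_pos.
      * apply Rmult_le_compat_r; [|auto]. apply Rmult_le_pos; apply Rlt_le, exp_pos.
    + replace (exp (- (3 * q) * u)) with (exp (q * u) * exp (- c * u) * exp (c * u) * exp (- (4 * q) * u)).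
      * ring.
      * rewrite <- !exp_plus. f_equal. ring.
  - exists D.
    apply is_Cder_quadratic with (K := K * (/ (q / 2)) ^ 2 / (2 * q)) (d := q); [assumption|].
    intros h Hh.
    assert (Hre : - c < Re (s + h)%C).
    { assert (T := re_le_Cmod h). assert (T2 := Rle_abs (- Re h)). rewrite Rabs_Ropp in T2.
      replace (Re (s + h)%C) with (Re s + Re h) by (Csimpl_goal; ring). unfold q in Hh. lra. }
    assert (I := is_IInt_minus _ _ _ _ (is_IInt_minus _ _ _ _ (HL _ Hre) (HL _ Hs)) (is_IInt_scal h _ _ HD)).
    replace (K * (/ (q / 2)) ^ 2 / (2 * q) * Cmod h ^ 2)
      with (K * (/ (q / 2)) ^ 2 * Cmod h ^ 2 / (2 * q)) by (field; lra).
    refine (is_IInt_bound _ _ _ _ _ _ I); [lra|].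
    intros u Hu.
    replace (r u * Cexp (RtoC u * - (s + h)) - r u * Cexp (RtoC u * - s)
             - h * (- (1) * (RtoC u * (r u * Cexp (RtoC u * - s)))))%C
      with (r u * (Cexp (RtoC u * - s) * (Cexp (RtoC u * - h) - 1 - RtoC u * - h)))%C.
    2:{ replace (RtoC u * - (s + h))%C with (RtoC u * - s + RtoC u * - h)%C by ring.
        rewrite Cexp_plus. ring. }
    rewrite !Cmod_mult, Cmod_exp_lin.
    assert (T := Cexp_taylor2 (RtoC u * - h)).
    rewrite Cmod_mult, Cmod_opp, Cmod_R, Rabs_right in T by lra.
    assert (T2 : exp (u * Cmod h) <= exp (q * u)).
    { apply exp_le_compat. nra. }
    assert (Hm := Cmod_ge_0 h).
    replace (u * Re (- s)%C) with (c * u + - (4 * q) * u) by (unfold q; Csimpl_goal; field).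
    rewrite exp_plus.
    assert (T3 := u2_exp_le (q / 2) u ltac:(lra) Hu).
    replace (2 * (q / 2) * u) with (q * u) in T3 by field.
    assert (T4 : Cmod (Cexp (RtoC u * - h) - 1 - RtoC u * - h)
                 <= ((/ (q / 2)) ^ 2 * exp (q * u)) * Cmod h ^ 2 * exp (q * u)).
    { eapply Rle_trans; [exact T|].
      apply Rmult_le_compat; [apply pow_le; nra|apply Rlt_le, exp_pos| |exact T2].
      rewrite Rpow_mult_distr. apply Rmult_le_compat_r; [apply pow_le; lra|exact T3]. }
    replace (K * (/ (q / 2)) ^ 2 * Cmod h ^ 2 * exp (- (2 * q) * u))
      with ((K * exp (- c * u)) * (exp (c * u) * exp (- (4 * q) * u)
            * (((/ (q / 2)) ^ 2 * exp (q * u)) * Cmod h ^ 2 * exp (q * u)))).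
    + apply Rmult_le_compat; [apply Cmod_ge_0| |auto|].
      * apply Rmult_le_pos; [|apply Cmod_ge_0]. apply Rmult_le_pos; apply Rlt_le, exp_pos.
      * apply Rmult_le_compat_l; [|exact T4]. apply Rmult_le_pos; apply Rlt_le, exp_pos.
    + replace (exp (- (2 * q) * u))
        with (exp (- c * u) * exp (c * u) * exp (- (4 * q) * u) * exp (q * u) * exp (q * u)).
      * ring.
      * rewrite <- !exp_plus. f_equal. ring.
Qed.

(** * Integrals over the line *)

(** The two half-lines must converge separately; this is not a principal value. *)
Definition is_BInt (g : R -> C) (l : C) : Prop :=
  exists l1 l2, is_IInt g l1 /\ is_IInt (fun u => g (- u)) l2 /\ l = (l1 + l2)%C.

Lemma is_BInt_ext (f g : R -> C) (l : C) : (forall u, f u = g u) -> is_BInt f l -> is_BInt g l.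
Proof.
  intros E (l1 & l2 & H1 & H2 & ->). exists l1, l2. split; [|split; [|reflexivity]].
  - eapply is_IInt_ext; eassumption.
  - eapply is_IInt_ext; [|exact H2]. intros u; apply E.
Qed.

Lemma is_BInt_plus (f g : R -> C) (l m : C) :
  is_BInt f l -> is_BInt g m -> is_BInt (fun u => f u + g u)%C (l + m)%C.
Proof.
  intros (l1 & l2 & H1 & H2 & ->) (m1 & m2 & H3 & H4 & ->).
  exists (l1 + m1)%C, (l2 + m2)%C. split; [|split; [|ring]].
  - apply is_IInt_plus; assumption.
  - apply (is_IInt_plus (fun u => f (- u)) (fun u => g (- u))); assumption.
Qed.

Lemma is_BInt_scal (c : C) (g : R -> C) (l : C) :
  is_BInt g l -> is_BInt (fun u => c * g u)%C (c * l)%C.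
Proof.
  intros (l1 & l2 & H1 & H2 & ->).
  exists (c * l1)%C, (c * l2)%C. split; [|split; [|ring]].
  - apply is_IInt_scal; assumption.
  - apply (is_IInt_scal c (fun u => g (- u))); assumption.
Qed.

Lemma is_BInt_minus (f g : R -> C) (l m : C) :
  is_BInt f l -> is_BInt g m -> is_BInt (fun u => f u - g u)%C (l - m)%C.
Proof.
  intros H1 H2. apply (is_BInt_scal (- (1))%C) in H2.
  assert (T := is_BInt_plus _ _ _ _ H1 H2).
  replace (l - m)%C with (l + - (1) * m)%C by ring.
  eapply is_BInt_ext; [|exact T]. intros u; simpl. ring.
Qed.

Lemma is_BInt_unique (g : R -> C) (l m : C) : is_BInt g l -> is_BInt g m -> l = m.
Proof.
  intros (l1 & l2 & H1 & H2 & ->) (m1 & m2 & H3 & H4 & ->).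
  rewrite (is_IInt_unique _ _ _ H1 H3), (is_IInt_unique _ _ _ H2 H4). reflexivity.
Qed.

Lemma is_BInt_bound (g : R -> C) (l : C) (K c : R) : 0 < c ->
  (forall u, Cmod (g u) <= K * exp (- c * Rabs u)) -> is_BInt g l -> Cmod l <= 2 * (K / c).
Proof.
  intros Hc H (l1 & l2 & H1 & H2 & ->).
  assert (B1 := is_IInt_bound g l1 K c Hc). assert (B2 := is_IInt_bound (fun u => g (- u)) l2 K c Hc).
  eapply Rle_trans; [apply Cmod_triangle|].
  assert (Cmod l1 <= K / c).
  { apply B1; [|assumption]. intros u Hu. specialize (H u). rewrite Rabs_right in H by lra. exact H. }
  assert (Cmod l2 <= K / c).
  { apply B2; [|assumption]. intros u Hu. specialize (H (- u)).
    rewrite Rabs_Ropp, Rabs_right in H by lra. exact H. }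
  lra.
Qed.

Lemma ex_BInt_dom (g : R -> C) (K c : R) : 0 < c -> Ccont g ->
  (forall u, Cmod (g u) <= K * exp (- c * Rabs u)) -> exists l, is_BInt g l.
Proof.
  intros Hc Hg H.
  destruct (ex_IInt_dom g K c Hc Hg) as [l1 H1].
  { intros u Hu. specialize (H u). rewrite Rabs_right in H by lra. exact H. }
  destruct (ex_IInt_dom (fun u => g (- u)) K c Hc (Ccont_opp_arg g Hg)) as [l2 H2].
  { intros u Hu. specialize (H (- u)). rewrite Rabs_Ropp, Rabs_right in H by lra. exact H. }
  exists (l1 + l2)%C, l1, l2. auto.
Qed.

Lemma is_BInt_comp_scal (g : R -> C) (l : C) (k : R) : 0 < k ->
  is_BInt g l -> is_BInt (fun u => RtoC k * g (k * u)%R)%C l.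
Proof.
  intros Hk (l1 & l2 & H1 & H2 & ->). exists l1, l2. split; [|split; [|reflexivity]].
  - apply is_IInt_comp_scal; assumption.
  - apply (is_IInt_comp_scal _ _ k Hk) in H2. eapply is_IInt_ext; [|exact H2].
    intros u; simpl. do 2 f_equal. ring.
Qed.

Lemma is_BInt_FTC (G dG : C -> C) (K c : R) : 0 < c ->
  (forall u : R, is_Cder G (RtoC u) (dG (RtoC u))) -> Ccont (fun u => dG (RtoC u)) ->
  (forall u : R, Cmod (G (RtoC u)) <= K * exp (- c * Rabs u)) ->
  is_BInt (fun u => dG (RtoC u)) 0.
Proof.
  intros Hc HG Hd H.
  exists (- G (RtoC 0))%C, (G (RtoC 0)). split; [|split; [|ring]].
  - apply (is_IInt_FTC (fun u => G (RtoC u))) with (K := K) (c := c); auto.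
    + intros u. apply is_RCder_of_Cder, HG.
    + intros u Hu. specialize (H u). rewrite Rabs_right in H by lra. exact H.
  - replace (G (RtoC 0)) with (- (- G (RtoC (- 0))))%C by (rewrite Ropp_0; ring).
    apply (is_IInt_FTC (fun u => - G (RtoC (- u)))%C) with (K := K) (c := c); auto.
    + apply (Ccont_opp_arg _ Hd).
    + intros u.
      assert (E : RtoC (- u) = (- RtoC u)%C) by Ceq_ring.
      assert (T : is_Cder (fun z => - G (- z))%C (RtoC u) (- (dG (RtoC (- u)) * - (1)))%C).
      { apply (is_Cder_opp (fun z => G (- z)%C)).
        apply (is_Cder_comp G (fun z => - z)%C).
        - apply (is_Cder_opp (fun z => z)), is_Cder_id.
        - rewrite <- E. apply HG. }
      replace (- (dG (RtoC (- u)) * - (1)))%C with (dG (RtoC (- u))) in T by ring.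
      apply is_RCder_of_Cder in T. destruct T as [T1 T2]. split.
      * eapply is_derive_ext; [|exact T1]. intros v; simpl. do 3 f_equal. Ceq_ring.
      * eapply is_derive_ext; [|exact T2]. intros v; simpl. do 3 f_equal. Ceq_ring.
    + intros u Hu. rewrite Cmod_opp. specialize (H (- u)).
      rewrite Rabs_Ropp, Rabs_right in H by lra. exact H.
Qed.

(** * The Mellin transform of [2 x / (x^2 + b)] *)

(* Integrand after [x = e^z]. *)
Definition mker (b s z : C) : C := (2 * Cexp (z * (2 - s)) / (Cexp (z * 2) + b))%C.

(** Quantifies that [- b] stays off the closed positive half-axis: the denominator is at least [m]
    times the maximum of 1 and [e^(2u)]. One bound serves [u < 0], the other [u > 0]. *)
Definition away (b : C) (m : R) : Prop :=
  forall u : R, m * exp (2 * u) <= Cmod (Cexp (RtoC u * 2) + b) /\ m <= Cmod (Cexp (RtoC u * 2) + b).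

Lemma Cexp_R2 (u : R) : Cexp (RtoC u * 2) = RtoC (exp (2 * u)).
Proof. rewrite <- Cexp_R. f_equal. Ceq_ring. Qed.

Lemma away_Re_nonneg (b : C) : 0 <= Re b -> b <> 0 -> away b (Rmin 1 (Cmod b)).
Proof.
  intros Hb Hb0 u. rewrite Cexp_R2. assert (He := exp_pos (2 * u)). set (x := exp (2 * u)) in *.
  assert (Hp := proj1 (Cmod_gt_0 b) Hb0).
  assert (H1 : x <= Cmod (RtoC x + b)).
  { eapply Rle_trans; [|apply re_le_Cmod]. eapply Rle_trans; [|apply Rle_abs].
    replace (Re (RtoC x + b)%C) with (x + Re b) by (Csimpl_goal; ring). lra. }
  assert (H2 : Cmod b <= Cmod (RtoC x + b)).
  { assert (E : Cmod b ^ 2 <= Cmod (RtoC x + b) ^ 2).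
    { rewrite !Cmod2_alt. replace (Re (RtoC x + b)%C) with (x + Re b) by (Csimpl_goal; ring).
      replace (Im (RtoC x + b)%C) with (Im b) by (Csimpl_goal; ring). nra. }
    assert (T := Cmod_ge_0 (RtoC x + b)). nra. }
  assert (M1 := Rmin_l 1 (Cmod b)). assert (M2 := Rmin_r 1 (Cmod b)).
  split; nra.
Qed.

(** The average of the two lower bounds for [b] absorbs the loss [m / 2]. This makes the transform
    available in a full disc around [b], even when [b] lies on the imaginary axis. *)
Lemma away_perturb (b h : C) (m : R) : away b m -> Cmod h <= m / 2 -> away (b + h) (m / 2).
Proof.
  intros Hb Hh u. destruct (Hb u) as [H1 H2].
  assert (T := Cmod_triangle_sub (Cexp (RtoC u * 2) + b) (- h)). rewrite Cmod_opp in T.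
  replace (Cexp (RtoC u * 2) + b - - h)%C with (Cexp (RtoC u * 2) + (b + h))%C in T by ring.
  split; lra.
Qed.

Lemma away_neq_0 (b : C) (m u : R) : 0 < m -> away b m -> (Cexp (RtoC u * 2) + b)%C <> 0.
Proof. intros Hm H. apply Cmod_gt_0. destruct (H u). lra. Qed.

(** The quotient decays like [e^(- u Re s)] at plus infinity and like [e^(u (2 - Re s))] at minus
    infinity, hence the strip [0 < Re s < 2] and the smaller of the two rates. *)
Lemma exp_quot_bound (b s : C) (m u : R) : 0 < m -> 0 < Re s < 2 -> away b m ->
  Cmod (Cexp (RtoC u * (2 - s)) / (Cexp (RtoC u * 2) + b))
  <= / m * exp (- Rmin (Re s) (2 - Re s) * Rabs u).
Proof.
  intros Hm Hs H. rewrite Cmod_div by (eapply away_neq_0; eassumption).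
  rewrite Cmod_exp_lin. replace (Re (2 - s)%C) with (2 - Re s) by (Csimpl_goal; ring).
  destruct (H u) as [H1 H2].
  assert (Hp := exp_pos (2 * u)).
  assert (M1 := Rmin_l (Re s) (2 - Re s)). assert (M2 := Rmin_r (Re s) (2 - Re s)).
  set (d := Cmod (Cexp (RtoC u * 2) + b)) in *. unfold Rdiv.
  destruct (Rle_dec 0 u) as [Hu|Hu].
  - rewrite Rabs_right by lra.
    apply Rle_trans with (exp (u * (2 - Re s)) * / (m * exp (2 * u))).
    + apply Rmult_le_compat_l; [apply Rlt_le, exp_pos|]. apply Rinv_le_contravar; [|assumption].
      apply Rmult_lt_0_compat; assumption.
    + rewrite Rinv_mult, <- exp_Ropp, (Rmult_comm (/ m)), <- Rmult_assoc, <- exp_plus, Rmult_comm.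
      apply Rmult_le_compat_l; [apply Rlt_le, Rinv_0_lt_compat, Hm|]. apply exp_le_compat. nra.
  - rewrite Rabs_left by lra.
    apply Rle_trans with (exp (u * (2 - Re s)) * / m).
    + apply Rmult_le_compat_l; [apply Rlt_le, exp_pos|]. apply Rinv_le_contravar; lra.
    + rewrite Rmult_comm. apply Rmult_le_compat_l; [apply Rlt_le, Rinv_0_lt_compat, Hm|].
      apply exp_le_compat. nra.
Qed.

Lemma mker_bound (b s : C) (m u : R) : 0 < m -> 0 < Re s < 2 -> away b m ->
  Cmod (mker b s (RtoC u)) <= 2 / m * exp (- Rmin (Re s) (2 - Re s) * Rabs u).
Proof.
  intros Hm Hs H. unfold mker. unfold Cdiv. rewrite <- Cmult_assoc.
  rewrite Cmod_mult, Cmod_R, Rabs_right by lra. unfold Rdiv. rewrite Rmult_assoc.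
  apply Rmult_le_compat_l; [lra|]. apply exp_quot_bound; assumption.
Qed.

Lemma mker_cont (b s : C) (m : R) : 0 < m -> away b m -> Ccont (fun u => mker b s (RtoC u)).
Proof.
  intros Hm H. apply (Ccont_of_Cdiffable (mker b s)). intros u. unfold mker.
  apply Cdiffable_div; [eapply away_neq_0; eassumption| |]; Cdiff.
Qed.

Lemma ex_mellin (b s : C) (m : R) : 0 < m -> 0 < Re s < 2 -> away b m ->
  exists l, is_BInt (fun u => mker b s (RtoC u)) l.
Proof.
  intros Hm Hs H. apply (ex_BInt_dom _ (2 / m) (Rmin (Re s) (2 - Re s))).
  - apply Rmin_pos; lra.
  - eapply mker_cont; eassumption.
  - intros u. apply mker_bound; assumption.
Qed.

(* Integrating [d/du (e^((2-s)u) / (e^(2u)+b))] relates the b-derivative of the transform to the transform itself. *)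
Lemma mellin_derivative (b s : C) (m : R) (l : C) : 0 < m -> 0 < Re s < 2 -> away b m -> b <> 0 ->
  is_BInt (fun u => mker b s (RtoC u)) l ->
  is_BInt (fun u => 2 * Cexp (RtoC u * (2 - s)) / ((Cexp (RtoC u * 2) + b) * (Cexp (RtoC u * 2) + b)))%C
    (s / 2 * l / b)%C.
Proof.
  intros Hm Hs H Hb Hl.
  set (G := fun z => (Cexp (z * (2 - s)) * / (Cexp (z * 2) + b))%C).
  set (dG := fun z => (Cexp (z * (2 - s)) * (2 - s) * / (Cexp (z * 2) + b)
    + Cexp (z * (2 - s)) * (- / ((Cexp (z * 2) + b) * (Cexp (z * 2) + b)) * (Cexp (z * 2) * 2 + 0)))%C).
  assert (F : is_BInt (fun u => dG (RtoC u)) 0).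
  { apply (is_BInt_FTC G dG (/ m) (Rmin (Re s) (2 - Re s))).
    - apply Rmin_pos; lra.
    - intros u. unfold G, dG.
      apply (is_Cder_mult (fun z => Cexp (z * (2 - s))) (fun z => / (Cexp (z * 2) + b))%C).
      + apply is_Cder_exp_lin.
      + apply (is_Cder_comp Cinv (fun z => Cexp (z * 2) + b)%C).
        * apply (is_Cder_plus (fun z => Cexp (z * 2)) (fun _ => b)); [apply is_Cder_exp_lin|apply is_Cder_const].
        * apply is_Cder_inv. eapply away_neq_0; eassumption.
    - apply Ccont_of_Cdiffable. intros u. unfold dG. assert (N := away_neq_0 b m u Hm H).
      Cdiff; [exact N|apply Cmult_neq_0; exact N].
    - intros u. apply exp_quot_bound; assumption. }
  apply (is_BInt_scal (s / 2)%C) in Hl.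
  assert (T := is_BInt_scal (/ b)%C _ _ (is_BInt_plus _ _ _ _ F Hl)).
  replace (s / 2 * l / b)%C with (/ b * (0 + s / 2 * l))%C
    by (field; repeat split; auto using Ctwo_neq_0).
  eapply is_BInt_ext; [|exact T]. intros u. simpl. unfold dG, mker.
  assert (N := away_neq_0 b m u Hm H).
  field. repeat split; auto using Ctwo_neq_0.
Qed.

Lemma mellin_function (s : C) : 0 < Re s < 2 -> exists Q : C -> C,
  (forall b m, 0 < m -> away b m -> is_BInt (fun u => mker b s (RtoC u)) (Q b)).
Proof.
  intros Hs.
  assert (Hex : forall b, exists l, (exists m, 0 < m /\ away b m) -> is_BInt (fun u => mker b s (RtoC u)) l).
  { intros b. destruct (excluded_middle_informative (exists m, 0 < m /\ away b m)) as [[m [Hm H]]|N].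
    - destruct (ex_mellin b s m Hm Hs H) as [l Hl]. exists l. auto.
    - exists 0. intros T. contradiction. }
  apply choice in Hex. destruct Hex as [Q HQ]. exists Q. intros b m Hm H. apply HQ. eauto.
Qed.

(** The equation [b Q' = - s / 2 Q], whose solutions are the multiples of [b^(- s / 2)].
    Differentiating in [b] squares the denominator, and [mellin_derivative] evaluates the resulting
    integral. *)
Lemma mellin_Cder (s b : C) (Q : C -> C) : 0 < Re s < 2 ->
  (forall b m, 0 < m -> away b m -> is_BInt (fun u => mker b s (RtoC u)) (Q b)) ->
  0 <= Re b -> b <> 0 -> is_Cder Q b (- (s / 2 * Q b / b))%C.
Proof.
  intros Hs HQ Hb Hb0.
  assert (Hp := proj1 (Cmod_gt_0 b) Hb0).
  set (m := Rmin 1 (Cmod b)). assert (Hm : 0 < m) by (apply Rmin_pos; lra).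
  assert (Ha : away b m) by (apply away_Re_nonneg; assumption).
  set (c := Rmin (Re s) (2 - Re s)). assert (Hc : 0 < c) by (apply Rmin_pos; lra).
  apply is_Cder_quadratic with (K := 2 * (2 / (m / 2) * / m * / m / c)) (d := m / 2); [lra|].
  intros h Hh.
  assert (Ha' : away (b + h) (m / 2)) by (apply away_perturb; [assumption|lra]).
  assert (Hm' : 0 < m / 2) by lra.
  assert (I := is_BInt_plus _ _ _ _ (is_BInt_minus _ _ _ _ (HQ _ _ Hm' Ha') (HQ _ _ Hm Ha))
            (is_BInt_scal h _ _ (mellin_derivative b s m (Q b) Hm Hs Ha Hb0 (HQ _ _ Hm Ha)))).
  replace (2 * (2 / (m / 2) * / m * / m / c) * Cmod h ^ 2)
    with (2 * (2 / (m / 2) * / m * / m * Cmod h ^ 2 / c)) by (unfold Rdiv; ring).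
  replace (Q (b + h)%C - Q b - h * - (s / 2 * Q b / b))%C
    with (Q (b + h)%C - Q b + h * (s / 2 * Q b / b))%C by ring.
  refine (is_BInt_bound _ _ _ _ Hc _ I).
  intros u. simpl.
  assert (N := away_neq_0 b m u Hm Ha). assert (N' := away_neq_0 (b + h) (m / 2) u Hm' Ha').
  (* With [D] the denominator at [b], this is the exact remainder [1 / (D + h) - 1 / D + h / D^2 =
     h^2 / ((D + h) D^2)]. *)
  replace (mker (b + h) s (RtoC u) - mker b s (RtoC u)
     + h * (2 * Cexp (RtoC u * (2 - s)) / ((Cexp (RtoC u * 2) + b) * (Cexp (RtoC u * 2) + b))))%C
    with (mker (b + h) s (RtoC u) * / (Cexp (RtoC u * 2) + b) * / (Cexp (RtoC u * 2) + b) * (h * h))%C.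
  2:{ unfold mker. field. repeat split; auto. }
  rewrite !Cmod_mult, Cmod_inv by assumption.
  destruct (Ha u) as [_ L]. apply Rinv_le_contravar in L; [|assumption].
  assert (P := mker_bound (b + h) s (m / 2) u Hm' Hs Ha'). fold c in P.
  assert (Hi : 0 <= / Cmod (Cexp (RtoC u * 2) + b)).
  { apply Rlt_le, Rinv_0_lt_compat, Cmod_gt_0, N. }
  apply Rle_trans with (2 / (m / 2) * exp (- c * Rabs u) * / m * / m * (Cmod h * Cmod h));
    [|right; ring].
  assert (P0 := Cmod_ge_0 (mker (b + h) s (RtoC u))).
  apply Rmult_le_compat_r; [apply Rmult_le_pos; apply Cmod_ge_0|].
  apply Rmult_le_compat; [apply Rmult_le_pos; assumption|assumption| |assumption].
  apply Rmult_le_compat; assumption.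
Qed.

(** Along [t -> e^(t a)] the differential equation makes [e^(t s a / 2) Q (e^(t a))] stationary, and
    [|Im a| <= pi / 2] keeps the path in the closed right half-plane. Parametrising by the logarithm
    [a] of [b] avoids any branch of the power. *)
Lemma mellin_rotate (s a : C) (Q : C -> C) : 0 < Re s < 2 ->
  (forall b m, 0 < m -> away b m -> is_BInt (fun u => mker b s (RtoC u)) (Q b)) ->
  - (PI / 2) <= Im a <= PI / 2 -> (Cexp (s / 2 * a) * Q (Cexp a))%C = Q 1.
Proof.
  intros Hs HQ Ha.
  set (Y := fun z => (Cexp (z * (s / 2 * a)) * Q (Cexp (z * a)))%C).
  assert (E : Cmod (Y (RtoC 1) - Y (RtoC 0))%C <= 0).
  { apply (Cmean_value (fun t => Y (RtoC t)) (fun _ => 0)); [|intros; rewrite Cmod_0; lra].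
    intros t Ht. apply is_RCder_of_Cder. unfold Y.
    set (e := Cexp (RtoC t * a)).
    assert (He : e <> 0) by apply Cexp_neq_0.
    assert (HRe : 0 <= Re e).
    { change (0 <= exp (Re (RtoC t * a)%C) * cos (Im (RtoC t * a)%C)).
      apply Rmult_le_pos; [apply Rlt_le, exp_pos|].
      replace (Im (RtoC t * a)%C) with (t * Im a) by (Csimpl_goal; ring).
      assert (P : Rabs (t * Im a) <= PI / 2).
      { rewrite Rabs_mult, (Rabs_right t) by lra.
        assert (A : Rabs (Im a) <= PI / 2) by (apply Rabs_le; lra).
        assert (A0 := Rabs_pos (Im a)). nra. }
      apply Rabs_le_between in P. apply cos_ge_0; lra. }
    replace (RtoC 0) with (Cexp (RtoC t * (s / 2 * a)) * (s / 2 * a) * Q e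
       + Cexp (RtoC t * (s / 2 * a)) * (- (s / 2 * Q e / e) * (e * a)))%C
      by (field; auto using Ctwo_neq_0).
    apply (is_Cder_mult (fun z => Cexp (z * (s / 2 * a))) (fun z => Q (Cexp (z * a)))).
    - apply is_Cder_exp_lin.
    - apply (is_Cder_comp Q (fun z => Cexp (z * a))); [apply is_Cder_exp_lin|].
      apply mellin_Cder; assumption. }
  assert (E0 : (Y (RtoC 1) - Y (RtoC 0))%C = 0).
  { apply Cmod_eq_0. apply Rle_antisym; [exact E|apply Cmod_ge_0]. }
  unfold Y in E0. rewrite !Cmult_1_l, !Cmult_0_l, Cexp_0, Cmult_1_l in E0.
  replace (Cexp (s / 2 * a) * Q (Cexp a))%C
    with ((Cexp (s / 2 * a) * Q (Cexp a) - Q 1) + Q 1)%C by ring.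
  rewrite E0. ring.
Qed.

Lemma Cexp_Ci (x : R) : Cexp (Ci * RtoC x) = (cos x, sin x).
Proof.
  unfold Cexp.
  replace (Re (Ci * RtoC x)%C) with 0 by (Csimpl_goal; ring).
  replace (Im (Ci * RtoC x)%C) with x by (Csimpl_goal; ring).
  rewrite exp_0, !Rmult_1_l. reflexivity.
Qed.

(* Doubling: [1/(y + i) + 1/(y - i) = 2y/(y^2 + 1)]. *)
Lemma mellin_double (s : C) (Q Q2 : C -> C) : 0 < Re s < 2 ->
  (forall b m, 0 < m -> away b m -> is_BInt (fun u => mker b s (RtoC u)) (Q b)) ->
  (forall b m, 0 < m -> away b m -> is_BInt (fun u => mker b (s / 2)%C (RtoC u)) (Q2 b)) ->
  (Csin (RtoC (PI / 2) * (s / 2)) * Q2 1 = Csin (RtoC (PI / 2) * s) * Q 1)%C.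
Proof.
  intros Hs HQ HQ2. assert (PP := PI_RGT_0).
  set (w := (Ci * RtoC (PI / 2))%C).
  assert (Ew : Cexp w = Ci).
  { unfold w. rewrite Cexp_Ci, cos_PI2, sin_PI2. reflexivity. }
  assert (Ew' : Cexp (- w) = (- Ci)%C).
  { rewrite Cexp_opp, Ew. apply Ceq; unfold Cinv; Csimpl_goal; field. }
  assert (I1 : (Cexp (s / 2 * w) * Q Ci)%C = Q 1).
  { rewrite <- Ew. apply mellin_rotate; auto. unfold w. Csimpl_goal; lra. }
  assert (I2 : (Cexp (s / 2 * - w) * Q (- Ci))%C = Q 1).
  { rewrite <- Ew'. apply mellin_rotate; auto. unfold w. Csimpl_goal; lra. }
  assert (A1 : away Ci (Rmin 1 (Cmod Ci))).
  { apply away_Re_nonneg; [simpl; lra|apply Ci_neq_0]. }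
  assert (N2 : (- Ci)%C <> 0).
  { intros E. apply Ci_neq_0. replace Ci with (- - Ci)%C by ring. rewrite E. ring. }
  assert (A2 : away (- Ci) (Rmin 1 (Cmod (- Ci)))).
  { apply away_Re_nonneg; [simpl; lra|assumption]. }
  assert (A3 : away 1 (Rmin 1 (Cmod 1))).
  { apply away_Re_nonneg; [simpl; lra|apply RtoC_neq_0; lra]. }
  rewrite Cmod_opp, Cmod_Ci, Rmin_left in A2 by lra.
  rewrite Cmod_Ci, Rmin_left in A1 by lra. rewrite Cmod_1, Rmin_left in A3 by lra.
  assert (D : (Q Ci + Q (- Ci))%C = Q2 1).
  { apply (is_BInt_unique (fun u => mker Ci s (RtoC u) + mker (- Ci) s (RtoC u))%C).
    - apply is_BInt_plus; [apply (HQ Ci 1)|apply (HQ (- Ci)%C 1)]; auto; lra.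
    - eapply is_BInt_ext; [|apply (is_BInt_comp_scal _ _ 2 ltac:(lra) (HQ2 1 1 Rlt_0_1 A3))].
      intros u. simpl. unfold mker.
      assert (M1 := away_neq_0 Ci 1 u Rlt_0_1 A1).
      assert (M2 := away_neq_0 (- Ci) 1 u Rlt_0_1 A2).
      assert (M3 := away_neq_0 1 1 (2 * u) Rlt_0_1 A3).
      replace (RtoC (2 * u) * (2 - s / 2))%C with (RtoC u * (2 - s) + RtoC u * 2)%C
        by (rewrite RtoC_mult; field; apply Ctwo_neq_0).
      replace (RtoC (2 * u) * 2)%C with (RtoC u * 2 + RtoC u * 2)%C in *
        by (rewrite RtoC_mult; ring).
      rewrite !Cexp_plus in *.
      set (y := Cexp (RtoC u * 2)) in *.
      replace (y * y + 1)%C with ((y + Ci) * (y + - Ci))%C in *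
        by (replace (RtoC 1) with (- (Ci * Ci))%C by (rewrite Ci_sqr; ring); ring).
      field. split; assumption. }
  rewrite <- D.
  (* Here [e = e^(i pi s / 4)]. Since [Q Ci = Q 1 / e] and [Q (- Ci) = e * Q 1], the sum is
     [2 cos (pi s / 4) Q 1], and the claim is the duplication formula for the sine. *)
  set (e := Cexp (s / 2 * w)) in *.
  assert (He : e <> 0) by apply Cexp_neq_0.
  assert (He' : Cexp (s / 2 * - w) = (/ e)%C).
  { replace (s / 2 * - w)%C with (- (s / 2 * w))%C by (field; apply Ctwo_neq_0). apply Cexp_opp. }
  rewrite He' in I2.
  replace (Q Ci) with (/ e * Q 1)%C by (rewrite <- I1; field; exact He).
  replace (Q (- Ci)%C) with (e * Q 1)%C by (rewrite <- I2; field; exact He).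
  unfold Csin.
  replace (Ci * (RtoC (PI / 2) * (s / 2)))%C with (s / 2 * w)%C by (unfold w; field; apply Ctwo_neq_0).
  replace (Ci * (RtoC (PI / 2) * s))%C with (s / 2 * w + s / 2 * w)%C by (unfold w; field; apply Ctwo_neq_0).
  rewrite !Cexp_opp, !Cexp_plus. fold e.
  field. repeat split; auto using Ci_neq_0, Ctwo_neq_0.
Qed.

(** On [u > 0] the kernel differs from [2 e^(- s u)] by at most [2 e^(- 2 u)], which costs 1; on
    [u < 0] it is at most [2 e^(- |u|)] because [Re s <= 1], which costs 2. *)
Lemma mellin_small (s : C) (l : C) : 0 < Re s <= 1 ->
  is_BInt (fun u => mker 1 s (RtoC u)) l -> Cmod (l - 2 / s) <= 3.
Proof.
  intros Hs (l1 & l2 & H1 & H2 & ->).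
  assert (Hs0 : s <> 0). { intros E. rewrite E in Hs. simpl in Hs. lra. }
  assert (A3 : away 1 (Rmin 1 (Cmod 1))).
  { apply away_Re_nonneg; [simpl; lra|apply RtoC_neq_0; lra]. }
  rewrite Cmod_1, Rmin_left in A3 by lra.
  assert (B2 : Cmod l2 <= 2 / 1).
  { refine (is_IInt_bound _ _ _ _ Rlt_0_1 _ H2). intros u Hu.
    unfold mker, Cdiv. rewrite !Cmod_mult, Cmod_R, Cmod_exp_lin, Rabs_right by lra.
    rewrite Cmod_inv by (eapply away_neq_0; [apply Rlt_0_1|exact A3]).
    replace (Re (2 - s)%C) with (2 - Re s) by (Csimpl_goal; ring).
    destruct (A3 (- u)) as [_ L]. apply Rinv_le_contravar in L; [|lra]. rewrite Rinv_1 in L.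
    rewrite Rmult_assoc. apply Rmult_le_compat_l; [lra|].
    rewrite <- Rmult_1_r.
    apply Rmult_le_compat; [apply Rlt_le, exp_pos| | |exact L].
    - apply Rlt_le, Rinv_0_lt_compat, Cmod_gt_0. eapply away_neq_0; [apply Rlt_0_1|exact A3].
    - apply exp_le_compat. nra. }
  assert (I := is_IInt_minus _ _ _ _ H1 (is_IInt_scal 2 _ _ (is_IInt_exp s ltac:(lra)))).
  assert (B1 : Cmod (l1 - 2 * / s) <= 2 / 2).
  { refine (is_IInt_bound _ _ 2 2 ltac:(lra) _ I). intros u Hu. simpl.
    assert (M3 := away_neq_0 1 1 u Rlt_0_1 A3).
    replace (mker 1 s (RtoC u) - 2 * Cexp (RtoC u * - s))%C
      with (- (RtoC 2) * Cexp (RtoC u * - s) * / (Cexp (RtoC u * 2) + 1))%C.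
    2:{ unfold mker. replace (RtoC u * (2 - s))%C with (RtoC u * 2 + RtoC u * - s)%C by ring.
        rewrite Cexp_plus. field. exact M3. }
    rewrite !Cmod_mult, Cmod_opp, Cmod_R, Cmod_exp_lin, Rabs_right by lra.
    rewrite Cmod_inv by exact M3.
    replace (Re (- s)%C) with (- Re s) by (Csimpl_goal; ring).
    destruct (A3 u) as [L _].
    assert (P := exp_pos (2 * u)).
    apply Rinv_le_contravar in L; [|lra].
    rewrite Rmult_1_l, <- exp_Ropp in L.
    rewrite Rmult_assoc. apply Rmult_le_compat_l; [lra|].
    replace (- (2) * u) with (- (2 * u)) by ring.
    rewrite <- (Rmult_1_l (exp (- (2 * u)))).
    apply Rmult_le_compat; [apply Rlt_le, exp_pos| | |exact L].
    - apply Rlt_le, Rinv_0_lt_compat, Cmod_gt_0, M3.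
    - rewrite <- exp_0. apply exp_le_compat. nra. }
  replace (l1 + l2 - 2 / s)%C with ((l1 - 2 * / s) + l2)%C by (field; exact Hs0).
  eapply Rle_trans; [apply Cmod_triangle|]. lra.
Qed.

(* [Csin (pi s / 2) Q(1, s)] is invariant under [s -> s / 2] and tends to [pi] at 0. *)
Lemma mellin_one (s l : C) : 0 < Re s < 2 ->
  is_BInt (fun u => mker 1 s (RtoC u)) l -> (Csin (RtoC (PI / 2) * s) * l)%C = RtoC PI.
Proof.
  intros Hs Hl.
  assert (PP := PI_RGT_0).
  assert (A3 : away 1 (Rmin 1 (Cmod 1))).
  { apply away_Re_nonneg; [simpl; lra|apply RtoC_neq_0; lra]. }
  rewrite Cmod_1, Rmin_left in A3 by lra.
  assert (Hn : forall n, exists w k, 0 < Re w < 2 /\ Cmod w = Cmod s / 2 ^ n /\ Re w = Re s / 2 ^ n /\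
    is_BInt (fun u => mker 1 w (RtoC u)) k /\
    (Csin (RtoC (PI / 2) * w) * k = Csin (RtoC (PI / 2) * s) * l)%C).
  { induction n as [|n (w & k & Hw & E1 & E2 & Hk & E)].
    - exists s, l. simpl. repeat split; try tauto; lra.
    - assert (Hre : Re (w / 2)%C = Re w / 2) by (unfold Cinv; Csimpl_goal; field).
      assert (Hw2 : 0 < Re (w / 2)%C < 2) by (rewrite Hre; lra).
      destruct (mellin_function w Hw) as [Q HQ].
      destruct (mellin_function (w / 2) Hw2) as [Q2 HQ2].
      exists (w / 2)%C, (Q2 1).
      split; [exact Hw2|]. split; [|split; [|split]].
      + rewrite Cmod_div by apply Ctwo_neq_0. rewrite E1, Cmod_R, Rabs_right by lra.
        simpl. field. apply pow_nonzero; lra.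
      + rewrite Hre, E2. simpl. field. apply pow_nonzero; lra.
      + apply (HQ2 1 1); auto; lra.
      + rewrite (mellin_double w Q Q2 Hw HQ HQ2), <- E.
        rewrite (is_BInt_unique _ _ _ (HQ 1 1 Rlt_0_1 A3) Hk). reflexivity. }
  set (P := (Csin (RtoC (PI / 2) * s) * l)%C) in *.
  replace P with ((P - RtoC PI) + RtoC PI)%C by ring.
  enough (E0 : (P - RtoC PI)%C = 0) by (rewrite E0; ring).
  apply Cmod_eq_0. apply Rle_antisym; [|apply Cmod_ge_0].
  apply le_epsilon. intros eps He. rewrite Rplus_0_l.
  destruct (Csinc_diffable 0) as [D HD].
  destruct (is_Cder_continuous Csinc 0 D HD (Rmin 1 (eps / 2 / PI))) as [d [Hd Hc]].
  { apply Rmin_pos; [lra|]. apply Rdiv_lt_0_compat; lra. }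
  (* The bound [1 / 2] gives [Re w <= 1]; [d / 4] keeps [pi / 2 * |w|] below [d], as [pi <= 4]; the
     last bound gives [2 * |w| * 2 * 3 <= eps / 2], with 2 for [Cmod S] and 3 from
     [mellin_small]. *)
  set (r := Rmin (1 / 2) (Rmin (d / 4) (eps / 2 / 12))).
  assert (Hr : 0 < r) by (repeat apply Rmin_pos; lra).
  assert (Hs1 := Cmod_ge_0 s).
  destruct (pow_lt_1_zero (/ 2)) with (y := r / (Cmod s + 1)) as [n Hnn].
  { rewrite Rabs_right; lra. }
  { apply Rdiv_lt_0_compat; lra. }
  specialize (Hnn n (Nat.le_refl n)).
  assert (Hi : 0 < (/ 2) ^ n) by (apply pow_lt; lra).
  rewrite Rabs_right in Hnn by lra.
  destruct (Hn n) as (w & k & Hw & E1 & E2 & Hk & E). rewrite <- E.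
  assert (Hwr : Cmod w < r).
  { rewrite E1. unfold Rdiv. rewrite <- pow_inv.
    apply Rmult_lt_compat_l with (r := Cmod s + 1) in Hnn; [|lra].
    replace ((Cmod s + 1) * (r / (Cmod s + 1))) with r in Hnn by (field; lra). nra. }
  assert (R1 : r <= 1 / 2) by apply Rmin_l.
  assert (R2 : r <= d / 4) by (eapply Rle_trans; [apply Rmin_r|apply Rmin_l]).
  assert (R3 : r <= eps / 2 / 12) by (eapply Rle_trans; [apply Rmin_r|apply Rmin_r]).
  assert (Hw0 : w <> 0). { intros E0. rewrite E0 in Hw. simpl in Hw. lra. }
  assert (Hw1 : Re w <= 1).
  { assert (T := re_le_Cmod w). assert (T2 := Rle_abs (Re w)). lra. }
  assert (B := mellin_small w k ltac:(lra) Hk).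
  rewrite Csin_sinc.
  set (S := Csinc (RtoC (PI / 2) * w)).
  assert (P4 := PI_4).
  assert (HS : Cmod (S - 1) < Rmin 1 (eps / 2 / PI)).
  { rewrite <- Csinc_0. specialize (Hc (RtoC (PI / 2) * w)%C). rewrite Cplus_0_l in Hc. apply Hc.
    rewrite Cmod_mult, Cmod_R, Rabs_right by lra. assert (Hm := Cmod_ge_0 w). nra. }
  assert (HS1 := Rlt_le_trans _ _ _ HS (Rmin_l _ _)).
  assert (HS2 := Rlt_le_trans _ _ _ HS (Rmin_r _ _)).
  replace (RtoC (PI / 2) * w * S * k - RtoC PI)%C
    with (RtoC PI * (S - 1) + RtoC (PI / 2) * w * S * (k - 2 / w))%C.
  2:{ replace (RtoC PI) with (RtoC (PI / 2) * 2)%C by (apply Ceq; Csimpl_goal; field).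
      field. exact Hw0. }
  eapply Rle_trans; [apply Cmod_triangle|].
  rewrite !Cmod_mult, !Cmod_R, !Rabs_right by lra.
  assert (C1 : PI * Cmod (S - 1) <= eps / 2).
  { apply Rmult_lt_compat_l with (r := PI) in HS2; [|lra].
    replace (PI * (eps / 2 / PI)) with (eps / 2) in HS2 by (field; lra). lra. }
  assert (C2 : Cmod S <= 2).
  { assert (T := Cmod_triangle_sub S 1). rewrite Cmod_1 in T. lra. }
  assert (C3 : PI / 2 * Cmod w * Cmod S * Cmod (k - 2 / w) <= 2 * (eps / 2 / 12) * 2 * 3).
  { assert (Hm := Cmod_ge_0 w). assert (HmS := Cmod_ge_0 S). assert (Hmk := Cmod_ge_0 (k - 2 / w)).
    apply Rmult_le_compat; [|lra| |lra].
    - apply Rmult_le_pos; [|lra]. apply Rmult_le_pos; lra.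
    - apply Rmult_le_compat; [apply Rmult_le_pos; lra|lra| |lra].
      apply Rmult_le_compat; lra. }
  lra.
Qed.

(* [a] plays the role of [log b]. *)
Lemma mellin_transform (s a : C) : 0 < Re s < 2 -> - (PI / 2) <= Im a <= PI / 2 ->
  exists l, is_BInt (fun u => mker (Cexp a) s (RtoC u)) l /\
    (Csin (RtoC (PI / 2) * s) * l)%C = (RtoC PI * Cexp (- (s / 2 * a)))%C.
Proof.
  intros Hs Ha. destruct (mellin_function s Hs) as [Q HQ].
  assert (A3 : away 1 (Rmin 1 (Cmod 1))).
  { apply away_Re_nonneg; [simpl; lra|apply RtoC_neq_0; lra]. }
  rewrite Cmod_1, Rmin_left in A3 by lra.
  assert (N : Cexp a <> 0) by apply Cexp_neq_0.
  assert (A : away (Cexp a) (Rmin 1 (Cmod (Cexp a)))).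
  { apply away_Re_nonneg; [|assumption]. unfold Cexp; simpl.
    apply Rmult_le_pos; [apply Rlt_le, exp_pos|]. apply cos_ge_0; lra. }
  exists (Q (Cexp a)). split.
  - apply (HQ _ (Rmin 1 (Cmod (Cexp a)))); [|assumption].
    apply Rmin_pos; [lra|apply Cmod_gt_0, N].
  - assert (E := mellin_rotate s a Q Hs HQ Ha).
    rewrite <- (mellin_one s (Q 1) Hs (HQ 1 1 Rlt_0_1 A3)), <- E.
    rewrite Cexp_opp. field. apply Cexp_neq_0.
Qed.

(** * Complex series *)

Lemma is_Cseries_spec (a : nat -> C) (l : C) : is_Cseries a l <->
  (forall eps, 0 < eps -> exists N, forall n, (N <= n)%nat -> Cmod (sum_n a n - l)%C < eps).
Proof.
  split.
  - intros H eps He.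
    destruct (H (fun z : C => Cmod (z - l)%C < eps)) as [N HN].
    + apply (@locally_le_locally_norm C_AbsRing C_NormedModule l).
      exact (@locally_norm_ball_norm C_AbsRing C_NormedModule l (mkposreal eps He)).
    + exists N. intros n Hn. apply HN, Hn.
  - intros H P [d Hd].
    destruct (H d (cond_pos d)) as [N HN]. exists N. intros n Hn.
    apply Hd. apply C_NormedModule_mixin_compat1. apply HN, Hn.
Qed.

Lemma is_Cseries_scal (c : C) (a : nat -> C) (l : C) :
  is_Cseries a l -> is_Cseries (fun k => c * a k)%C (c * l)%C.
Proof. intros H. exact (is_series_scal c a l H). Qed.

Lemma is_Cseries_ext (a b : nat -> C) (l : C) :
  (forall k, a k = b k) -> is_Cseries a l -> is_Cseries b l.
Proof. intros E H. exact (is_series_ext a b l E H). Qed.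

Lemma is_Cseries_minus (a b : nat -> C) (l m : C) :
  is_Cseries a l -> is_Cseries b m -> is_Cseries (fun k => a k - b k)%C (l - m)%C.
Proof. intros H1 H2. exact (is_series_minus a b l m H1 H2). Qed.

Lemma is_Cseries_unique (a : nat -> C) (l m : C) : is_Cseries a l -> is_Cseries a m -> l = m.
Proof.
  intros H1 H2.
  exact (@filterlim_locally_unique _ C_AbsRing C_NormedModule eventually _ (sum_n a) l m H1 H2).
Qed.

Lemma ex_Cseries_dom (a : nat -> C) (b : nat -> R) :
  (forall k, Cmod (a k) <= b k) -> ex_series b -> exists l, is_Cseries a l.
Proof. intros H Hb. exact (@ex_series_le C_AbsRing C_CompleteNormedModule a b H Hb). Qed.

Lemma ex_series_Rscal (c : R) (b : nat -> R) : ex_series b -> ex_series (fun k => c * b k).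
Proof. intros H. exact (ex_series_scal c b H). Qed.

Lemma sum_n_CS (a : nat -> C) (n : nat) : sum_n a (S n) = (sum_n a n + a (S n))%C.
Proof. exact (sum_Sn a n). Qed.

Lemma sum_n_RS (a : nat -> R) (n : nat) : sum_n a (S n) = sum_n a n + a (S n).
Proof. exact (sum_Sn a n). Qed.

Lemma sum_n_C0 (a : nat -> C) : sum_n a 0 = a 0%nat.
Proof. exact (sum_O a). Qed.

Lemma sum_n_R0 (a : nat -> R) : sum_n a 0 = a 0%nat.
Proof. exact (sum_O a). Qed.

Lemma sum_n_nonneg_le (b : nat -> R) (n m : nat) : (forall k, 0 <= b k) -> (n <= m)%nat ->
  sum_n b n <= sum_n b m.
Proof.
  intros Hb H. induction H as [|m H IH]; [lra|]. rewrite sum_n_RS. specialize (Hb (S m)). lra.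
Qed.

Lemma sum_n_le_Series (b : nat -> R) (n : nat) : (forall k, 0 <= b k) -> ex_series b ->
  sum_n b n <= Series b.
Proof.
  intros Hb Hs. apply Series_correct in Hs.
  apply (is_lim_seq_incr_compare (sum_n b) (Series b)); [exact Hs|].
  intros m. apply sum_n_nonneg_le; auto.
Qed.

Lemma Cseries_tail (a : nat -> C) (b : nat -> R) (l : C) (n : nat) :
  (forall k, Cmod (a k) <= b k) -> ex_series b -> is_Cseries a l ->
  Cmod (l - sum_n a n)%C <= Series b - sum_n b n.
Proof.
  intros H Hs Hl.
  assert (Hb : forall k, 0 <= b k) by (intros k; eapply Rle_trans; [apply Cmod_ge_0|apply H]).
  assert (T : forall m, (n <= m)%nat -> Cmod (sum_n a m - sum_n a n)%C <= sum_n b m - sum_n b n).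
  { intros m Hm. induction Hm as [|m Hm IH].
    - replace (sum_n a n - sum_n a n)%C with (RtoC 0) by (symmetry; apply (Cplus_opp_r (sum_n a n))). rewrite Cmod_0. lra.
    - rewrite sum_n_CS, sum_n_RS.
      replace (sum_n a m + a (S m) - sum_n a n)%C with ((sum_n a m - sum_n a n) + a (S m))%C.
      + eapply Rle_trans; [apply Cmod_triangle|]. specialize (H (S m)). lra.
      + change ((sum_n a m - sum_n a n + a (S m))%C = (sum_n a m + a (S m) - sum_n a n)%C :> C).
        generalize (sum_n a m : C) (sum_n a n : C). intros x y. ring. }
  apply le_epsilon. intros eps He.
  destruct (proj1 (is_Cseries_spec a l) Hl eps He) as [N HN].
  specialize (HN (N + n)%nat ltac:(lia)). specialize (T (N + n)%nat ltac:(lia)).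
  assert (T2 := sum_n_le_Series b (N + n) Hb Hs).
  generalize dependent (sum_n a (N + n)). generalize (sum_n a n : C). intros x y HN T.
  replace (l - x)%C with ((l - y) + (y - x))%C by ring.
  eapply Rle_trans; [apply Cmod_triangle|]. rewrite (Cmod_sub_sym l). lra.
Qed.

Lemma Cseries_bound (a : nat -> C) (b : nat -> R) (l : C) :
  (forall k, Cmod (a k) <= b k) -> ex_series b -> is_Cseries a l -> Cmod l <= Series b.
Proof.
  intros H Hs Hl. assert (T := Cseries_tail a b l 0 H Hs Hl).
  rewrite sum_n_C0, sum_n_R0 in T. specialize (H 0%nat).
  assert (T2 := Cmod_triangle_sub l (a 0%nat)). lra.
Qed.

Lemma tail_small (b : nat -> R) : ex_series b -> forall eps, 0 < eps ->
  exists N, forall n, (N <= n)%nat -> Series b - sum_n b n < eps.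
Proof.
  intros Hs eps He. apply Series_correct in Hs.
  assert (H : is_lim_seq (sum_n b) (Series b)) by exact Hs.
  apply is_lim_seq_spec in H. destruct (H (mkposreal eps He)) as [N HN].
  exists N. intros n Hn. specialize (HN n Hn). simpl in HN. apply Rabs_def2 in HN. lra.
Qed.

(** * Sequences with abscissa of convergence 1 *)

(* [L k] stands for [log (alpha k)]. *)
Definition good_logs (L : nat -> C) : Prop :=
  (forall k, 0 <= Re (L k) /\ Rabs (Im (L k)) <= PI / 4) /\
  (forall p, 1 < p -> ex_series (fun k => exp (- p * Re (L k)))).

(** As [pi / 4 <= 1], the argument of the base costs at most the constant [e^|Im s|], uniformly over
    the sequence. *)
Lemma Cmod_Dirichlet (x s : C) : Rabs (Im x) <= PI / 4 ->
  Cmod (Cexp (- s * x)) <= exp (Rabs (Im s)) * exp (- Re s * Re x).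
Proof.
  intros H. rewrite Cmod_Cexp, <- exp_plus. apply exp_le_compat.
  replace (Re (- s * x)%C) with (Im s * Im x + - Re s * Re x) by (Csimpl_goal; ring).
  assert (A : Im s * Im x <= Rabs (Im s)); [|lra].
  eapply Rle_trans; [apply Rle_abs|]. rewrite Rabs_mult. assert (P := PI_4).
  assert (A1 := Rabs_pos (Im s)). assert (A2 := Rabs_pos (Im x)). nra.
Qed.

(** Termwise differentiation with a second-order remainder, parallel to [Laplace_exists]: [Re (L k)]
    replaces [u] and summability at exponents above 1 replaces integrability. *)
Lemma Dirichlet_diffable (L : nat -> C) : good_logs L ->
  exists Z : C -> C, forall s, 1 < Re s ->
    is_Cseries (fun k => Cexp (- s * L k)) (Z s) /\ Cdiffable Z s.
Proof.
  intros [HL HS].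
  assert (Hex : forall s, exists l, 1 < Re s -> is_Cseries (fun k => Cexp (- s * L k)) l).
  { intros s. destruct (Rlt_dec 1 (Re s)) as [Hs|Hs]; [|exists 0; intros; lra].
    destruct (ex_Cseries_dom (fun k => Cexp (- s * L k))
               (fun k => exp (Rabs (Im s)) * exp (- Re s * Re (L k)))) as [l Hl].
    - intros k. apply Cmod_Dirichlet, HL.
    - apply (ex_series_Rscal (exp (Rabs (Im s)))). apply HS, Hs.
    - exists l. auto. }
  apply choice in Hex. destruct Hex as [Z HZ]. exists Z. intros s Hs. split; [apply HZ, Hs|].
  (* The margin above 1 is [6 d]. The series is compared at exponent [1 + d], which leaves room for
     the factors [|L k|], [|L k|^2] and [e^(|h| |L k|)], all absorbed in [e^(3 d |L k|)];
     [|L k| <= Re (L k) + 1] turns this into a real power. *)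
  set (d := (Re s - 1) / 6). assert (Hd : 0 < d) by (unfold d; lra).
  set (p := 1 + d).
  assert (Hp : 1 < p) by (unfold p; lra).
  assert (Habs : forall k, Cmod (L k) <= Re (L k) + 1).
  { intros k. destruct (HL k) as [H1 H2]. assert (T := Cmod_le_Re_Im (L k)).
    rewrite Rabs_right in T by lra. assert (P := PI_4). lra. }
  assert (HE : forall k, exp (- Re s * Re (L k)) * exp (3 * d * Cmod (L k))
                 <= exp (3 * d) * exp (- p * Re (L k))).
  { intros k. rewrite <- !exp_plus. apply exp_le_compat. specialize (Habs k).
    destruct (HL k) as [H1 _].
    replace (Re s) with (1 + 6 * d) by (unfold d; field). unfold p. nra. }
  set (M := exp (Rabs (Im s)) * exp (3 * d)).
  assert (HM : 0 < M) by (apply Rmult_lt_0_compat; apply exp_pos).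
  destruct (ex_Cseries_dom (fun k => - L k * Cexp (- s * L k))%C
              (fun k => / d * M * exp (- p * Re (L k)))) as [D HD].
  { intros k. rewrite Cmod_mult, Cmod_opp.
    assert (T1 := Cmod_Dirichlet (L k) s (proj2 (HL k))).
    assert (T2 := u_exp_le d (Cmod (L k)) Hd (Cmod_ge_0 _)).
    assert (T3 : exp (d * Cmod (L k)) <= exp (3 * d * Cmod (L k))).
    { apply exp_le_compat. assert (T := Cmod_ge_0 (L k)). nra. }
    apply Rle_trans with ((/ d * exp (3 * d * Cmod (L k)))
                          * (exp (Rabs (Im s)) * exp (- Re s * Re (L k)))).
    - apply Rmult_le_compat; [apply Cmod_ge_0|apply Cmod_ge_0| |exact T1].
      eapply Rle_trans; [exact T2|]. apply Rmult_le_compat_l; [|exact T3].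
      apply Rlt_le, Rinv_0_lt_compat, Hd.
    - specialize (HE k). unfold M.
      replace (/ d * exp (3 * d * Cmod (L k)) * (exp (Rabs (Im s)) * exp (- Re s * Re (L k))))
        with (/ d * exp (Rabs (Im s)) * (exp (- Re s * Re (L k)) * exp (3 * d * Cmod (L k)))) by ring.
      replace (/ d * (exp (Rabs (Im s)) * exp (3 * d)) * exp (- p * Re (L k)))
        with (/ d * exp (Rabs (Im s)) * (exp (3 * d) * exp (- p * Re (L k)))) by ring.
      apply Rmult_le_compat_l; [|exact HE].
      apply Rmult_le_pos; [apply Rlt_le, Rinv_0_lt_compat, Hd|apply Rlt_le, exp_pos]. }
  { apply (ex_series_Rscal (/ d * M)). apply HS, Hp. }
  exists D.
  set (b := fun k => (/ (d / 2)) ^ 2 * M * exp (- p * Re (L k))).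
  assert (Hb : ex_series b) by (apply (ex_series_Rscal ((/ (d / 2)) ^ 2 * M)); apply HS, Hp).
  apply is_Cder_quadratic with (K := Series b) (d := d); [exact Hd|].
  intros h Hh.
  assert (Hre : 1 < Re (s + h)%C).
  { assert (T := re_le_Cmod h). assert (T2 := Rle_abs (- Re h)). rewrite Rabs_Ropp in T2.
    replace (Re (s + h)%C) with (Re s + Re h) by (Csimpl_goal; ring). unfold d in Hh. lra. }
  assert (I := is_Cseries_minus _ _ _ _ (is_Cseries_minus _ _ _ _ (HZ _ Hre) (HZ _ Hs))
                 (is_Cseries_scal h _ _ HD)).
  rewrite Rmult_comm, <- Series_scal_l.
  refine (Cseries_bound _ _ _ _ _ I).
  2:{ apply (ex_series_Rscal (Cmod h ^ 2)), Hb. }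
  intros k. cbv beta.
  replace (Cexp (- (s + h) * L k) - Cexp (- s * L k) - h * (- L k * Cexp (- s * L k)))%C
    with (Cexp (- s * L k) * (Cexp (- (h * L k)) - 1 - - (h * L k)))%C.
  2:{ replace (- (s + h) * L k)%C with (- s * L k + - (h * L k))%C by ring.
      rewrite Cexp_plus. ring. }
  rewrite Cmod_mult.
  assert (T := Cexp_taylor2 (- (h * L k))). rewrite Cmod_opp, Cmod_mult in T.
  assert (T1 := Cmod_Dirichlet (L k) s (proj2 (HL k))).
  assert (Hm := Cmod_ge_0 h). assert (HLk := Cmod_ge_0 (L k)).
  assert (T2 := u2_exp_le (d / 2) (Cmod (L k)) ltac:(lra) HLk).
  replace (2 * (d / 2)) with d in T2 by field.
  assert (T3 : (Cmod h * Cmod (L k)) ^ 2 * exp (Cmod h * Cmod (L k))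
               <= Cmod h ^ 2 * (/ (d / 2)) ^ 2 * exp (3 * d * Cmod (L k))).
  { rewrite Rpow_mult_distr.
    apply Rle_trans with (Cmod h ^ 2 * ((/ (d / 2)) ^ 2 * exp (d * Cmod (L k))) * exp (d * Cmod (L k))).
    - apply Rmult_le_compat.
      + apply Rmult_le_pos; apply pow_le; assumption.
      + apply Rlt_le, exp_pos.
      + apply Rmult_le_compat_l; [apply pow_le; assumption|exact T2].
      + apply exp_le_compat. nra.
    - rewrite !Rmult_assoc, <- exp_plus. apply Rmult_le_compat_l; [apply pow_le; assumption|].
      apply Rmult_le_compat_l; [apply pow_le; apply Rlt_le, Rinv_0_lt_compat; lra|].
      apply exp_le_compat. nra. }
  apply Rle_trans with ((exp (Rabs (Im s)) * exp (- Re s * Re (L k)))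
                        * (Cmod h ^ 2 * (/ (d / 2)) ^ 2 * exp (3 * d * Cmod (L k)))).
  { apply Rmult_le_compat; [apply Cmod_ge_0|apply Cmod_ge_0|exact T1|lra]. }
  specialize (HE k). unfold b, M.
  replace (exp (Rabs (Im s)) * exp (- Re s * Re (L k)) * (Cmod h ^ 2 * (/ (d / 2)) ^ 2 * exp (3 * d * Cmod (L k))))
    with (Cmod h ^ 2 * (/ (d / 2)) ^ 2 * exp (Rabs (Im s)) * (exp (- Re s * Re (L k)) * exp (3 * d * Cmod (L k)))) by ring.
  replace (Cmod h ^ 2 * ((/ (d / 2)) ^ 2 * (exp (Rabs (Im s)) * exp (3 * d)) * exp (- p * Re (L k))))
    with (Cmod h ^ 2 * (/ (d / 2)) ^ 2 * exp (Rabs (Im s)) * (exp (3 * d) * exp (- p * Re (L k)))) by ring.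
  apply Rmult_le_compat_l; [|exact HE].
  apply Rmult_le_pos; [|apply Rlt_le, exp_pos].
  apply Rmult_le_pos; apply pow_le; [assumption|apply Rlt_le, Rinv_0_lt_compat; lra].
Qed.

(** * The generating function [sum 2x/(x^2+alpha_k^2)] at [x = e^u] *)

(** The [k]-th term of the series in condition (e) at the point [e^z]. The complex argument [z] lets
    continuity on the line follow from differentiability. *)
Definition rterm (L : nat -> C) (k : nat) (z : C) : C := (2 * Cexp z / (Cexp (z * 2) + Cexp (2 * L k)))%C.

Lemma Re_sqr_nonneg (L : nat -> C) (k : nat) : good_logs L -> 0 <= Re (Cexp (2 * L k)).
Proof.
  intros [H _]. destruct (H k) as [_ Hk]. apply Rabs_le_between in Hk.
  change (0 <= exp (Re (2 * L k)%C) * cos (Im (2 * L k)%C)).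
  apply Rmult_le_pos; [apply Rlt_le, exp_pos|].
  replace (Im (2 * L k)%C) with (2 * Im (L k)) by (Csimpl_goal; ring).
  apply cos_ge_0; lra.
Qed.

(** With [x = e^u] and the square of [alpha_k] in the right half-plane, the modulus dominates both
    [x^2] and [|alpha_k|^2], hence every geometric mean [x^(2 - p) |alpha_k|^p]. The free exponent
    [p] trades growth in [x] against summability in [k]. *)
Lemma rterm_denominator (L : nat -> C) (k : nat) (u p : R) : good_logs L -> 0 <= p <= 2 ->
  exp ((2 - p) * u + p * Re (L k)) <= Cmod (Cexp (RtoC u * 2) + Cexp (2 * L k)).
Proof.
  intros HL Hp. assert (Hb := Re_sqr_nonneg L k HL).
  assert (Eb : Cmod (Cexp (2 * L k)) = exp (2 * Re (L k))).
  { rewrite Cmod_Cexp. f_equal. Csimpl_goal. ring. }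
  rewrite Cexp_R2. set (b := Cexp (2 * L k)) in *.
  assert (He := exp_pos (2 * u)). set (x := exp (2 * u)) in *.
  assert (H1 : x <= Cmod (RtoC x + b)).
  { eapply Rle_trans; [|apply re_le_Cmod]. eapply Rle_trans; [|apply Rle_abs].
    replace (Re (RtoC x + b)%C) with (x + Re b) by (Csimpl_goal; ring). lra. }
  assert (H2 : Cmod b <= Cmod (RtoC x + b)).
  { assert (E : Cmod b ^ 2 <= Cmod (RtoC x + b) ^ 2).
    { rewrite !Cmod2_alt. replace (Re (RtoC x + b)%C) with (x + Re b) by (Csimpl_goal; ring).
      replace (Im (RtoC x + b)%C) with (Im b) by (Csimpl_goal; ring). nra. }
    assert (T := Cmod_ge_0 (RtoC x + b)). assert (T2 := Cmod_ge_0 b). nra. }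
  destruct (Rle_dec u (Re (L k))).
  - eapply Rle_trans; [|exact H2]. rewrite Eb. apply exp_le_compat. nra.
  - eapply Rle_trans; [|exact H1]. apply exp_le_compat. nra.
Qed.

Lemma rterm_neq_0 (L : nat -> C) (k : nat) (u : R) : good_logs L ->
  (Cexp (RtoC u * 2) + Cexp (2 * L k))%C <> 0.
Proof.
  intros HL. apply Cmod_gt_0. eapply Rlt_le_trans; [|apply (rterm_denominator L k u 0 HL); lra].
  apply exp_pos.
Qed.

Lemma rterm_bound (L : nat -> C) (k : nat) (u p : R) : good_logs L -> 0 <= p <= 2 ->
  Cmod (rterm L k (RtoC u)) <= 2 * exp ((p - 1) * u) * exp (- p * Re (L k)).
Proof.
  intros HL Hp. unfold rterm. rewrite Cmod_div by (apply rterm_neq_0, HL).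
  rewrite Cmod_mult, Cmod_R, Cexp_R, Cmod_R, !Rabs_right by (try lra; left; apply exp_pos).
  assert (D := rterm_denominator L k u p HL Hp).
  apply Rinv_le_contravar in D; [|apply exp_pos].
  apply Rle_trans with (2 * exp u * / exp ((2 - p) * u + p * Re (L k))).
  - apply Rmult_le_compat_l; [|exact D]. assert (T := exp_pos u). lra.
  - right. rewrite <- exp_Ropp, !Rmult_assoc, <- !exp_plus. do 2 f_equal. ring.
Qed.

Lemma rterm_cont (L : nat -> C) (k : nat) : good_logs L -> Ccont (fun u => rterm L k (RtoC u)).
Proof.
  intros HL. apply (Ccont_of_Cdiffable (rterm L k)). intros u. unfold rterm.
  Cdiff. apply rterm_neq_0, HL.
Qed.

Lemma Ccont_sum_n (g : nat -> R -> C) (n : nat) : (forall k, Ccont (g k)) ->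
  Ccont (fun u => sum_n (fun k => g k u) n).
Proof.
  intros H. induction n as [|n IH].
  - eapply Ccont_ext; [|apply (H 0%nat)]. intros u. symmetry. apply sum_n_C0.
  - eapply Ccont_ext; [|apply (Ccont_plus _ _ IH (H (S n)))]. intros u. symmetry. apply sum_n_CS.
Qed.

Lemma is_BInt_sum_n (g : nat -> R -> C) (l : nat -> C) (n : nat) :
  (forall k, is_BInt (g k) (l k)) -> is_BInt (fun u => sum_n (fun k => g k u) n) (sum_n l n).
Proof.
  intros H. induction n as [|n IH].
  - rewrite sum_n_C0. eapply is_BInt_ext; [|apply (H 0%nat)]. intros u. symmetry. apply sum_n_C0.
  - rewrite sum_n_CS. eapply is_BInt_ext; [|apply (is_BInt_plus _ _ _ _ IH (H (S n)))].
    intros u. symmetry. apply sum_n_CS.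
Qed.

Lemma sum_n_Rscal (c : R) (b : nat -> R) (n : nat) : sum_n (fun k => c * b k) n = c * sum_n b n.
Proof. exact (sum_n_mult_l c b n). Qed.

Lemma sum_n_Cscal (c : C) (b : nat -> C) (n : nat) : sum_n (fun k => c * b k)%C n = (c * sum_n b n)%C.
Proof. exact (sum_n_mult_l (c : C_Ring) b n). Qed.

Definition generating (L : nat -> C) (F : R -> C) : Prop :=
  forall u, is_Cseries (fun k => rterm L k (RtoC u)) (F u).

Lemma ex_generating (L : nat -> C) : good_logs L -> exists F, generating L F.
Proof.
  intros HL.
  assert (H : forall u, exists l, is_Cseries (fun k => rterm L k (RtoC u)) l).
  { intros u. apply (ex_Cseries_dom _ (fun k => 2 * exp ((2 - 1) * u) * exp (- (2) * Re (L k)))).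
    - intros k. apply rterm_bound; [assumption|lra].
    - apply ex_series_Rscal. apply HL. lra. }
  apply choice in H. destruct H as [F HF]. exists F. exact HF.
Qed.

Lemma generating_tail (L : nat -> C) (F : R -> C) (u p : R) (n : nat) :
  good_logs L -> generating L F -> 1 < p <= 2 ->
  Cmod (F u - sum_n (fun k => rterm L k (RtoC u)) n)%C
  <= 2 * exp ((p - 1) * u)
     * (Series (fun k => exp (- p * Re (L k))) - sum_n (fun k => exp (- p * Re (L k))) n).
Proof.
  intros HL HF Hp.
  rewrite Rmult_minus_distr_l, <- Series_scal_l, <- sum_n_Rscal.
  apply Cseries_tail.
  - intros k. apply rterm_bound; [assumption|lra].
  - apply ex_series_Rscal. apply HL. lra.
  - apply HF.
Qed.

Lemma generating_bound (L : nat -> C) (F : R -> C) (u p : R) :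
  good_logs L -> generating L F -> 1 < p <= 2 ->
  Cmod (F u) <= 2 * exp ((p - 1) * u) * Series (fun k => exp (- p * Re (L k))).
Proof.
  intros HL HF Hp. rewrite <- Series_scal_l.
  apply (Cseries_bound (fun k => rterm L k (RtoC u))).
  - intros k. apply rterm_bound; [assumption|lra].
  - apply ex_series_Rscal. apply HL. lra.
  - apply HF.
Qed.

Lemma generating_cont (L : nat -> C) (F : R -> C) : good_logs L -> generating L F -> Ccont F.
Proof.
  intros HL HF u eps He.
  (* Uniform convergence: with [p = 2] the tail bound increases with the point, so a tail below [e3]
     is below [eps / 3] for every [w <= u + 1]. *)
  set (e3 := eps / 3 / (2 * exp ((2 - 1) * (u + 1)))).
  assert (Hx : 0 < 2 * exp ((2 - 1) * (u + 1))).
  { assert (T := exp_pos ((2 - 1) * (u + 1))). lra. }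
  assert (He3 : 0 < e3) by (apply Rdiv_lt_0_compat; lra).
  assert (Hs2 : ex_series (fun k => exp (- (2) * Re (L k)))) by (apply HL; lra).
  destruct (tail_small _ Hs2 e3 He3) as [n Hn]. specialize (Hn n (Nat.le_refl n)).
  assert (T0 : 0 <= Series (fun k => exp (- (2) * Re (L k))) - sum_n (fun k => exp (- (2) * Re (L k))) n).
  { assert (T := sum_n_le_Series _ n (fun k => Rlt_le _ _ (exp_pos (- (2) * Re (L k)))) Hs2). lra. }
  assert (Hc := Ccont_sum_n (fun k u => rterm L k (RtoC u)) n (fun k => rterm_cont L k HL)).
  destruct (Hc u (eps / 3)) as [d [Hd H]]; [lra|].
  exists (Rmin 1 d). split; [apply Rmin_pos; lra|]. intros v Hv.
  assert (Hv1 := Rlt_le_trans _ _ _ Hv (Rmin_l _ _)).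
  specialize (H v (Rlt_le_trans _ _ _ Hv (Rmin_r _ _))).
  assert (B : forall w, w <= u + 1 -> Cmod (F w - sum_n (fun k => rterm L k (RtoC w)) n)%C < eps / 3).
  { intros w Hw. eapply Rle_lt_trans; [apply (generating_tail L F w 2 n HL HF); lra|].
    eapply Rle_lt_trans with (2 * exp ((2 - 1) * (u + 1)) * _); [apply Rmult_le_compat_r; [exact T0|]|].
    - apply Rmult_le_compat_l; [lra|]. apply exp_le_compat. lra.
    - apply Rmult_lt_compat_l with (r := 2 * exp ((2 - 1) * (u + 1))) in Hn; [|exact Hx].
      unfold e3 in Hn at 1.
      replace (2 * exp ((2 - 1) * (u + 1)) * (eps / 3 / (2 * exp ((2 - 1) * (u + 1))))) with (eps / 3)
        in Hn by (field; lra). exact Hn. }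
  apply Rabs_def2 in Hv1.
  assert (B1 := B v ltac:(lra)). assert (B2 := B u ltac:(lra)). cbv beta in H.
  generalize dependent (sum_n (fun k => rterm L k (RtoC v)) n).
  generalize dependent (sum_n (fun k => rterm L k (RtoC u)) n). intros x B2 y H B1.
  replace (F v - F u)%C with ((F v - y) + ((y - x) + (x - F u)))%C by ring.
  eapply Rle_lt_trans; [apply Cmod_triangle|].
  assert (T := Cmod_triangle (y - x) (x - F u)). rewrite (Cmod_sub_sym x) in T. lra.
Qed.

(** Interchange of sum and integral: the tails of the series, times the Mellin kernel, are dominated
    by an integrable exponential whose constant tends to 0. The sum of the transforms of the single
    terms is then [mellin_transform] applied to [2 * L k]. *)
Lemma generating_mellin (L : nat -> C) (F : R -> C) (s l z : C) :
  good_logs L -> generating L F -> 1 < Re s < 2 ->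
  is_BInt (fun u => F u * Cexp (RtoC u * (1 - s)))%C l ->
  is_Cseries (fun k => Cexp (- s * L k)) z ->
  (Csin (RtoC (PI / 2) * s) * l)%C = (RtoC PI * z)%C.
Proof.
  intros HL HF Hs Hl Hz.
  (* Since [p1 < Re s < p2], the bound with [p1] decays for [u > 0] and the bound with [p2] for
     [u < 0]; both exceed 1, so both tails [R1] and [R2] tend to 0. *)
  set (p1 := (1 + Re s) / 2). set (p2 := (2 + Re s) / 2).
  assert (Hp1 : 1 < p1 <= 2) by (unfold p1; lra). assert (Hp2 : 1 < p2 <= 2) by (unfold p2; lra).
  set (R1 := fun n => Series (fun k => exp (- p1 * Re (L k))) - sum_n (fun k => exp (- p1 * Re (L k))) n).
  set (R2 := fun n => Series (fun k => exp (- p2 * Re (L k))) - sum_n (fun k => exp (- p2 * Re (L k))) n).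
  assert (S1 : ex_series (fun k => exp (- p1 * Re (L k)))) by (apply HL; lra).
  assert (S2 : ex_series (fun k => exp (- p2 * Re (L k)))) by (apply HL; lra).
  assert (R1p : forall n, 0 <= R1 n).
  { intros n. assert (T := sum_n_le_Series _ n (fun k => Rlt_le _ _ (exp_pos (- p1 * Re (L k)))) S1).
    unfold R1. lra. }
  assert (R2p : forall n, 0 <= R2 n).
  { intros n. assert (T := sum_n_le_Series _ n (fun k => Rlt_le _ _ (exp_pos (- p2 * Re (L k)))) S2).
    unfold R2. lra. }
  set (c := Rmin ((Re s - 1) / 2) ((2 - Re s) / 2)).
  assert (Hc : 0 < c) by (apply Rmin_pos; lra).
  assert (c1 : c <= (Re s - 1) / 2) by apply Rmin_l. assert (c2 : c <= (2 - Re s) / 2) by apply Rmin_r.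
  set (sn := Csin (RtoC (PI / 2) * s)).
  assert (Hk : forall k, exists m, is_BInt (fun u => rterm L k (RtoC u) * Cexp (RtoC u * (1 - s)))%C m /\
                 (sn * m = RtoC PI * Cexp (- s * L k))%C).
  { intros k. destruct (mellin_transform s (2 * L k)) as (m & Hm & Em); [lra| |].
    - replace (Im (2 * L k)%C) with (2 * Im (L k)) by (Csimpl_goal; ring).
      destruct (proj1 HL k) as [_ T]. apply Rabs_le_between in T. lra.
    - exists m. split.
      + eapply is_BInt_ext; [|exact Hm]. intros u. unfold mker, rterm.
        replace (RtoC u * (2 - s))%C with (RtoC u + RtoC u * (1 - s))%C by ring.
        rewrite Cexp_plus. field. apply rterm_neq_0, HL.
      + unfold sn. rewrite Em. do 2 f_equal. field; apply Ctwo_neq_0. }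
  apply choice in Hk. destruct Hk as [m Hm].
  assert (D : forall n, Cmod (l - sum_n m n)%C <= 2 * (2 * (R1 n + R2 n) / c)).
  { intros n.
    assert (I := is_BInt_minus _ _ _ _ Hl
       (is_BInt_sum_n (fun k u => rterm L k (RtoC u) * Cexp (RtoC u * (1 - s)))%C m n (fun k => proj1 (Hm k)))).
    refine (is_BInt_bound _ _ _ _ Hc _ I). intros u. cbv beta.
    replace (sum_n (fun k => rterm L k (RtoC u) * Cexp (RtoC u * (1 - s)))%C n)
      with (Cexp (RtoC u * (1 - s)) * sum_n (fun k => rterm L k (RtoC u)) n)%C.
    2:{ rewrite <- sum_n_Cscal. apply sum_n_ext. intros k. apply Cmult_comm. }
    assert (G1 := generating_tail L F u p1 n HL HF Hp1). fold (R1 n) in G1.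
    assert (G2 := generating_tail L F u p2 n HL HF Hp2). fold (R2 n) in G2.
    generalize dependent (sum_n (fun k => rterm L k (RtoC u)) n). intros y G1 G2.
    replace (F u * Cexp (RtoC u * (1 - s)) - Cexp (RtoC u * (1 - s)) * y)%C
      with ((F u - y) * Cexp (RtoC u * (1 - s)))%C by ring.
    rewrite Cmod_mult, Cmod_exp_lin.
    replace (Re (1 - s)%C) with (1 - Re s) by (Csimpl_goal; ring).
    specialize (R1p n). specialize (R2p n).
    assert (Ex : forall p X, 0 <= X -> (p - Re s) * u <= - c * Rabs u ->
      2 * exp ((p - 1) * u) * X * exp (u * (1 - Re s)) <= 2 * X * exp (- c * Rabs u)).
    { intros p X HX Hle.
      replace (2 * exp ((p - 1) * u) * X * exp (u * (1 - Re s)))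
        with (2 * X * (exp ((p - 1) * u) * exp (u * (1 - Re s)))) by ring.
      rewrite <- exp_plus. apply Rmult_le_compat_l; [lra|]. apply exp_le_compat.
      eapply Rle_trans; [|exact Hle]. right. ring. }
    assert (Ep := exp_pos (- c * Rabs u)).
    assert (Eu := exp_pos (u * (1 - Re s))).
    destruct (Rle_dec 0 u) as [Hu|Hu].
    - eapply Rle_trans; [apply Rmult_le_compat_r; [apply Rlt_le, Eu|exact G1]|].
      eapply Rle_trans; [apply Ex; [assumption|]|].
      + rewrite Rabs_right by lra. unfold p1. nra.
      + apply Rmult_le_compat_r; lra.
    - eapply Rle_trans; [apply Rmult_le_compat_r; [apply Rlt_le, Eu|exact G2]|].
      eapply Rle_trans; [apply Ex; [assumption|]|].
      + rewrite Rabs_left by lra. unfold p2. nra.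
      + apply Rmult_le_compat_r; lra. }
  apply (is_Cseries_unique (fun k => sn * m k)%C).
  - apply is_Cseries_scal. apply is_Cseries_spec. intros eps He.
    assert (Hec : 0 < eps * c / 16) by (apply Rdiv_lt_0_compat; [apply Rmult_lt_0_compat|]; lra).
    destruct (tail_small _ S1 _ Hec) as [N1 H1]. destruct (tail_small _ S2 _ Hec) as [N2 H2].
    exists (N1 + N2)%nat. intros n Hn.
    specialize (H1 n ltac:(lia)). specialize (H2 n ltac:(lia)).
    fold (R1 n) in H1. fold (R2 n) in H2.
    rewrite Cmod_sub_sym. eapply Rle_lt_trans; [apply D|].
    apply Rmult_lt_reg_r with c; [assumption|].
    replace (2 * (2 * (R1 n + R2 n) / c) * c) with (4 * (R1 n + R2 n)) by (field; lra). nra.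
  - eapply is_Cseries_ext; [|apply (is_Cseries_scal (RtoC PI) _ _ Hz)].
    intros k. symmetry. apply Hm.
Qed.

(** * Riemann sequences *)

Lemma Re_Cmod_bounds (z : C) : z <> 0 -> -1 <= Re z / Cmod z <= 1.
Proof.
  intros Hz. assert (Hp := proj1 (Cmod_gt_0 z) Hz).
  assert (T := re_le_Cmod z). apply Rabs_le_between in T.
  split; apply Rmult_le_reg_r with (Cmod z); auto; unfold Rdiv; rewrite Rmult_assoc, Rinv_l; lra.
Qed.

Lemma cos_Carg (z : C) : z <> 0 -> cos (Carg z) = Re z / Cmod z.
Proof.
  intros Hz. unfold Carg. destruct (Rle_dec 0 (Im z)); [|rewrite cos_neg];
    apply cos_acos, Re_Cmod_bounds, Hz.
Qed.

Lemma sin_Carg (z : C) : z <> 0 -> sin (Carg z) = Im z / Cmod z.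
Proof.
  intros Hz. assert (Hp := proj1 (Cmod_gt_0 z) Hz).
  assert (E : sqrt (1 - (Re z / Cmod z)²) = Rabs (Im z) / Cmod z).
  { replace (1 - (Re z / Cmod z)²) with ((Rabs (Im z) / Cmod z)²).
    - apply sqrt_Rsqr. apply Rmult_le_pos; [apply Rabs_pos|apply Rlt_le, Rinv_0_lt_compat, Hp].
    - assert (T := Cmod2_alt z). unfold Rsqr.
      assert (T2 : Rabs (Im z) * Rabs (Im z) = Im z * Im z).
      { rewrite <- Rabs_mult. apply Rabs_right. apply Rle_ge, Rle_0_sqr. }
      field_simplify; [|lra|lra]. f_equal. rewrite <- !Rsqr_pow2. unfold Rsqr. rewrite T2.
      simpl in T. rewrite !Rmult_1_r in T. lra. }
  assert (B := Re_Cmod_bounds z Hz).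
  unfold Carg. destruct (Rle_dec 0 (Im z)).
  - rewrite sin_acos by exact B. rewrite E, Rabs_right; lra.
  - rewrite sin_neg, sin_acos by exact B. rewrite E, Rabs_left by lra. field. lra.
Qed.

Lemma Cexp_Clog (z : C) : z <> 0 -> Cexp (Clog z) = z.
Proof.
  intros Hz. assert (Hp := proj1 (Cmod_gt_0 z) Hz).
  change (Cexp (Clog z)) with ((exp (ln (Cmod z)) * cos (Carg z), exp (ln (Cmod z)) * sin (Carg z)) : C).
  rewrite exp_ln, cos_Carg, sin_Carg by assumption.
  apply Ceq; unfold Re at 1, Im at 1; cbn [fst snd]; field; lra.
Qed.

Lemma Clog_R (x : R) : 0 < x -> Clog (RtoC x) = RtoC (ln x).
Proof.
  intros Hx. unfold Clog, Carg. rewrite Cmod_R, Rabs_right by lra. simpl.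
  destruct (Rle_dec 0 0) as [_|N]; [|lra].
  replace (x / x) with 1 by (field; lra). rewrite acos_1. reflexivity.
Qed.

Lemma Carg_R (x : R) : 0 < x -> Carg (RtoC x) = 0.
Proof. intros Hx. exact (f_equal Im (Clog_R x Hx)). Qed.

(** * Growth of the sequence and convergence of its Dirichlet series *)

(** Telescoping instead of an integral test: with [m = t - 1],
    [m n^(- t) <= (n - 1)^(- m) - n^(- m)], by the tangent inequality for [exp] used twice. *)
Lemma ex_series_power (t : R) : 1 < t -> ex_series (fun k => exp (- t * ln (INR (S k)))).
Proof.
  intros Ht. set (m := t - 1). assert (Hm : 0 < m) by (unfold m; lra).
  set (a := fun k => exp (- t * ln (INR (S k)))).
  set (c := fun k => exp (- m * ln (INR (S k)))).
  assert (Hstep : forall k, m * a (S k) <= c k - c (S k)).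
  { intros k. unfold a, c.
    assert (Hx : 0 < INR (S k)) by apply lt_0_INR, Nat.lt_0_succ.
    assert (Hy : 0 < INR (S (S k))) by apply lt_0_INR, Nat.lt_0_succ.
    assert (Exy : INR (S (S k)) = INR (S k) + 1) by apply S_INR.
    set (x := INR (S k)) in *. set (y := INR (S (S k))) in *.
    set (v := ln x - ln y).
    assert (Ev : exp v = x / y).
    { unfold v, Rminus. rewrite exp_plus, exp_Ropp, !exp_ln by assumption. reflexivity. }
    assert (Hv : 1 + v <= x / y) by (rewrite <- Ev; apply exp_ineq1_le).
    assert (Hxy : x / y = 1 - / y) by (replace x with (y - 1) by lra; field; lra).
    assert (E1 : exp (- t * ln y) = exp (- m * ln y) * / y).
    { replace (/ y) with (exp (- ln y)) by (rewrite exp_Ropp, exp_ln; auto).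
      rewrite <- exp_plus. f_equal. unfold m. ring. }
    assert (E2 : exp (- m * ln x) = exp (- m * ln y) * exp (- m * v)).
    { rewrite <- exp_plus. f_equal. unfold v. ring. }
    rewrite E1, E2. assert (P := exp_pos (- m * ln y)).
    assert (Q := exp_ineq1_le (- m * v)). assert (Q2 : m * / y <= - m * v) by nra. nra. }
  assert (Hs : forall n, sum_n a n <= 1 + (1 - c n) / m).
  { induction n as [|n IH].
    - rewrite sum_n_R0. unfold a, c. simpl. rewrite ln_1, !Rmult_0_r, exp_0.
      replace ((1 - 1) / m) with 0 by (field; lra). lra.
    - rewrite sum_n_RS. specialize (Hstep n).
      assert (T : a (S n) <= (c n - c (S n)) / m).
      { apply Rmult_le_reg_l with m; [assumption|].
        replace (m * ((c n - c (S n)) / m)) with (c n - c (S n)) by (field; lra). exact Hstep. }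
      replace ((1 - c (S n)) / m) with ((1 - c n) / m + (c n - c (S n)) / m) by (field; lra). lra. }
  assert (Hl : ex_finite_lim_seq (sum_n a)).
  { apply ex_finite_lim_seq_incr with (1 + / m).
    - intros n. rewrite sum_n_RS. assert (T := exp_pos (- t * ln (INR (S (S n))))).
      change (a (S n)) with (exp (- t * ln (INR (S (S n))))). lra.
    - intros n. eapply Rle_trans; [apply Hs|].
      assert (T : 0 < c n) by apply exp_pos. assert (T2 := Rinv_0_lt_compat m Hm). unfold Rdiv. nra. }
  destruct Hl as [l Hl]. exists l. exact Hl.
Qed.

Lemma ln_le_exp (e x : R) : 0 < e -> 0 < x -> ln x <= / e * exp (e * ln x).
Proof.
  intros He Hx. assert (T := exp_ineq1_le (e * ln x)).
  apply Rmult_le_reg_l with e; [assumption|].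
  rewrite <- Rmult_assoc, Rinv_r, Rmult_1_l by lra. lra.
Qed.

Lemma Re_sum_n (a : nat -> C) (n : nat) : Re (sum_n a n) = sum_n (fun k => Re (a k)) n.
Proof.
  induction n as [|n IH]; [rewrite sum_n_C0, sum_n_R0; reflexivity|].
  rewrite sum_n_CS, sum_n_RS, <- IH. reflexivity.
Qed.

Lemma Cseries_Re_ge (a : nat -> C) (l : C) (n : nat) : (forall k, 0 <= Re (a k)) ->
  is_Cseries a l -> sum_n (fun k => Re (a k)) n <= Re l.
Proof.
  intros H Hl. apply le_epsilon. intros eps He.
  destruct (proj1 (is_Cseries_spec a l) Hl eps He) as [N HN].
  specialize (HN (N + n)%nat ltac:(lia)).
  assert (T := sum_n_nonneg_le (fun k => Re (a k)) n (N + n) H ltac:(lia)).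
  rewrite <- (Re_sum_n a (N + n)) in T.
  generalize dependent (sum_n a (N + n)). intros x HN T.
  assert (T2 := re_le_Cmod (x - l)). assert (T3 := Rle_abs (Re (x - l)%C)).
  replace (Re (x - l)%C) with (Re x - Re l) in T3, T2 by (Csimpl_goal; ring). lra.
Qed.

Lemma sum_n_ge_const (b : nat -> R) (c : R) (n : nat) :
  (forall k, (k <= n)%nat -> c <= b k) -> INR (S n) * c <= sum_n b n.
Proof.
  intros H. induction n as [|n IH].
  - rewrite sum_n_R0. simpl. specialize (H 0%nat (Nat.le_refl 0)). lra.
  - rewrite sum_n_RS, S_INR. specialize (H (S n) (Nat.le_refl _)) as H1.
    assert (T : INR (S n) * c <= sum_n b n) by (apply IH; intros; apply H; lia). lra.
Qed.

(** For [w = x^2 + b] the real part is [2 x Re w / |w|^2]. It is nonnegative, and [Re w >= x^2] with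
    [|w| <= 2 x^2] gives the lower bound. *)
Lemma Re_quotient_bounds (x : R) (b : C) : 0 < x -> 0 <= Re b ->
  0 <= Re (2 * RtoC x / (RtoC x ^ 2 + b))%C /\
  (Cmod b <= x ^ 2 -> / (2 * x) <= Re (2 * RtoC x / (RtoC x ^ 2 + b))%C).
Proof.
  intros Hx Hb. set (w := (RtoC x ^ 2 + b)%C).
  assert (Rw : Re w = x ^ 2 + Re b) by (unfold w; Csimpl_goal; ring).
  assert (x2 : 0 < x ^ 2) by (apply pow_lt, Hx).
  assert (w0 : w <> 0). { intros E. rewrite E in Rw. simpl in Rw. simpl in x2. lra. }
  assert (Hw := proj1 (Cmod_gt_0 w) w0).
  assert (E : Re (2 * RtoC x / w)%C = 2 * x * Re w / (Cmod w ^ 2)).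
  { clear -Hw. assert (T := Cmod2_alt w). rewrite T.
    assert (T2 : Re w ^ 2 + Im w ^ 2 <> 0) by (rewrite <- T; apply pow_nonzero; lra).
    destruct w as [p q]. unfold Cinv; Csimpl_goal. field. lra. }
  rewrite E, Rw.
  assert (P : 0 < Cmod w ^ 2) by (apply pow_lt, Hw).
  assert (P2 := Rinv_0_lt_compat _ P).
  split.
  - apply Rmult_le_pos; [|lra]. apply Rmult_le_pos; lra.
  - intros Hbx.
    assert (B : Cmod w <= 2 * x ^ 2).
    { unfold w. eapply Rle_trans; [apply Cmod_triangle|]. rewrite Cmod_pow, Cmod_R, Rabs_right by lra. lra. }
    assert (B2 : Cmod w ^ 2 <= 4 * x ^ 4).
    { replace (4 * x ^ 4) with ((2 * x ^ 2) ^ 2) by ring. apply pow_incr. lra. }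
    apply Rle_trans with (2 * x * x ^ 2 / (4 * x ^ 4)); [right; field; lra|].
    apply Rmult_le_compat.
    + apply Rmult_le_pos; lra.
    + apply Rlt_le, Rinv_0_lt_compat. assert (T := pow_lt x 4 Hx). lra.
    + apply Rmult_le_compat_l; lra.
    + apply Rinv_le_contravar; [exact P|exact B2].
Qed.

Lemma asymp_real (f : C -> C) (b : nat -> C) (N : nat) : asymp f b ->
  exists X, 0 < X /\ forall x, X < x ->
    Cmod (f (RtoC x) - sum_n (fun n => b n / RtoC x ^ n)%C N)%C <= / x ^ N.
Proof.
  intros H. assert (PP := PI_RGT_0).
  assert (He : 0 < PI / 4 < PI / 2) by lra.
  specialize (H N (PI / 4) He).
  destruct (H (fun z : C => Cmod (z - 0)%C < 1)) as [M HM].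
  { apply (@locally_le_locally_norm C_AbsRing C_NormedModule (RtoC 0)).
    exact (@locally_norm_ball_norm C_AbsRing C_NormedModule (RtoC 0) (mkposreal 1 Rlt_0_1)). }
  exists (Rmax 1 M). split; [eapply Rlt_le_trans; [apply Rlt_0_1|apply Rmax_l]|].
  intros x Hx.
  assert (H1 := Rle_lt_trans _ _ _ (Rmax_l 1 M) Hx). assert (H2 := Rle_lt_trans _ _ _ (Rmax_r 1 M) Hx).
  specialize (HM (RtoC x)). rewrite Cmod_R, Rabs_right in HM by lra.
  rewrite Carg_R, Rabs_R0 in HM by lra.
  specialize (HM H2 ltac:(lra)). cbv beta in HM.
  set (d := (f (RtoC x) - sum_n (fun n => b n / RtoC x ^ n)%C N)%C) in *.
  replace (d * RtoC x ^ N - 0)%C with (d * RtoC x ^ N)%C in HM by ring.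
  rewrite Cmod_mult, Cmod_pow, Cmod_R, Rabs_right in HM by lra.
  assert (P : 0 < x ^ N) by (apply pow_lt; lra).
  apply Rmult_le_reg_r with (x ^ N); [assumption|]. rewrite Rinv_l by lra. lra.
Qed.

(** The sequence is ordered by real parts while the counting uses moduli, so the two must be
    comparable. The factor 2 comes from the coarse [cos (pi / 4) >= cos (pi / 3) = 1 / 2]. *)
Lemma Riemann_Cmod_le (E B : nat -> R) (alpha : nat -> C) (k : nat) :
  is_Riemann_sequence E B alpha -> 1 < Re (alpha k) /\ Cmod (alpha k) <= 2 * Re (alpha k) /\
    Re (alpha k) <= Cmod (alpha k).
Proof.
  intros H.
  assert (H1 : 1 < Re (alpha k)).
  { induction k as [|k IH]; [apply H|]. eapply Rlt_le_trans; [exact IH|apply H]. }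
  assert (H0 : alpha k <> 0). { intros E0. rewrite E0 in H1. simpl in H1. lra. }
  assert (Hp := proj1 (Cmod_gt_0 _) H0).
  assert (Ha := Rs_arg _ _ _ H k). apply Rabs_def2 in Ha.
  assert (PP := PI_RGT_0).
  assert (Hc : 1 / 2 <= cos (Carg (alpha k))).
  { rewrite <- cos_PI3. destruct (Rle_dec 0 (Carg (alpha k))).
    - apply cos_decr_1; lra.
    - rewrite <- (cos_neg (Carg (alpha k))). apply cos_decr_1; lra. }
  rewrite cos_Carg in Hc by assumption.
  split; [exact H1|]. split.
  - apply Rmult_le_compat_r with (r := Cmod (alpha k)) in Hc; [|lra].
    replace (Re (alpha k) / Cmod (alpha k) * Cmod (alpha k)) with (Re (alpha k)) in Hc by (field; lra). lra.
  - eapply Rle_trans; [apply Rle_abs|apply re_le_Cmod].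
Qed.

Lemma Riemann_neq_0 (E B : nat -> R) (alpha : nat -> C) (k : nat) :
  is_Riemann_sequence E B alpha -> alpha k <> 0.
Proof.
  intros H E0. destruct (Riemann_Cmod_le E B alpha k H) as [T _]. rewrite E0 in T. simpl in T. lra.
Qed.

Lemma Riemann_sqr_Re (E B : nat -> R) (alpha : nat -> C) (k : nat) :
  is_Riemann_sequence E B alpha -> 0 <= Re (alpha k ^ 2)%C.
Proof.
  intros H. rewrite <- (Cexp_Clog (alpha k)) by (eapply Riemann_neq_0; eassumption).
  replace (Cexp (Clog (alpha k)) ^ 2)%C with (Cexp (2 * Clog (alpha k)))%C.
  2:{ replace (2 * Clog (alpha k))%C with (Clog (alpha k) + Clog (alpha k))%C by ring.
      rewrite Cexp_plus. ring. }
  change (0 <= exp (Re (2 * Clog (alpha k))%C) * cos (Im (2 * Clog (alpha k))%C)).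
  apply Rmult_le_pos; [apply Rlt_le, exp_pos|].
  replace (Im (2 * Clog (alpha k))%C) with (2 * Im (Clog (alpha k))) by (Csimpl_goal; ring).
  change (Im (Clog (alpha k))) with (Carg (alpha k)).
  assert (Ha := Rs_arg _ _ _ H k). apply Rabs_def2 in Ha. apply cos_ge_0; lra.
Qed.

Lemma Clog_2PI (x : R) : 0 < x -> Clog (RtoC x / (2 * PI))%C = RtoC (ln x - ln (2 * PI)).
Proof.
  intros Hx. assert (PP := PI_RGT_0).
  replace (RtoC x / (2 * PI))%C with (RtoC (x / (2 * PI))).
  - rewrite Clog_R by (apply Rdiv_lt_0_compat; lra). rewrite ln_div by lra. reflexivity.
  - unfold Rdiv. rewrite RtoC_mult, RtoC_inv, RtoC_mult by lra. reflexivity.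
Qed.

(* Counting: each of the first [n] terms of [f x] with [|alpha_k| <= x] has real part at least [1 / (2 x)],
   while [f x = O(ln x)]. *)
Lemma Riemann_counting (E B : nat -> R) (alpha : nat -> C) (e : R) :
  is_Riemann_sequence E B alpha -> 0 < e ->
  exists M, 0 < M /\ forall n, INR (S n) <= M * exp ((1 + e) * ln (Re (alpha n))).
Proof.
  intros H He.
  destruct (Rs_asymp _ _ _ H) as (a & f & Hf & Has).
  destruct (asymp_real _ _ 0 Has) as (X & HX & HXb).
  set (x1 := Rmax (X + Rabs a + 1) 2).
  assert (x1a : X + Rabs a + 1 <= x1) by apply Rmax_l.
  assert (x12 : 2 <= x1) by apply Rmax_r.
  assert (Ra := Rle_abs a). assert (Ra0 := Rabs_pos a).
  exists ((/ e + 2) * exp ((1 + e) * ln x1)).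
  split. { apply Rmult_lt_0_compat; [|apply exp_pos]. assert (T := Rinv_0_lt_compat e He). lra. }
  intros n. destruct (Riemann_Cmod_le E B alpha n H) as (Hn1 & Hn2 & Hn3).
  set (r := Re (alpha n)) in *.
  (* The factor [x1 >= 2] gives [|alpha_k| <= 2 r <= x] for all [k <= n]; as [r > 1],
     [x1 >= X + |a| + 1] puts [x] where both the series and its expansion are available. *)
  set (x := x1 * r). assert (Hx1 : x1 <= x) by (unfold x; nra). assert (Hx2 : 2 * r <= x) by (unfold x; nra).
  assert (Hx0 : 0 < x) by lra.
  specialize (Hf (RtoC x)). specialize (HXb x ltac:(lra)).
  specialize (Hf ltac:(simpl; lra)).
  assert (Q := fun k => Re_quotient_bounds x (alpha k ^ 2) Hx0 (Riemann_sqr_Re E B alpha k H)).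
  assert (L := Cseries_Re_ge _ _ n (fun k => proj1 (Q k)) Hf).
  assert (Mono : forall k, (k <= n)%nat -> Re (alpha k) <= r).
  { intros k Hk. unfold r. clear -H Hk. induction Hk as [|n Hk IH]; [lra|].
    eapply Rle_trans; [exact IH|apply H]. }
  assert (L2 : INR (S n) * / (2 * x) <= sum_n (fun k => Re (2 * RtoC x / (RtoC x ^ 2 + alpha k ^ 2))%C) n).
  { apply sum_n_ge_const. intros k Hk. apply Q. rewrite Cmod_pow. apply pow_incr.
    split; [apply Cmod_ge_0|]. destruct (Riemann_Cmod_le E B alpha k H) as (_ & T & _).
    specialize (Mono k Hk). lra. }
  rewrite Clog_2PI in HXb by assumption.
  rewrite sum_n_C0 in HXb. simpl in HXb.
  assert (T := re_le_Cmod (f (RtoC x) - / 2 * RtoC (ln x - ln (2 * PI)) - RtoC (coef E B 0) / 1)%C).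
  replace (Re (f (RtoC x) - / 2 * RtoC (ln x - ln (2 * PI)) - RtoC (coef E B 0) / 1)%C)
    with (Re (f (RtoC x)) - / 2 * (ln x - ln (2 * PI))) in T.
  2:{ unfold coef. simpl. unfold Cinv; Csimpl_goal. field. }
  assert (T2 := Rle_abs (Re (f (RtoC x)) - / 2 * (ln x - ln (2 * PI)))).
  assert (L2PI : 0 <= ln (2 * PI)).
  { rewrite <- ln_1. apply ln_le; [lra|]. assert (P := PI2_1). lra. }
  assert (Fx : Re (f (RtoC x)) <= / 2 * ln x + 1).
  { rewrite Rinv_1 in HXb. lra. }
  assert (Cn : INR (S n) <= x * (ln x + 2)).
  { apply Rmult_le_reg_r with (/ (2 * x)); [apply Rinv_0_lt_compat; lra|].
    replace (x * (ln x + 2) * / (2 * x)) with (/ 2 * ln x + 1) by (field; lra). lra. }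
  assert (Le := ln_le_exp e x He Hx0).
  assert (E1 : 1 <= exp (e * ln x)).
  { rewrite <- exp_0. apply exp_le_compat. apply Rmult_le_pos; [lra|].
    rewrite <- ln_1. apply ln_le; lra. }
  assert (Fin : x * (ln x + 2) <= (/ e + 2) * exp ((1 + e) * ln x)).
  { replace ((1 + e) * ln x) with (ln x + e * ln x) by ring. rewrite exp_plus, exp_ln by assumption.
    replace ((/ e + 2) * (x * exp (e * ln x))) with (x * (/ e * exp (e * ln x) + 2 * exp (e * ln x))) by ring.
    apply Rmult_le_compat_l; lra. }
  eapply Rle_trans; [exact Cn|]. eapply Rle_trans; [exact Fin|]. right.
  unfold x. rewrite ln_mult by lra. rewrite Rmult_plus_distr_l, exp_plus. ring.
Qed.

Lemma Riemann_good_logs (E B : nat -> R) (alpha : nat -> C) :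
  is_Riemann_sequence E B alpha -> good_logs (fun k => Clog (alpha k)).
Proof.
  intros H. split.
  - intros k. destruct (Riemann_Cmod_le E B alpha k H) as (H1 & _ & H2). split.
    + change (0 <= ln (Cmod (alpha k))). rewrite <- ln_1. apply ln_le; lra.
    + apply Rlt_le, (Rs_arg _ _ _ H k).
  - intros p Hp. set (e := (p - 1) / 2). assert (He : 0 < e) by (unfold e; lra).
    destruct (Riemann_counting E B alpha e H He) as (M & HM & Hc).
    (* Inverting the counting bound gives [|alpha_k|^(- p) <= M^t (k + 1)^(- t)]; the choice
       [e = (p - 1) / 2] makes [t > 1]. *)
    set (t := p / (1 + e)).
    assert (Ht : 1 < t).
    { unfold t. apply Rmult_lt_reg_r with (1 + e); [lra|].
      replace (p / (1 + e) * (1 + e)) with p by (field; lra). unfold e. lra. }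
    apply (@ex_series_le R_AbsRing R_CompleteNormedModule _
             (fun k => exp (t * ln M) * exp (- t * ln (INR (S k))))).
    2:{ apply ex_series_Rscal. apply ex_series_power, Ht. }
    intros k. change (Rabs (exp (- p * ln (Cmod (alpha k)))) <= exp (t * ln M) * exp (- t * ln (INR (S k)))).
    rewrite Rabs_right by (left; apply exp_pos). rewrite <- exp_plus. apply exp_le_compat.
    destruct (Riemann_Cmod_le E B alpha k H) as (H1 & _ & H2).
    assert (L1 : ln (Re (alpha k)) <= ln (Cmod (alpha k))) by (apply ln_le; lra).
    assert (L2 : ln (INR (S k)) <= ln M + (1 + e) * ln (Re (alpha k))).
    { specialize (Hc k). apply ln_le in Hc; [|apply lt_0_INR, Nat.lt_0_succ].
      rewrite ln_mult, ln_exp in Hc by (try assumption; apply exp_pos). exact Hc. }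
    assert (Et : t * (1 + e) = p) by (unfold t; field; lra).
    assert (T : t * ln (INR (S k)) <= t * ln M + p * ln (Re (alpha k))).
    { rewrite <- Et. replace (t * ln M + t * (1 + e) * ln (Re (alpha k)))
        with (t * (ln M + (1 + e) * ln (Re (alpha k)))) by ring.
      apply Rmult_le_compat_l; lra. }
    nra.
Qed.

(** * The asymptotic expansion on the half-line *)

Lemma Ccont_bounded (g : R -> C) (b : R) : Ccont g -> 0 <= b ->
  exists M, forall u, 0 <= u <= b -> Cmod (g u) <= M.
Proof.
  intros Hg Hb.
  destruct (continuity_ab_maj (fun u => Cmod (g u)) 0 b Hb) as [m [Hm _]].
  - intros u _. apply continuity_pt_locally. intros eps.
    destruct (Hg u eps (cond_pos eps)) as [d [Hd H]]. exists (mkposreal d Hd).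
    intros v Hv. specialize (H v Hv). apply Rle_lt_trans with (2 := H).
    assert (T1 := Cmod_triangle_sub (g v) (g u)). assert (T2 := Cmod_triangle_sub (g u) (g v)).
    rewrite (Cmod_sub_sym (g u)) in T2. apply Rabs_le. lra.
  - exists (Cmod (g m)). exact Hm.
Qed.

(* In the variable [u = ln x]. *)
Definition remainder (F : R -> C) (b : nat -> C) (N : nat) (u : R) : C :=
  (F u - (/ 2 * (RtoC u - RtoC (ln (2 * PI))) + sum_n (fun n => b n * Cexp (RtoC u * - RtoC (INR n)))%C N))%C.

Lemma remainder_cont (F : R -> C) (b : nat -> C) (N : nat) : Ccont F -> Ccont (remainder F b N).
Proof.
  intros HF. unfold remainder, Cminus.
  assert (O : forall g, Ccont g -> Ccont (fun u => - g u)%C).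
  { intros g Hg. eapply Ccont_ext; [|apply (Ccont_mult _ _ (Ccont_const (- (1))%C) Hg)].
    intros u. simpl. ring. }
  apply Ccont_plus; [assumption|]. apply O. apply Ccont_plus.
  - apply (Ccont_of_Cdiffable (fun z => / 2 * (z + - RtoC (ln (2 * PI))))%C). intros u. Cdiff.
  - apply (Ccont_sum_n (fun n u => b n * Cexp (RtoC u * - RtoC (INR n)))%C). intros k.
    apply Ccont_mult; [apply Ccont_const|apply Ccont_exp_lin].
Qed.

(** Condition (e) gives the bound with constant 1 for large [u] only. On the remaining compact
    interval the remainder is bounded by continuity, and a larger constant covers it, because the
    Laplace transform needs all [u >= 0]. *)
Lemma Riemann_expansion (E B : nat -> R) (alpha : nat -> C) (F : R -> C) (N : nat) :
  is_Riemann_sequence E B alpha -> generating (fun k => Clog (alpha k)) F ->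
  exists K, forall u, 0 <= u ->
    Cmod (remainder F (fun n => RtoC (coef E B n)) N u) <= K * exp (- INR N * u).
Proof.
  intros H HF.
  assert (HL := Riemann_good_logs E B alpha H).
  destruct (Rs_asymp _ _ _ H) as (a & f & Hf & Has).
  destruct (asymp_real _ _ N Has) as (X & HX & HXb).
  set (U := Rmax 0 (ln (X + Rabs a + 1))).
  assert (Ra := Rle_abs a). assert (Ra0 := Rabs_pos a).
  assert (HU : 0 <= U) by apply Rmax_l.
  assert (Big : forall u, U <= u ->
    Cmod (remainder F (fun n => RtoC (coef E B n)) N u) <= exp (- INR N * u)).
  { intros u Hu.
    assert (Hx : X + Rabs a + 1 <= exp u).
    { rewrite <- (exp_ln (X + Rabs a + 1)) by lra. apply exp_le_compat.
      eapply Rle_trans; [apply Rmax_r|exact Hu]. }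
    set (x := exp u) in *. assert (x0 : 0 < x) by lra.
    specialize (HXb x ltac:(lra)). specialize (Hf (RtoC x) ltac:(simpl; lra)).
    assert (EF : f (RtoC x) = F u).
    { apply (is_Cseries_unique (fun k => 2 * RtoC x / (RtoC x ^ 2 + alpha k ^ 2))%C); [exact Hf|].
      eapply is_Cseries_ext; [|apply HF]. intros k. unfold rterm.
      replace (RtoC u * 2)%C with (RtoC u + RtoC u)%C by ring.
      replace (2 * Clog (alpha k))%C with (Clog (alpha k) + Clog (alpha k))%C by ring.
      rewrite !Cexp_plus, Cexp_Clog, Cexp_R by (eapply Riemann_neq_0; eassumption).
      fold x. f_equal. f_equal; ring. }
    rewrite EF, Clog_2PI in HXb by assumption.
    unfold x in HXb at 1. rewrite ln_exp in HXb.
    replace (exp (- INR N * u)) with (/ x ^ N).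
    2:{ unfold x.
        replace (- INR N * u) with (- (INR N * u)) by ring. rewrite exp_Ropp. f_equal.
        clear. induction N as [|n IH]; [simpl; rewrite Rmult_0_l, exp_0; reflexivity|].
        rewrite S_INR, <- tech_pow_Rmult, IH, <- exp_plus. f_equal. ring. }
    eapply Rle_trans; [|exact HXb]. right. f_equal. unfold remainder.
    rewrite (sum_n_ext (fun n => RtoC (coef E B n) * Cexp (RtoC u * - RtoC (INR n)))%C
               (fun n => RtoC (coef E B n) / RtoC x ^ n)%C).
    - rewrite RtoC_minus.
      match goal with |- context [sum_n ?g N] => generalize (sum_n g N : C) end. intros y. ring.
    - intros n. unfold Cdiv. f_equal.
      replace (RtoC u * - RtoC (INR n))%C with (- (RtoC (INR n * u)))%C by (rewrite RtoC_mult; ring).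
      rewrite Cexp_opp, Cexp_R. f_equal. rewrite <- RtoC_pow. f_equal. unfold x.
      clear. induction n as [|n IH]; [simpl; rewrite Rmult_0_l, exp_0; reflexivity|].
      rewrite S_INR, <- tech_pow_Rmult, <- IH, <- exp_plus. f_equal. ring. }
  destruct (Ccont_bounded (remainder F (fun n => RtoC (coef E B n)) N) U) as [M HM].
  { apply remainder_cont. eapply generating_cont; eassumption. }
  { assumption. }
  exists (Rmax 1 (M * exp (INR N * U))). intros u Hu.
  assert (P := exp_pos (- INR N * u)).
  destruct (Rle_dec U u) as [Hc|Hc].
  - eapply Rle_trans; [apply Big, Hc|]. rewrite <- (Rmult_1_l (exp (- INR N * u))) at 1.
    apply Rmult_le_compat_r; [lra|apply Rmax_l].
  - specialize (HM u ltac:(lra)).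
    apply Rle_trans with (M * exp (INR N * U) * exp (- INR N * u)).
    + rewrite Rmult_assoc, <- exp_plus. assert (M0 := Rle_trans _ _ _ (Cmod_ge_0 _) HM).
      assert (1 <= exp (INR N * U + - INR N * u)).
      { rewrite <- exp_0. apply exp_le_compat. assert (T := pos_INR N). nra. }
      nra.
    + apply Rmult_le_compat_r; [lra|apply Rmax_r].
Qed.

(** * The Bernoulli numbers of even index do not vanish *)

Lemma ex_pseries_radius (a : nat -> R) (x : R) : ex_pseries a x -> Rbar_le (Rabs x) (CV_radius a).
Proof.
  intros H. apply Rbar_not_lt_le. intros N. apply (CV_disk_outside a x N).
  exact (ex_series_lim_0 _ (proj1 (ex_pseries_R a x) H)).
Qed.

Definition mono (m : nat) (c : R) (n : nat) : R := if Nat.eqb n m then c else 0.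

Lemma is_pseries_mono (m : nat) (c t : R) : is_pseries (mono m c) t (c * t ^ m).
Proof.
  apply is_pseries_R.
  assert (S1 : forall n, sum_n (fun n => mono m c n * t ^ n) n = if Nat.leb m n then c * t ^ m else 0).
  { induction n as [|n IH].
    - rewrite sum_n_R0. unfold mono. destruct m; simpl; ring.
    - rewrite sum_n_RS, IH. unfold mono.
      destruct (Nat.leb_spec m n), (Nat.leb_spec m (S n)), (Nat.eqb_spec (S n) m); subst; try lia;
        simpl; ring. }
  apply (filterlim_ext_loc (fun _ => c * t ^ m)).
  - exists m. intros n Hn. rewrite S1. destruct (Nat.leb_spec m n); [reflexivity|lia].
  - apply filterlim_const.
Qed.

Lemma PSeries_coeff_unique (a b : nat -> R) (r : R) : 0 < r ->
  (forall t, Rabs t < r -> ex_pseries a t /\ ex_pseries b t /\ PSeries a t = PSeries b t) ->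
  forall n, a n = b n.
Proof.
  intros Hr H n.
  assert (Hr2 : Rabs (r / 2) < r) by (rewrite Rabs_right; lra).
  destruct (H (r / 2) Hr2) as (Ha & Hb & _).
  apply ex_pseries_radius in Ha. apply ex_pseries_radius in Hb.
  rewrite Rabs_right in Ha, Hb by lra.
  apply PSeries_ext_recip.
  - eapply Rbar_lt_le_trans; [|exact Ha]. simpl. lra.
  - eapply Rbar_lt_le_trans; [|exact Hb]. simpl. lra.
  - exists (mkposreal r Hr). intros t Ht. apply H.
    change (Rabs (t - 0) < r) in Ht. rewrite Rminus_0_r in Ht. exact Ht.
Qed.

(* [g] is the coefficient sequence of [t / (e^t - 1) + t / 2], which solves [t g' = g - g^2 + t^2 / 4]. *)
Lemma Bernoulli_recurrence (B : nat -> R) (g : nat -> R) : is_Bernoulli_numbers B ->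
  (forall n, g n = B n / INR (fact n) + mono 1 (1 / 2) n) ->
  g 0%nat = 1 /\
  forall n, (1 <= n)%nat -> INR n * g n = g n - sum_f_R0 (fun k => g k * g (n - k)%nat) n + mono 2 (1 / 4) n.
Proof.
  intros (r & Hr & HB) Hg.
  set (phi := fun t => t / (exp t - 1) + t / 2).
  assert (Hphi : forall t, 0 < Rabs t < r -> is_pseries g t (phi t)).
  { intros t Ht. apply (is_series_ext (fun k => scal (pow_n t k) (plus (B k / INR (fact k)) (mono 1 (1 / 2) k)))).
    { intros k. rewrite Hg. reflexivity. }
    unfold phi. replace (t / 2) with (1 / 2 * t ^ 1) by (simpl; field).
    apply (is_pseries_plus (fun k => B k / INR (fact k)) (mono 1 (1 / 2)) t).
    - apply HB, Ht.
    - apply is_pseries_mono. }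
  (* Convergence at [r / 2] places all smaller points strictly inside the disc of convergence, where
     termwise differentiation is allowed. *)
  assert (Rad : forall t, Rabs t < r / 2 -> Rbar_lt (Rabs t) (CV_radius g)).
  { intros t Ht. eapply Rbar_lt_le_trans with (Finite (r / 2)); [exact Ht|].
    replace (r / 2) with (Rabs (r / 2)) by (apply Rabs_right; lra).
    apply ex_pseries_radius. exists (phi (r / 2)). apply Hphi. rewrite Rabs_right; lra. }
  assert (Hr2 : 0 < r / 2) by lra.
  assert (Val : forall t, 0 < Rabs t < r / 2 -> PSeries g t = phi t).
  { intros t Ht. apply is_pseries_unique, Hphi. lra. }
  assert (Hexp : forall t, t <> 0 -> exp t - 1 <> 0).
  { intros t Ht. assert (T := exp_ineq1 t Ht). assert (T2 := exp_ineq1 (- t) ltac:(lra)).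
    rewrite exp_Ropp in T2. assert (P := exp_pos t). intros E.
    assert (E1 : exp t = 1) by lra. rewrite E1, Rinv_1 in T2. lra. }
  (* The hypothesis says nothing at [t = 0]. The identity [(e^t - 1) g(t) = t + t / 2 (e^t - 1)]
     does hold there too, and comparing derivatives at 0 gives the constant term. *)
  assert (G0 : g 0%nat = 1).
  { assert (D1 := is_derive_PSeries g 0 (Rad 0 ltac:(rewrite Rabs_R0; lra))).
    assert (D2 : is_derive (fun t => (exp t - 1) * PSeries g t) 0 (g 0%nat)).
    { replace (g 0%nat) with (plus (mult (exp 0) (PSeries g 0)) (mult (exp 0 - 1) (PSeries (PS_derive g) 0))).
      - apply (is_derive_mult (fun t => exp t - 1) (PSeries g)); [|exact D1|intros; apply Rmult_comm].
        auto_derive; auto. ring.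
      - rewrite exp_0, PSeries_0. unfold plus, mult; simpl. unfold mult; simpl. ring. }
    assert (D3 : is_derive (fun t => t + t / 2 * (exp t - 1)) 0 1).
    { auto_derive; auto. rewrite exp_0. field. }
    rewrite <- (is_derive_unique _ _ _ D2).
    transitivity (Derive (fun t => t + t / 2 * (exp t - 1)) 0); [|exact (is_derive_unique _ _ _ D3)].
    apply Derive_ext_loc. exists (mkposreal _ Hr2). intros t Ht.
    change (Rabs (t - 0) < r / 2) in Ht. rewrite Rminus_0_r in Ht.
    destruct (Req_dec t 0) as [->|E].
    - rewrite exp_0. field.
    - rewrite Val by (split; [apply Rabs_pos_lt, E|exact Ht]). unfold phi. field. apply Hexp, E. }
  split; [exact G0|].
  assert (Eq := PSeries_coeff_unique (PS_incr_1 (PS_derive g))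
    (PS_plus (PS_minus g (PS_mult g g)) (mono 2 (1 / 4))) (r / 2) Hr2).
  assert (Eq' : forall n, PS_incr_1 (PS_derive g) n = PS_plus (PS_minus g (PS_mult g g)) (mono 2 (1 / 4)) n).
  { apply Eq. intros t Ht. specialize (Rad t Ht).
    assert (X1 : ex_pseries g t) by (apply CV_radius_inside, Rad).
    assert (X2 : ex_pseries (PS_mult g g) t) by (apply ex_pseries_mult; exact Rad).
    assert (X3 : ex_pseries (mono 2 (1 / 4)) t) by (eexists; apply is_pseries_mono).
    assert (X4 : ex_pseries (PS_minus g (PS_mult g g)) t) by (apply (ex_pseries_minus g (PS_mult g g)); assumption).
    split; [|split].
    - apply @ex_pseries_incr_1. apply ex_pseries_derive, Rad.
    - apply (ex_pseries_plus (PS_minus g (PS_mult g g)) (mono 2 (1 / 4))); assumption.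
    - rewrite PSeries_incr_1, PSeries_plus, PSeries_minus, PSeries_mult by assumption.
      rewrite (is_pseries_unique _ _ _ (is_pseries_mono 2 (1 / 4) t)).
      destruct (Req_dec t 0) as [->|E].
      + rewrite (PSeries_0 g), G0. ring.
      + assert (Ht0 := Rabs_pos_lt t E).
        assert (D : PSeries (PS_derive g) t = / (exp t - 1) - t * exp t / (exp t - 1) ^ 2 + / 2).
        { rewrite <- (is_derive_unique _ _ _ (is_derive_PSeries g t Rad)).
          apply is_derive_unique. apply (is_derive_ext_loc phi).
          - assert (Hd : 0 < Rmin (Rabs t) (r / 2 - Rabs t)) by (apply Rmin_pos; lra).
            exists (mkposreal _ Hd). intros v Hv. change (Rabs (v - t) < Rmin (Rabs t) (r / 2 - Rabs t)) in Hv.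
            assert (V1 := Rlt_le_trans _ _ _ Hv (Rmin_l _ _)).
            assert (V2 := Rlt_le_trans _ _ _ Hv (Rmin_r _ _)).
            symmetry. apply Val.
            assert (T : forall v : R, Rabs (v - t) < Rabs t -> Rabs (v - t) < r / 2 - Rabs t ->
                      0 < Rabs v < r / 2).
            { clear. intros v H1 H2.
              assert (T1 := Rabs_triang (v - t) t). replace (v - t + t) with v in T1 by ring.
              assert (T2 := Rabs_triang (t - v) v). replace (t - v + v) with t in T2 by ring.
              rewrite Rabs_minus_sym in T2. lra. }
            apply T; assumption.
          - unfold phi. auto_derive; [exact (Hexp t E)|]. field. apply Hexp, E. }
        rewrite D, Val by lra. unfold phi. field. apply Hexp, E. }
  intros n Hn. specialize (Eq' n).
  destruct n as [|n]; [lia|].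
  change (PS_incr_1 (PS_derive g) (S n)) with (INR (S n) * g (S n)) in Eq'.
  rewrite Eq'. unfold PS_plus, PS_minus, PS_opp, PS_mult, plus, opp, Rminus. reflexivity.
Qed.

(** The two extreme terms of the convolution contain [g 0 = 1]. Moved to the left they turn the
    factor [n - 1] into [n + 1], and only earlier coefficients remain on the right. *)
Lemma Bernoulli_convolution (g : nat -> R) : g 0%nat = 1 ->
  (forall n, (1 <= n)%nat -> INR n * g n = g n - sum_f_R0 (fun k => g k * g (n - k)%nat) n + mono 2 (1 / 4) n) ->
  g 1%nat = 0 /\ forall p, INR (p + 3) * g (p + 2)%nat
    = mono 2 (1 / 4) (p + 2) - sum_f_R0 (fun k => g (k + 1)%nat * g (p + 1 - k)%nat) p.
Proof.
  intros G0 H. split.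
  - specialize (H 1%nat (Nat.le_refl 1)). simpl in H. unfold mono in H. simpl in H. rewrite G0 in H. lra.
  - intros p. specialize (H (p + 2)%nat ltac:(lia)).
    replace (p + 2)%nat with (S (S p)) in * by lia.
    rewrite tech5, decomp_sum in H by lia. cbn [Init.Nat.pred] in H.
    replace (S (S p) - S (S p))%nat with 0%nat in H by lia.
    replace (S (S p) - 0)%nat with (S (S p)) in H by lia.
    rewrite G0 in H.
    rewrite (sum_eq (fun k => g (k + 1)%nat * g (p + 1 - k)%nat) (fun i => g (S i) * g (S (S p) - S i)%nat)).
    + replace (INR (p + 3)) with (INR (S (S p)) + 1).
      * lra.
      * replace (p + 3)%nat with (S (S (S p))) by lia. rewrite (S_INR (S (S p))). reflexivity.
    + intros i Hi. f_equal; f_equal; lia.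
Qed.

Lemma sum_f_R0_pos (u : nat -> R) (n k : nat) : (forall i, (i <= n)%nat -> 0 <= u i) ->
  (k <= n)%nat -> 0 < u k -> 0 < sum_f_R0 u n.
Proof.
  intros H. induction n as [|n IH]; intros Hk Hu.
  - replace k with 0%nat in Hu by lia. exact Hu.
  - simpl. assert (T := H (S n) (Nat.le_refl _)).
    destruct (Nat.eq_dec k (S n)) as [->|N].
    + assert (0 <= sum_f_R0 u n); [|lra].
      clear -H. assert (H' : forall i, (i <= n)%nat -> 0 <= u i) by (intros; apply H; lia). clear H.
      induction n as [|n IH]; [apply H'; lia|]. simpl.
      assert (T := H' (S n) (Nat.le_refl _)). assert (0 <= sum_f_R0 u n) by (apply IH; intros; apply H'; lia). lra.
    + assert (0 < sum_f_R0 u n) by (apply IH; [intros; apply H; lia|lia|assumption]). lra.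
Qed.

(** By strong induction the odd coefficients of [g] vanish, so only products of even ones survive in
    the recurrence. Those all have the same sign, so no cancellation occurs and the even
    coefficients alternate strictly. *)
Lemma Bernoulli_even_neq_0 (B : nat -> R) (n : nat) :
  is_Bernoulli_numbers B -> (1 <= n)%nat -> B (2 * n)%nat <> 0.
Proof.
  intros HB Hn.
  set (g := fun n => B n / INR (fact n) + mono 1 (1 / 2) n).
  destruct (Bernoulli_recurrence B g HB) as [G0 Hrec]; [reflexivity|].
  destruct (Bernoulli_convolution g G0 Hrec) as [G1 Hp]. clear Hrec.
  assert (Odd : forall m j, (j <= m)%nat -> g (2 * j + 1)%nat = 0).
  { induction m as [|m IH]; intros j Hj.
    - replace j with 0%nat by lia. exact G1.
    - destruct j as [|j]; [exact G1|].
      replace (2 * S j + 1)%nat with ((2 * j + 1) + 2)%nat by lia.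
      specialize (Hp (2 * j + 1)%nat).
      assert (S0 : sum_f_R0 (fun k => g (k + 1)%nat * g (2 * j + 1 + 1 - k)%nat) (2 * j + 1) = 0).
      { apply sum_eq_R0. intros k Hk.
        destruct (Nat.Even_or_Odd k) as [[i Hi]|[i Hi]].
        - replace (k + 1)%nat with (2 * i + 1)%nat by lia. rewrite (IH i) by lia. ring.
        - replace (2 * j + 1 + 1 - k)%nat with (2 * (j - i) + 1)%nat by lia. rewrite (IH (j - i)%nat) by lia. ring. }
      rewrite S0 in Hp. unfold mono in Hp.
      destruct (Nat.eqb_spec (2 * j + 1 + 2) 2); [lia|].
      assert (P : 0 < INR (2 * j + 1 + 3)) by (apply lt_0_INR; lia).
      apply Rmult_eq_reg_l with (INR (2 * j + 1 + 3)); [|lra]. lra. }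
  assert (Even : forall m j, (j <= m)%nat -> 0 < (-1) ^ j * g (2 * j + 2)%nat).
  { induction m as [|m IH]; intros j Hj.
    - replace j with 0%nat by lia. specialize (Hp 0%nat). simpl in Hp. rewrite G1 in Hp.
      unfold mono in Hp. simpl in Hp. simpl. lra.
    - destruct (Nat.eq_dec j 0) as [->|Nj]; [apply IH; lia|].
      specialize (Hp (2 * j)%nat).
      assert (P : 0 < INR (2 * j + 3)) by (apply lt_0_INR; lia).
      unfold mono in Hp. destruct (Nat.eqb_spec (2 * j + 2) 2); [lia|].
      assert (SP : 0 < sum_f_R0 (fun k => - (-1) ^ j * (g (k + 1)%nat * g (2 * j + 1 - k)%nat)) (2 * j)).
      { assert (Term : forall i, (2 * i + 1 <= 2 * j)%nat ->
          0 < - (-1) ^ j * (g (2 * i + 1 + 1)%nat * g (2 * j + 1 - (2 * i + 1))%nat)).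
        { intros i Hi.
          assert (A1 := IH i ltac:(lia)). assert (A2 := IH (j - i - 1)%nat ltac:(lia)).
          replace (2 * i + 1 + 1)%nat with (2 * i + 2)%nat by lia.
          replace (2 * j + 1 - (2 * i + 1))%nat with (2 * (j - i - 1) + 2)%nat by lia.
          replace (- (-1) ^ j) with ((-1) ^ i * (-1) ^ (j - i - 1)).
          - assert (T := Rmult_lt_0_compat _ _ A1 A2). lra.
          - rewrite <- pow_add. replace j with (S (i + (j - i - 1))) at 2 by lia. simpl. ring. }
        apply (sum_f_R0_pos _ (2 * j) 1).
        - intros k Hk. destruct (Nat.Even_or_Odd k) as [[i Hi]|[i Hi]].
          + replace (k + 1)%nat with (2 * i + 1)%nat by lia. rewrite (Odd i i) by lia. lra.
          + subst k. apply Rlt_le, Term. lia.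
        - lia.
        - apply (Term 0%nat). lia. }
      rewrite (sum_eq _ (fun k => (g (k + 1)%nat * g (2 * j + 1 - k)%nat) * - (-1) ^ j)) in SP by (intros; ring).
      rewrite <- scal_sum in SP.
      apply Rmult_lt_reg_l with (INR (2 * j + 3)); [exact P|]. rewrite Rmult_0_r.
      replace (INR (2 * j + 3) * ((-1) ^ j * g (2 * j + 2)%nat))
        with ((-1) ^ j * (INR (2 * j + 3) * g (2 * j + 2)%nat)) by ring.
      rewrite Hp. lra. }
  intros E. specialize (Even n (n - 1)%nat ltac:(lia)).
  replace (2 * (n - 1) + 2)%nat with (2 * n)%nat in Even by lia.
  unfold g, mono in Even. rewrite E in Even.
  destruct (Nat.eqb_spec (2 * n) 1); [lia|]. unfold Rdiv in Even. rewrite Rmult_0_l, Rplus_0_l, Rmult_0_r in Even. lra.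
Qed.

(** * Analytic continuation *)

Definition sgn (m : nat) : C := RtoC ((-1) ^ m).

Lemma sgn_S (m : nat) : sgn (S m) = (- sgn m)%C.
Proof. unfold sgn. rewrite <- tech_pow_Rmult. Ceq_ring. Qed.

Lemma sgn_sqr (m : nat) : (sgn m * sgn m)%C = 1.
Proof.
  unfold sgn. rewrite <- RtoC_mult, <- Rpow_mult_distr.
  replace (-1 * -1) with 1 by ring. rewrite pow1. reflexivity.
Qed.

Definition csig (s : C) : C := Csin (RtoC (PI / 2) * s).

Lemma Csin_shift (x : C) (m : nat) : Csin (x + RtoC (INR m * PI)) = (sgn m * Csin x)%C.
Proof.
  induction m as [|m IH].
  - simpl. rewrite Rmult_0_l. unfold sgn. simpl. rewrite Cplus_0_r. ring.
  - rewrite S_INR, sgn_S.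
    replace (x + RtoC ((INR m + 1) * PI))%C with ((x + RtoC (INR m * PI)) + RtoC PI)%C
      by (rewrite !RtoC_mult, RtoC_plus; ring).
    rewrite Csin_plus, Csin_R, Ccos_R, sin_PI, cos_PI, IH.
    replace (RtoC (-1)) with (- (1))%C by Ceq_ring. ring.
Qed.

(** Exhibits the simple zero at [s = - 2 m], which cancels the denominator [s - 1 + n] for the odd
    index [n = 2 m + 1]. *)
Lemma csig_even (s : C) (m : nat) :
  csig s = (sgn m * (RtoC (PI / 2) * (s + RtoC (2 * INR m)) * Csinc (RtoC (PI / 2) * (s + RtoC (2 * INR m)))))%C.
Proof.
  rewrite <- Csin_sinc. unfold csig.
  replace (RtoC (PI / 2) * (s + RtoC (2 * INR m)))%C with (RtoC (PI / 2) * s + RtoC (INR m * PI))%C.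
  - rewrite Csin_shift, Cmult_assoc, sgn_sqr. ring.
  - replace (INR m * PI) with (PI / 2 * (2 * INR m)) by field. rewrite (RtoC_mult (PI / 2)). ring.
Qed.

(* At the odd integer [1 - 2 m] the function [csig] equals [+-1] up to second order. *)
Lemma csig_odd (s : C) (m : nat) :
  csig s = (sgn m * (1 - 2 * (RtoC (PI / 4) * (s + RtoC (2 * INR m - 1)) * Csinc (RtoC (PI / 4) * (s + RtoC (2 * INR m - 1)))
                           * (RtoC (PI / 4) * (s + RtoC (2 * INR m - 1)) * Csinc (RtoC (PI / 4) * (s + RtoC (2 * INR m - 1)))))))%C.
Proof.
  rewrite <- Csin_sinc, <- Ccos_double.
  set (x := (2 * (RtoC (PI / 4) * (s + RtoC (2 * INR m - 1))))%C).
  assert (E : Ccos x = Csin (x + RtoC (PI / 2))).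
  { rewrite Csin_plus, Csin_R, Ccos_R, sin_PI2, cos_PI2. ring. }
  rewrite E. unfold csig.
  replace (x + RtoC (PI / 2))%C with (RtoC (PI / 2) * s + RtoC (INR m * PI))%C.
  - rewrite Csin_shift, Cmult_assoc, sgn_sqr. ring.
  - unfold x. apply Ceq; Csimpl_goal; field.
Qed.

(* [csig s * b n / (s - 1 + n)], with its removable singularity removed when [n] is odd. *)
Definition Uterm (b : nat -> C) (n : nat) (s : C) : C :=
  if Nat.odd n
  then (b n * (sgn (Nat.div2 n) * (RtoC (PI / 2) * Csinc (RtoC (PI / 2) * (s + RtoC (2 * INR (Nat.div2 n)))))))%C
  else (b n * (csig s / (s + RtoC (INR n - 1))))%C.

(** The Laplace transform at [s - 1] of [(u - ln (2 pi)) / 2], the logarithmic part of the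
    expansion. *)
Definition head_term (s : C) : C :=
  (/ 2 * (/ ((s - 1) * (s - 1)) - RtoC (ln (2 * PI)) * / (s - 1)))%C.

Lemma Uterm_generic (b : nat -> C) (n : nat) (s : C) : (s + RtoC (INR n - 1))%C <> 0 ->
  Uterm b n s = (csig s * (b n / (s + RtoC (INR n - 1))))%C.
Proof.
  intros H. unfold Uterm. destruct (Nat.odd n) eqn:Ho.
  - assert (En : INR n - 1 = 2 * INR (Nat.div2 n)).
    { rewrite (Nat.div2_odd n) at 1. rewrite Ho, plus_INR, mult_INR. simpl. ring. }
    rewrite En in *. rewrite (csig_even s (Nat.div2 n)). field. exact H.
  - field. exact H.
Qed.

Lemma csig_diffable (s : C) : Cdiffable csig s.
Proof. apply (Cdiffable_comp Csin (fun z => RtoC (PI / 2) * z)%C); [Cdiff|apply Csin_diffable]. Qed.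

Lemma Csinc_affine_diffable (c d s : C) : Cdiffable (fun z => Csinc (c * (z + d))%C) s.
Proof. apply (Cdiffable_comp Csinc (fun z => c * (z + d))%C); [Cdiff|apply Csinc_diffable]. Qed.

Lemma Uterm_diffable (b : nat -> C) (n : nat) (s : C) :
  (Nat.odd n = false -> (s + RtoC (INR n - 1))%C <> 0) -> Cdiffable (Uterm b n) s.
Proof.
  intros H. unfold Uterm. destruct (Nat.odd n).
  - Cdiff. apply Csinc_affine_diffable.
  - Cdiff; [apply H; reflexivity|apply csig_diffable].
Qed.

Lemma Cdiffable_sum_n (g : nat -> C -> C) (N : nat) (s : C) :
  (forall n, (n <= N)%nat -> Cdiffable (g n) s) -> Cdiffable (fun z => sum_n (fun n => g n z) N) s.
Proof.
  intros H. induction N as [|N IH].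
  - eapply Cdiffable_ext; [|apply (H 0%nat); lia]. intros z. symmetry. apply (sum_n_C0 (fun n => g n z)).
  - eapply Cdiffable_ext; [|apply (Cdiffable_plus (fun z => sum_n (fun n => g n z) N) (g (S N)))].
    + intros z. symmetry. apply (sum_n_CS (fun n => g n z)).
    + apply IH. intros n Hn. apply H. lia.
    + apply H. lia.
Qed.

Lemma Cdiffable_ext_disc (F G : C -> C) (s : C) (d : R) : 0 < d ->
  (forall z, Cmod (z - s)%C < d -> F z = G z) -> Cdiffable F s -> Cdiffable G s.
Proof.
  intros Hd H [D HD]. exists D. apply (is_Cder_ext_loc F G s D d Hd); [|exact HD].
  intros h Hh. apply H. replace (s + h - s)%C with h by ring. exact Hh.
Qed.

Lemma exp_term_IInt (w c : C) (n : nat) : - INR n < Re w ->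
  is_IInt (fun u => c * Cexp (RtoC u * - RtoC (INR n)) * Cexp (RtoC u * - w))%C (c / (w + RtoC (INR n)))%C.
Proof.
  intros Hw. unfold Cdiv.
  apply (is_IInt_ext (fun u => c * Cexp (RtoC u * - (w + RtoC (INR n))))%C).
  - intros u. rewrite <- Cmult_assoc, <- Cexp_plus. do 2 f_equal. ring.
  - apply is_IInt_scal, is_IInt_exp.
    replace (Re (w + RtoC (INR n))%C) with (Re w + INR n) by (Csimpl_goal; ring). lra.
Qed.

(** [W N] is the candidate on [1 - N < Re s < 2]. Two successive candidates agree by an explicit
    integral, and [W 0] agrees with the Dirichlet series on [1 < Re s < 2] by [generating_mellin];
    all pieces thus fit together. The hypothesis [b 0 = 0] excludes a further contribution to the
    pole at 1. *)
Lemma continuation (L : nat -> C) (F : R -> C) (b : nat -> C) :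
  good_logs L -> generating L F -> b 0%nat = 0 ->
  (forall N, exists K, forall u, 0 <= u -> Cmod (remainder F b N u) <= K * exp (- INR N * u)) ->
  exists Z : C -> C,
    (forall s, 1 < Re s -> is_Cseries (fun k => Cexp (- s * L k)) (Z s) /\ Cdiffable Z s) /\
    (forall N, exists Rg : C -> C, forall s, 1 - INR N < Re s < 2 ->
      Cdiffable Rg s /\
      Z s = (/ RtoC PI * (csig s * Rg s + csig s * head_term s + sum_n (fun n => Uterm b n s) N))%C).
Proof.
  intros HL HF Hb0 Hexp.
  assert (Fc := generating_cont L F HL HF).
  destruct (Dirichlet_diffable L HL) as [Zd HZd].
  destruct (Laplace_exists (fun v => F (- v)) (2 * Series (fun k => exp (- (2) * Re (L k)))) 1) as [Lm HLm].
  { apply Ccont_opp_arg, Fc. }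
  { intros u Hu. assert (T := generating_bound L F (- u) 2 HL HF ltac:(lra)).
    eapply Rle_trans; [exact T|]. right. replace ((2 - 1) * - u) with (- (1) * u) by ring. ring. }
  assert (HN : forall N, exists LN : C -> C, forall s, - INR N < Re s ->
     is_IInt (fun u => remainder F b N u * Cexp (RtoC u * (- s)))%C (LN s) /\ Cdiffable LN s).
  { intros N. destruct (Hexp N) as [K HK]. apply (Laplace_exists (remainder F b N) K); [|exact HK].
    apply remainder_cont, Fc. }
  apply choice in HN. destruct HN as [LN HLN].
  (* The first summand is the part [u < 0], reflected, and needs [Re s < 2]; the second is the part
     [u > 0] after subtraction of [N] terms. *)
  set (Rg := fun N s => (Lm (1 - s) + LN N (s - 1))%C).
  assert (HRg : forall N s, 1 - INR N < Re s < 2 -> Cdiffable (Rg N) s).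
  { intros N s Hs. unfold Rg.
    apply (Cdiffable_plus (fun s => Lm (1 - s)%C) (fun s => LN N (s - 1)%C)).
    - apply (Cdiffable_comp Lm (fun s => 1 - s)%C); [Cdiff|]. apply HLm.
      replace (Re (1 - s)%C) with (1 - Re s) by (Csimpl_goal; ring). lra.
    - apply (Cdiffable_comp (LN N) (fun s => s - 1)%C); [Cdiff|]. apply HLN.
      replace (Re (s - 1)%C) with (Re s - 1) by (Csimpl_goal; ring). lra. }
  set (W := fun N s => (/ RtoC PI * (csig s * Rg N s + csig s * head_term s + sum_n (fun n => Uterm b n s) N))%C).
  assert (PP := PI_RGT_0).
  assert (PC : RtoC PI <> 0) by (apply RtoC_neq_0; lra).
  assert (Hstep : forall N s, 1 - INR N < Re s < 2 -> W N s = W (S N) s).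
  { intros N s Hs. unfold W. rewrite sum_n_CS.
    assert (Hre : Re (s - 1)%C = Re s - 1) by (Csimpl_goal; ring).
    assert (Hden : (s + RtoC (INR (S N) - 1))%C <> 0).
    { intros E. apply (f_equal Re) in E. change (Re s + (INR (S N) - 1) = 0) in E.
      rewrite S_INR in E. lra. }
    rewrite (Uterm_generic b (S N) s Hden).
    (* The two remainders differ by one exponential, still integrable here because [Re s > 1 - N];
       its integral is the new polar term. *)
    assert (EL : LN N (s - 1)%C = (LN (S N) (s - 1) + b (S N) / (s + RtoC (INR (S N) - 1)))%C).
    { apply (is_IInt_unique (fun u => remainder F b N u * Cexp (RtoC u * - (s - 1)))%C).
      - apply HLN. rewrite Hre. lra.
      - assert (I1 : is_IInt (fun u => remainder F b (S N) u * Cexp (RtoC u * - (s - 1)))%C (LN (S N) (s - 1)%C)).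
        { apply HLN. rewrite Hre, S_INR. lra. }
        assert (I2 := exp_term_IInt (s - 1) (b (S N)) (S N) ltac:(rewrite Hre, S_INR; lra)).
        replace (s - 1 + RtoC (INR (S N)))%C with (s + RtoC (INR (S N) - 1))%C in I2 by (rewrite RtoC_minus; ring).
        eapply is_IInt_ext; [|apply (is_IInt_plus _ _ _ _ I1 I2)].
        intros u. unfold remainder. rewrite sum_n_CS.
        generalize (sum_n (fun n : nat => (b n * Cexp (u * - INR n))%C) N : C). intros y. ring. }
    unfold Rg. rewrite EL.
    generalize (sum_n (fun n => Uterm b n s) N : C). intros y. ring. }
  assert (Hle : forall N M s, (N <= M)%nat -> 1 - INR N < Re s < 2 -> W N s = W M s).
  { intros N M s HNM Hs. induction HNM as [|M HNM IH]; [reflexivity|].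
    rewrite IH. apply Hstep. apply le_INR in HNM. lra. }
  assert (Hd : forall N s, 1 < Re s < 2 -> W N s = Zd s).
  { intros N s Hs. rewrite <- (Hle 0%nat N s); [|lia|simpl; lra].
    unfold W.
    assert (Hre : Re (s - 1)%C = Re s - 1) by (Csimpl_goal; ring).
    assert (s1 : (s - 1)%C <> 0).
    { intros E. apply (f_equal Re) in E. rewrite Hre in E. simpl in E. lra. }
    assert (I : is_BInt (fun u => F u * Cexp (RtoC u * (1 - s)))%C (Rg 0%nat s + head_term s)%C).
    { exists (LN 0%nat (s - 1) + head_term s)%C, (Lm (1 - s)%C). split; [|split].
      - assert (I1 : is_IInt (fun u => remainder F b 0 u * Cexp (RtoC u * - (s - 1)))%C (LN 0%nat (s - 1)%C)).
        { apply HLN. rewrite Hre. simpl. lra. }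
        assert (I2 := is_IInt_u_exp (s - 1) ltac:(rewrite Hre; lra)).
        assert (I3 := is_IInt_scal (RtoC (ln (2 * PI))) _ _ (is_IInt_exp (s - 1) ltac:(rewrite Hre; lra))).
        assert (I4 := is_IInt_plus _ _ _ _ I1 (is_IInt_scal (/ 2)%C _ _ (is_IInt_minus _ _ _ _ I2 I3))).
        eapply is_IInt_ext; [|exact I4]. intros u. cbv beta. unfold remainder.
        rewrite sum_n_C0, Hb0.
        replace (RtoC u * (1 - s))%C with (RtoC u * - (s - 1))%C by ring. ring.
      - eapply is_IInt_ext; [|apply HLm].
        + intros u. cbv beta. f_equal. f_equal.
          replace (RtoC (- u)) with (- RtoC u)%C by Ceq_ring. ring.
        + replace (Re (1 - s)%C) with (1 - Re s) by (Csimpl_goal; ring). lra.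
      - unfold Rg. ring. }
    assert (T := generating_mellin L F s _ _ HL HF Hs I (proj1 (HZd s ltac:(lra)))).
    fold (csig s) in T. rewrite sum_n_C0.
    replace (Uterm b 0 s) with (RtoC 0) by (unfold Uterm; simpl; rewrite Hb0; ring).
    replace (csig s * Rg 0%nat s + csig s * head_term s + 0)%C with (csig s * (Rg 0%nat s + head_term s))%C by ring.
    rewrite T. field. exact PC. }
  assert (Hn : forall s, exists N, 1 - INR N < Re s).
  { intros s. destruct (INR_archimed 1 (1 - Re s)) as [N H]; [lra|]. exists N. lra. }
  apply choice in Hn. destruct Hn as [n0 Hn0].
  (* [n0 s] is an arbitrary admissible index; by [Hle] the value does not depend on it, so local
     formulas with a fixed [N] are available. *)
  exists (fun s => if Rlt_dec 1 (Re s) then Zd s else W (n0 s) s).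
  split.
  - intros s Hs. destruct (Rlt_dec 1 (Re s)) as [_|]; [|lra]. split; [apply HZd, Hs|].
    apply (Cdiffable_ext_disc Zd _ s (Re s - 1)); [lra| |apply HZd, Hs].
    intros z Hz. assert (T := re_le_Cmod (z - s)).
    replace (Re (z - s)%C) with (Re z - Re s) in T by (Csimpl_goal; ring).
    apply Rabs_le_between in T. destruct (Rlt_dec 1 (Re z)); [reflexivity|lra].
  - intros N. exists (Rg N). intros s Hs. split; [apply HRg, Hs|].
    change (/ RtoC PI * (csig s * Rg N s + csig s * head_term s + sum_n (fun n => Uterm b n s) N))%C with (W N s).
    destruct (Rlt_dec 1 (Re s)) as [H1|H1].
    + symmetry. apply Hd. lra.
    + specialize (Hn0 s). destruct (Nat.le_ge_cases N (n0 s)).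
      * symmetry. apply Hle; assumption.
      * apply Hle; [assumption|lra].
Qed.

(** * Poles and principal parts *)

Lemma locally_C_disc (z : C) (d : R) (P : C -> Prop) : 0 < d ->
  (forall s, Cmod (s - z)%C < d -> P s) -> locally z P.
Proof.
  intros Hd H. apply locally_C. exists (mkposreal d Hd). intros s Hs. apply H. exact Hs.
Qed.

Lemma locally_C_disc_inv (z : C) (P : C -> Prop) : locally z P ->
  exists d, 0 < d /\ forall s, Cmod (s - z)%C < d -> P s.
Proof.
  intros H. apply locally_C in H. destruct H as [d Hd]. exists d. split; [apply cond_pos|].
  intros s Hs. apply Hd. exact Hs.
Qed.

Lemma holomorphic_at_disc (f : C -> C) (z : C) (d : R) : 0 < d ->
  (forall s, Cmod (s - z)%C < d -> Cdiffable f s) -> holomorphic_at f z.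
Proof.
  intros Hd H. apply (locally_C_disc z d); [assumption|].
  intros s Hs. apply Cdiffable_ex_derive, H, Hs.
Qed.

Lemma holomorphic_at_continuous (f : C -> C) (z : C) : holomorphic_at f z -> Cdiffable f z.
Proof.
  intros H. apply locally_C_disc_inv in H. destruct H as (d & Hd & H).
  destruct (H z) as [D [_ HD]].
  { replace (z - z)%C with (RtoC 0) by ring. rewrite Cmod_0. exact Hd. }
  exists D. intros eps He.
  destruct (HD z (fun P HP => HP) (mkposreal eps He)) as [e He2].
  exists e. split; [apply cond_pos|]. intros h Hh.
  specialize (He2 (z + h)%C).
  assert (E : minus (z + h)%C z = h :> C) by (change ((z + h) - z = h)%C; ring).
  replace h with (minus (z + h)%C z : C) at 2 3.
  apply He2. change (Cmod (minus (z + h)%C z) < e). rewrite E. exact Hh.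
Qed.

(** The polynomial [(s - z)^m] times the polar sum, in Horner form, so that it also makes sense at
    [z], where for [m >= 1] its value is [c m]. *)
Fixpoint polar_numerator (z : C) (c : nat -> C) (m : nat) (s : C) : C :=
  match m with
  | O => 0
  | S m' => ((s - z) * polar_numerator z c m' s + c (S m'))%C
  end.

Lemma polar_sum_S (z : C) (m : nat) (c : nat -> C) (s : C) :
  polar_sum z (S m) c s = (polar_sum z m c s + c (S m) / (s - z) ^ (S m))%C.
Proof. unfold polar_sum. rewrite sum_n_Sm by lia. reflexivity. Qed.

Lemma polar_sum_0 (z : C) (c : nat -> C) (s : C) : polar_sum z 0 c s = 0.
Proof. unfold polar_sum. rewrite sum_n_m_zero by lia. reflexivity. Qed.

Lemma polar_sum_numerator (z : C) (c : nat -> C) (m : nat) (s : C) : s <> z ->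
  ((s - z) ^ m * polar_sum z m c s)%C = polar_numerator z c m s.
Proof.
  intros Hs. assert (H0 : (s - z)%C <> 0).
  { intros E. apply Hs. replace s with ((s - z) + z)%C by ring. rewrite E. ring. }
  induction m as [|m IH].
  - rewrite polar_sum_0. simpl. ring.
  - rewrite polar_sum_S. simpl polar_numerator. rewrite <- IH.
    assert (P : ((s - z) ^ S m)%C <> 0) by (apply Cpow_nz, H0).
    replace ((s - z) ^ S m * (polar_sum z m c s + c (S m) / (s - z) ^ S m))%C
      with ((s - z) ^ S m * polar_sum z m c s + c (S m))%C by (field; exact P).
    simpl. ring.
Qed.

Lemma polar_numerator_diffable (z : C) (c : nat -> C) (m : nat) (s : C) :
  Cdiffable (polar_numerator z c m) s.
Proof.
  induction m as [|m IH]; simpl; [apply Cdiffable_const|]. Cdiff. exact IH.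
Qed.

Lemma Cdiffable_pow (z : C) (m : nat) (s : C) : Cdiffable (fun w => (w - z) ^ m)%C s.
Proof.
  induction m as [|m IH]; simpl; [apply Cdiffable_const|].
  apply (Cdiffable_mult (fun w => w - z)%C (fun w => (w - z) ^ m)%C); [Cdiff|exact IH].
Qed.

(** Clearing denominators gives [phi], which vanishes near [z] except perhaps at [z] and is
    continuous there; but [phi z = - c m], so the leading coefficient would be 0. *)
Lemma not_pole_of_diffable (f : C -> C) (z : C) : Cdiffable f z -> ~ is_pole f z.
Proof.
  intros Hf (m & Hm & c & Hc & _ & g & Hg & Hfg).
  apply holomorphic_at_continuous in Hg.
  apply locally_C_disc_inv in Hfg. destruct Hfg as (d & Hd & Hfg).
  set (phi := fun s => ((s - z) ^ m * (f s - g s) - polar_numerator z c m s)%C).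
  assert (Dphi : Cdiffable phi z).
  { apply Cdiffable_minus; [|apply polar_numerator_diffable].
    apply (Cdiffable_mult (fun s => (s - z) ^ m)%C (fun s => f s - g s)%C); [apply Cdiffable_pow|].
    apply Cdiffable_minus; assumption. }
  assert (Pz : phi z = (- c m)%C).
  { unfold phi. destruct m as [|m]; [lia|]. simpl. ring. }
  assert (P0 : phi z = 0).
  { apply Cmod_eq_0. apply Rle_antisym; [|apply Cmod_ge_0]. apply le_epsilon. intros eps He.
    destruct Dphi as [D HD]. destruct (is_Cder_continuous phi z D HD eps He) as (e & He2 & H).
    set (h := Rmin d e / 2). assert (Hmin : 0 < Rmin d e) by (apply Rmin_pos; lra).
    assert (M1 := Rmin_l d e). assert (M2 := Rmin_r d e).
    specialize (H (RtoC h)). rewrite Cmod_R, Rabs_right in H by (unfold h; lra).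
    specialize (H ltac:(unfold h; lra)).
    assert (Hne : (z + RtoC h)%C <> z).
    { intros E. assert (E2 : RtoC h = 0) by (replace (RtoC h) with ((z + RtoC h) - z)%C by ring; rewrite E; ring).
      apply (f_equal Re) in E2. simpl in E2. unfold h in E2. lra. }
    assert (E : phi (z + RtoC h)%C = 0).
    { unfold phi. rewrite <- polar_sum_numerator by exact Hne. rewrite Hfg.
      - ring.
      - replace (z + RtoC h - z)%C with (RtoC h) by ring. rewrite Cmod_R, Rabs_right; unfold h; lra.
      - exact Hne. }
    rewrite E in H. replace (0 - phi z)%C with (- phi z)%C in H by ring. rewrite Cmod_opp in H. lra. }
  apply Hc. replace (c m) with (- - c m)%C by ring. rewrite <- Pz, P0. ring.
Qed.

Lemma has_principal_part_intro (f p g : C -> C) (z : C) (m : nat) (c : nat -> C) (d : R) : 0 < d ->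
  (forall s, s <> z -> p s = polar_sum z m c s) ->
  (forall s, Cmod (s - z)%C < d -> Cdiffable g s) ->
  (forall s, Cmod (s - z)%C < d -> s <> z -> f s = (p s + g s)%C) ->
  has_principal_part f z p.
Proof.
  intros Hd Hp Hg Hf. split; [eauto|]. exists g. split.
  - apply (holomorphic_at_disc g z d); assumption.
  - apply (locally_C_disc z d); assumption.
Qed.

(** * Poles and special values of the continued function *)

Definition continued (b : nat -> C) (Z : C -> C) : Prop :=
  (forall s, 1 < Re s -> Cdiffable Z s) /\
  (forall N, exists Rg : C -> C, forall s, 1 - INR N < Re s < 2 ->
    Cdiffable Rg s /\
    Z s = (/ RtoC PI * (csig s * Rg s + csig s * head_term s + sum_n (fun n => Uterm b n s) N))%C).

Lemma disc_Re (s z : C) (d : R) : Cmod (s - z)%C < d -> Re z - d < Re s < Re z + d.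
Proof.
  intros H. assert (T := re_le_Cmod (s - z)).
  change (Re (s - z)%C) with (Re s - Re z) in T. apply Rabs_le_between in T. lra.
Qed.

Lemma head_term_diffable (s : C) : s <> 1 -> Cdiffable head_term s.
Proof.
  intros H. assert (H1 : (s - 1)%C <> 0).
  { intros E. apply H. replace s with ((s - 1) + 1)%C by ring. rewrite E. ring. }
  unfold head_term. Cdiff; [apply Cmult_neq_0; exact H1|exact H1].
Qed.

Lemma Uterm_denominator (s : C) (n : nat) : Nat.odd n = false -> s <> 1 ->
  (forall m, (1 <= m)%nat -> n = (2 * m)%nat -> s <> RtoC (- (2 * INR m - 1))) ->
  (s + RtoC (INR n - 1))%C <> 0.
Proof.
  intros Ho H1 Hm E.
  assert (Es : s = RtoC (1 - INR n)).
  { replace s with ((s + RtoC (INR n - 1)) - RtoC (INR n - 1))%C by ring. rewrite E.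
    rewrite !RtoC_minus. ring. }
  assert (En : n = (2 * Nat.div2 n)%nat).
  { rewrite (Nat.div2_odd n) at 1. rewrite Ho. simpl. lia. }
  destruct (Nat.eq_dec (Nat.div2 n) 0) as [E0|N0].
  - apply H1. rewrite Es, En, E0. simpl. rewrite Rminus_0_r. reflexivity.
  - apply (Hm (Nat.div2 n) ltac:(lia) En). rewrite Es. rewrite En at 1.
    rewrite mult_INR. f_equal. simpl. ring.
Qed.

Lemma continued_regular (b : nat -> C) (Z : C -> C) (s : C) : continued b Z -> s <> 1 ->
  (forall m, (1 <= m)%nat -> s <> RtoC (- (2 * INR m - 1))) -> Cdiffable Z s.
Proof.
  intros [HZ1 HZN] Hs1 Hsm.
  destruct (Rlt_dec 1 (Re s)) as [H|H]; [apply HZ1, H|].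
  destruct (INR_archimed 1 (1 - Re s)) as [N HN]; [lra|].
  destruct (HZN N) as [Rg HRg].
  assert (Hd : 0 < Rmin (Re s - (1 - INR N)) (2 - Re s)) by (apply Rmin_pos; lra).
  assert (M1 := Rmin_l (Re s - (1 - INR N)) (2 - Re s)).
  assert (M2 := Rmin_r (Re s - (1 - INR N)) (2 - Re s)).
  eapply (Cdiffable_ext_disc _ Z s _ Hd).
  - intros z Hz. symmetry. apply HRg. apply disc_Re in Hz. lra.
  - destruct (HRg s ltac:(lra)) as [HR _].
    apply Cdiffable_mult; [apply Cdiffable_const|].
    apply (Cdiffable_plus (fun s => csig s * Rg s + csig s * head_term s)%C
             (fun s => sum_n (fun n => Uterm b n s) N)).
    + apply Cdiffable_plus; apply Cdiffable_mult; auto using csig_diffable, head_term_diffable.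
    + apply (Cdiffable_sum_n (Uterm b)). intros n _. apply Uterm_diffable. intros Ho.
      apply Uterm_denominator; auto.
Qed.

Definition polar_one (k : nat) : C :=
  if Nat.eqb k 1 then RtoC (- (ln (2 * PI) / (2 * PI))) else (1 / (2 * PI))%C.

Lemma RtoC_PI_neq_0 : RtoC PI <> 0.
Proof. apply RtoC_neq_0, PI_neq0. Qed.

Lemma polar_one_sum (s : C) : s <> 1 ->
  (1 / (2 * PI * (s - 1) ^ 2) - ln (2 * PI) / (2 * PI * (s - 1)))%C = polar_sum 1 2 polar_one s.
Proof.
  intros H. assert (H1 : (s - 1)%C <> 0).
  { intros E. apply H. replace s with ((s - 1) + 1)%C by ring. rewrite E. ring. }
  rewrite !polar_sum_S, polar_sum_0. unfold polar_one. simpl.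
  assert (PP := PI_RGT_0).
  rewrite RtoC_opp, RtoC_div, RtoC_mult by lra.
  field. repeat split; auto using RtoC_PI_neq_0, Ctwo_neq_0.
Qed.

(** By [csig_odd] with [m = 0], [csig s] is 1 up to a multiple of [(s - 1)^2]. Hence multiplying the
    double pole of [head_term] by it adds only an entire function, and the principal part is that of
    [head_term] divided by [pi]. *)
Lemma continued_pole_one (b : nat -> C) (Z : C -> C) (p : C -> C) : continued b Z -> b 0%nat = 0 ->
  (forall s : C, s <> 1 -> p s = polar_sum 1 2 polar_one s) -> has_principal_part Z 1 p.
Proof.
  intros [_ HZN] Hb0 Hp. destruct (HZN 1%nat) as [Rg HRg].
  set (y := fun s : C => (s + RtoC (2 * INR 0 - 1))%C).
  set (K := fun s : C => Csinc (RtoC (PI / 4) * y s)%C).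
  apply (has_principal_part_intro Z p
    (fun s => / RtoC PI * (csig s * Rg s
       - RtoC (PI / 4) * RtoC (PI / 4) * (K s * K s) * (1 - RtoC (ln (2 * PI)) * y s) + Uterm b 1 s))%C
    1 2 polar_one 1).
  - lra.
  - exact Hp.
  - intros s Hs. apply disc_Re in Hs. simpl in Hs.
    destruct (HRg s) as [HR _]; [simpl; lra|].
    assert (HK : Cdiffable K s) by apply Csinc_affine_diffable.
    assert (Hy : Cdiffable y s) by (unfold y; Cdiff).
    assert (HU : Cdiffable (Uterm b 1) s) by (apply Uterm_diffable; discriminate).
    assert (Hc := csig_diffable s).
    Cdiff; assumption.
  - intros s Hs Hs1. apply disc_Re in Hs. simpl in Hs.
    destruct (HRg s) as [_ ->]; [simpl; lra|].
    rewrite Hp, <- polar_one_sum by assumption.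
    assert (H1 : (s - 1)%C <> 0).
    { intros E. apply Hs1. replace s with ((s - 1) + 1)%C by ring. rewrite E. ring. }
    rewrite sum_n_CS, sum_n_C0.
    replace (Uterm b 0 s) with (RtoC 0) by (unfold Uterm; simpl; rewrite Hb0; ring).
    assert (Ey : y s = (s - 1)%C) by (unfold y; simpl; Ceq_ring).
    assert (Ec : csig s = (1 - 2 * (RtoC (PI / 4) * (s - 1) * K s * (RtoC (PI / 4) * (s - 1) * K s)))%C).
    { rewrite (csig_odd s 0). fold (y s). fold (K s). rewrite Ey. unfold sgn. simpl. ring. }
    assert (Eh : (csig s * head_term s)%C =
       (head_term s - RtoC (PI / 4) * RtoC (PI / 4) * (K s * K s) * (1 - RtoC (ln (2 * PI)) * y s))%C).
    { rewrite Ec, Ey. unfold head_term. field. exact H1. }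
    rewrite Eh, Ey. unfold head_term.
    field. repeat split; auto using RtoC_PI_neq_0, Ctwo_neq_0.
Qed.

(** Near [1 - 2 m] only the term of index [2 m] is singular, and [csig] equals [(-1)^m] there up to
    second order, so the singular part is just [(-1)^m b_(2m) / y]. *)
Lemma continued_pole_odd (b : nat -> C) (Z : C -> C) (p : C -> C) (m : nat) : continued b Z ->
  (1 <= m)%nat ->
  (forall s : C, s <> RtoC (- (2 * INR m - 1)) ->
     p s = polar_sum (RtoC (- (2 * INR m - 1))) 1 (fun _ => sgn m * b (2 * m)%nat / RtoC PI)%C s) ->
  has_principal_part Z (RtoC (- (2 * INR m - 1))) p.
Proof.
  (* Using [2 m + 1] terms the formula holds for [Re s > - 2 m], which covers the unit disc around
     the pole. *)
  intros [_ HZN] Hm Hp. destruct (HZN (2 * m + 1)%nat) as [Rg HRg].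
  assert (EN : 1 - INR (2 * m + 1) = - (2 * INR m)).
  { rewrite plus_INR, mult_INR. simpl. ring. }
  assert (Hm1 : 1 <= INR m) by (apply (le_INR 1), Hm).
  set (z0 := RtoC (- (2 * INR m - 1))) in *.
  assert (Rz0 : Re z0 = - (2 * INR m - 1)) by reflexivity.
  set (y := fun s : C => (s + RtoC (2 * INR m - 1))%C).
  set (K := fun s : C => Csinc (RtoC (PI / 4) * y s)%C).
  (* This is [2 m - 1]: the sum is split into the terms up to [N], the singular term [2 m], and the
     term [2 m + 1]. *)
  set (N := (2 * (m - 1) + 1)%nat).
  apply (has_principal_part_intro Z p
    (fun s => / RtoC PI * (csig s * Rg s + csig s * head_term s + sum_n (fun n => Uterm b n s) N
        + Uterm b (2 * m + 1) s
        - 2 * sgn m * b (2 * m)%nat * (RtoC (PI / 4) * RtoC (PI / 4)) * (K s * K s) * y s))%C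
    z0 1 (fun _ => sgn m * b (2 * m)%nat / RtoC PI)%C 1).
  - lra.
  - exact Hp.
  - intros s Hs. apply disc_Re in Hs. rewrite Rz0 in Hs.
    destruct (HRg s) as [HR _]; [rewrite EN; lra|].
    assert (HK : Cdiffable K s) by apply Csinc_affine_diffable.
    assert (Hy : Cdiffable y s) by (unfold y; Cdiff).
    assert (Hs1 : s <> 1). { intros E. rewrite E in Hs. simpl in Hs. lra. }
    assert (HU : Cdiffable (Uterm b (2 * m + 1)) s).
    { apply Uterm_diffable. intros Ho.
      rewrite Nat.add_1_r, Nat.odd_succ, Nat.even_mul in Ho. discriminate. }
    assert (Hc := csig_diffable s). assert (Hh := head_term_diffable s Hs1).
    assert (HS : Cdiffable (fun s => sum_n (fun n => Uterm b n s) N) s).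
    { apply (Cdiffable_sum_n (Uterm b)). intros n Hn. apply Uterm_diffable. intros Ho.
      apply Uterm_denominator; auto. intros j Hj Ej Es. rewrite Es in Hs.
      assert (Hjm : INR (j + 1) <= INR m) by (apply le_INR; unfold N in Hn; lia).
      rewrite plus_INR in Hjm. simpl in Hs, Hjm. lra. }
    apply Cdiffable_mult; [apply Cdiffable_const|].
    apply Cdiffable_minus; [apply Cdiffable_plus; [apply Cdiffable_plus; [|exact HS]|exact HU]|].
    + Cdiff; assumption.
    + Cdiff; assumption.
  - intros s Hs Hs0. apply disc_Re in Hs. rewrite Rz0 in Hs.
    destruct (HRg s) as [_ ->]; [rewrite EN; lra|].
    rewrite Hp, polar_sum_S, polar_sum_0 by assumption.
    assert (Ey : y s = (s - z0)%C).
    { unfold y, z0. rewrite RtoC_opp. ring. }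
    assert (Hy0 : y s <> 0).
    { rewrite Ey. intros E. apply Hs0. replace s with ((s - z0) + z0)%C by ring. rewrite E. ring. }
    replace (2 * m + 1)%nat with (S (2 * m)) at 1 by lia.
    rewrite sum_n_CS. replace (2 * m)%nat with (S N) at 1 by (unfold N; lia). rewrite sum_n_CS.
    replace (S N) with (2 * m)%nat by (unfold N; lia). replace (S (2 * m)) with (2 * m + 1)%nat by lia.
    assert (EU : Uterm b (2 * m) s = (sgn m * b (2 * m)%nat / y s
        - 2 * sgn m * b (2 * m)%nat * (RtoC (PI / 4) * RtoC (PI / 4)) * (K s * K s) * y s)%C).
    { unfold Uterm. replace (Nat.odd (2 * m)) with false by (symmetry; rewrite Nat.odd_mul; reflexivity).
      assert (E2 : (s + RtoC (INR (2 * m) - 1))%C = y s) by (unfold y; rewrite mult_INR; reflexivity).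
      rewrite E2. rewrite (csig_odd s m). fold (y s). fold (K s). field. exact Hy0. }
    rewrite EU, <- Ey. simpl Cpow. rewrite Cmult_1_r.
    generalize (sum_n (fun n => Uterm b n s) N : C). intros x.
    field; repeat split; auto using RtoC_PI_neq_0.
Qed.

Lemma sum_n_C_zero (a : nat -> C) (N : nat) : (forall n, (n <= N)%nat -> a n = 0) -> sum_n a N = RtoC 0.
Proof.
  intros H. induction N as [|N IH].
  - rewrite sum_n_C0. apply H. lia.
  - rewrite sum_n_CS, IH, H by (auto; lia). apply Cplus_0_l.
Qed.

(** [csig] vanishes at [- 2 n] and kills every summand except that of index [2 n + 1], where its
    zero was cancelled: there [Csinc 0 = 1] leaves [(-1)^n b_(2n+1) pi / 2], to be divided by
    [pi]. *)
Lemma continued_even_value (b : nat -> C) (Z : C -> C) (n : nat) : continued b Z ->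
  Z (RtoC (- (2 * INR n))) = (sgn n * b (2 * n + 1)%nat / 2)%C.
Proof.
  intros [_ HZN]. destruct (HZN (2 * n + 2)%nat) as [Rg HRg].
  assert (Hn0 := pos_INR n).
  destruct (HRg (RtoC (- (2 * INR n)))) as [_ ->].
  { rewrite plus_INR, mult_INR. simpl. lra. }
  set (s := RtoC (- (2 * INR n))).
  assert (E0 : (s + RtoC (2 * INR n))%C = 0) by (unfold s; rewrite RtoC_opp; ring).
  assert (Ec : csig s = 0) by (rewrite (csig_even s n), E0; ring).
  assert (U0 : forall k, k <> (2 * n + 1)%nat -> Uterm b k s = 0).
  { intros k Hk. rewrite Uterm_generic; [rewrite Ec; ring|].
    intros E. apply (f_equal Re) in E. unfold s in E.
    change (- (2 * INR n) + (INR k - 1) = 0) in E. apply Hk. apply INR_eq.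
    rewrite plus_INR, mult_INR. simpl. lra. }
  replace (2 * n + 2)%nat with (S (S (2 * n))) by lia.
  rewrite !sum_n_CS, (U0 (S (S (2 * n)))) by lia.
  rewrite sum_n_C_zero by (intros k Hk; apply U0; lia).
  replace (S (2 * n)) with (2 * n + 1)%nat by lia.
  unfold Uterm. rewrite Nat.add_1_r, Nat.div2_succ_double, Nat.odd_succ, Nat.even_mul. cbn [Nat.even orb].
  rewrite E0, Cmult_0_r, Ec.
  rewrite Csinc_0, RtoC_div by lra.
  field. repeat split; auto using Ctwo_neq_0, RtoC_PI_neq_0.
Qed.

(** * The coefficients and the final assembly *)

Lemma coef_double (E B : nat -> R) (n : nat) : (1 <= n)%nat ->
  coef E B (2 * n) = (1 - 1 / 2 ^ (2 * n - 1)) * (B (2 * n)%nat / (4 * INR n)).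
Proof.
  intros Hn. unfold coef, coef_even. rewrite Nat.odd_mul, Nat.div2_double. cbn [Nat.odd Nat.even negb andb].
  destruct (Nat.eqb_spec (2 * n) 0); [lia|reflexivity].
Qed.

Lemma coef_succ_double (E B : nat -> R) (n : nat) :
  coef E B (2 * n + 1) = (8 - E (2 * n)%nat) / 2 ^ (2 * n + 2).
Proof.
  unfold coef, coef_odd. rewrite Nat.add_1_r, Nat.div2_succ_double, Nat.odd_succ, Nat.even_mul. reflexivity.
Qed.

Lemma coef_double_neq_0 (E B : nat -> R) (n : nat) : is_Bernoulli_numbers B -> (1 <= n)%nat ->
  coef E B (2 * n) <> 0.
Proof.
  intros HB Hn. rewrite coef_double by assumption.
  assert (Hm1 : 1 <= INR n) by (apply (le_INR 1), Hn).
  apply Rmult_integral_contrapositive_currified.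
  - replace (2 * n - 1)%nat with (S (2 * (n - 1))) by lia.
    assert (P : 1 <= 2 ^ (2 * (n - 1))) by (apply pow_R1_Rle; lra).
    rewrite <- tech_pow_Rmult. assert (Q : 1 / (2 * 2 ^ (2 * (n - 1))) < 1); [|lra].
    apply Rmult_lt_reg_r with (2 * 2 ^ (2 * (n - 1))); [lra|].
    replace (1 / (2 * 2 ^ (2 * (n - 1))) * (2 * 2 ^ (2 * (n - 1)))) with 1 by (field; lra). lra.
  - apply Rmult_integral_contrapositive_currified; [apply Bernoulli_even_neq_0; assumption|].
    apply Rinv_neq_0_compat. lra.
Qed.

Lemma Cpow_m1 (n : nat) : ((-1) ^ n)%C = sgn n.
Proof. unfold sgn. rewrite RtoC_pow. reflexivity. Qed.

(** [holomorphic_at] asks for differentiability on a whole neighbourhood, so regular points must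
    keep a distance from all poles; [k = 0] is the pole at 1. Large [k] stay at distance at least 1,
    and finitely many others remain. *)
Lemma exceptional_discrete (z : C) : (forall k : nat, z <> RtoC (1 - 2 * INR k)) ->
  exists d, 0 < d /\ forall s, Cmod (s - z)%C < d -> forall k : nat, s <> RtoC (1 - 2 * INR k).
Proof.
  intros H.
  assert (Fin : forall N, exists d, 0 < d /\ forall k, (k <= N)%nat -> d <= Cmod (RtoC (1 - 2 * INR k) - z)%C).
  { assert (P : forall k : nat, 0 < Cmod (RtoC (1 - 2 * INR k) - z)%C).
    { intros k. apply Cmod_gt_0. intros E. apply (H k).
      replace z with (RtoC (1 - 2 * INR k) - (RtoC (1 - 2 * INR k) - z))%C by ring. rewrite E. ring. }
    induction N as [|N (d & Hd & IH)].
    - exists (Cmod (RtoC (1 - 2 * INR 0) - z)%C). split; [apply P|]. intros k Hk.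
      replace k with 0%nat by lia. lra.
    - exists (Rmin d (Cmod (RtoC (1 - 2 * INR (S N)) - z)%C)). split; [apply Rmin_pos; auto|].
      intros k Hk. destruct (Nat.eq_dec k (S N)) as [->|Nk]; [apply Rmin_r|].
      eapply Rle_trans; [apply Rmin_l|]. apply IH. lia. }
  destruct (INR_archimed 1 (1 - Re z)) as [N HN]; [lra|].
  destruct (Fin N) as (d & Hd & HF). exists (Rmin d 1). split; [apply Rmin_pos; lra|].
  intros s Hs k E. rewrite E in Hs.
  destruct (Nat.le_gt_cases k N) as [Hk|Hk].
  - specialize (HF k Hk). assert (T := Rmin_l d 1). lra.
  - apply (le_INR (S N)) in Hk. rewrite S_INR in Hk. apply disc_Re in Hs. assert (T := Rmin_r d 1).
    change (Re (RtoC (1 - 2 * INR k))) with (1 - 2 * INR k) in Hs.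
    assert (T2 := pos_INR N). destruct (Rle_dec 0 (Re z)); lra.
Qed.

Theorem theorem27 (E B : nat -> R) (alpha : nat -> C)
  (hE : is_Euler_numbers E) (hB : is_Bernoulli_numbers B)
  (halpha : is_Riemann_sequence E B alpha) :
  exists Z : C -> C,
    (forall s : C, 1 < Re s ->
       is_Cseries (fun n => Cpower (alpha n) (- s)%C) (Z s)) /\
    meromorphic Z /\
    is_pole_of_order Z (RtoC 1) 2 /\
    is_residue Z (RtoC 1) (RtoC (- (ln (2 * PI) / (2 * PI)))) /\
    has_principal_part Z (RtoC 1)
      (fun s => (1 / (2 * PI * (s - 1) ^ 2)
                 - ln (2 * PI) / (2 * PI * (s - 1)))%C) /\
    (forall n : nat, (1 <= n)%nat ->
       is_pole_of_order Z (RtoC (- (2 * INR n - 1))) 1 /\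
       has_principal_part Z (RtoC (- (2 * INR n - 1)))
         (fun s => ((-1) ^ n
                    * (coef E B (2 * n) / (PI * (s + 2 * INR n - 1))))%C) /\
       (forall s : C, s <> RtoC (- (2 * INR n - 1)) ->
          ((-1) ^ n * (coef E B (2 * n) / (PI * (s + 2 * INR n - 1))))%C
          = ((-1) ^ n * (RtoC (1 - powerRZ 2 (1 - 2 * Z.of_nat n)) / (2 * PI))
             * (B (2 * n)%nat / (2 * INR n)) * (1 / (s + 2 * INR n - 1)))%C)) /\
    (forall z : C, is_pole Z z ->
       z = RtoC 1 \/
       exists n : nat, (1 <= n)%nat /\ z = RtoC (- (2 * INR n - 1))) /\
    (forall n : nat,
       Z (RtoC (- (2 * INR n)))
         = RtoC ((-1) ^ n * (coef E B (2 * n + 1) / 2)) /\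
       (-1) ^ n * (coef E B (2 * n + 1) / 2)
         = (-1) ^ n * ((8 - E (2 * n)%nat) / 2 ^ (2 * n + 3))).
Proof.
  assert (HL := Riemann_good_logs E B alpha halpha).
  destruct (ex_generating _ HL) as [F HF].
  set (b := fun n => RtoC (coef E B n)).
  assert (Hb0 : b 0%nat = 0) by reflexivity.
  destruct (continuation _ F b HL HF Hb0) as (Z & HZ1 & HZN).
  { intros N. apply (Riemann_expansion E B alpha F N halpha HF). }
  assert (HZ : continued b Z) by (split; [apply HZ1|exact HZN]).
  assert (PP := PI_RGT_0).
  assert (Hone : is_pole_of_order Z 1 2).
  { split; [lia|]. exists polar_one. split.
    - unfold polar_one. simpl. unfold Cdiv. rewrite Cmult_1_l.
      intros E0. assert (T : (2 * RtoC PI)%C <> 0) by (apply Cmult_neq_0; [apply Ctwo_neq_0|apply RtoC_PI_neq_0]).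
      assert (T2 := Cinv_r _ T). rewrite E0, Cmult_0_r in T2. apply (f_equal Re) in T2. simpl in T2. lra.
    - apply (continued_pole_one b); auto. }
  assert (Hsum : forall n (s : C), s <> RtoC (- (2 * INR n - 1)) ->
     ((-1) ^ n * (coef E B (2 * n) / (PI * (s + 2 * INR n - 1))))%C
     = polar_sum (RtoC (- (2 * INR n - 1))) 1 (fun _ => sgn n * b (2 * n)%nat / RtoC PI)%C s).
  { intros n s Hs. rewrite polar_sum_S, polar_sum_0, Cpow_m1. simpl Cpow. rewrite Cmult_1_r.
    replace (s - RtoC (- (2 * INR n - 1)))%C with (s + 2 * INR n - 1)%C
      by (rewrite RtoC_opp, RtoC_minus, RtoC_mult; ring).
    unfold b. field; split; [apply RtoC_PI_neq_0|].
    intros E0. apply Hs. replace s with ((s + 2 * INR n - 1) - (2 * INR n - 1))%C by ring.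
    rewrite E0, RtoC_opp, RtoC_minus, RtoC_mult. ring. }
  assert (Hodd : forall n, (1 <= n)%nat -> is_pole_of_order Z (RtoC (- (2 * INR n - 1))) 1).
  { intros n Hn. split; [lia|]. exists (fun _ => sgn n * b (2 * n)%nat / RtoC PI)%C. split.
    - unfold b, sgn. rewrite <- RtoC_mult, <- RtoC_div by lra. apply RtoC_neq_0.
      apply Rmult_integral_contrapositive_currified; [|apply Rinv_neq_0_compat; lra].
      apply Rmult_integral_contrapositive_currified; [apply pow_nonzero; lra|].
      apply coef_double_neq_0; assumption.
    - apply (continued_pole_odd b); auto. }
  assert (Hreg : forall z : C, z <> 1 -> (forall n, (1 <= n)%nat -> z <> RtoC (- (2 * INR n - 1))) -> Cdiffable Z z).
  { intros z H1 H2. apply (continued_regular b); assumption. }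
  assert (Hcases : forall z : C, z = 1 \/ (exists n, (1 <= n)%nat /\ z = RtoC (- (2 * INR n - 1))) \/
     (z <> 1 /\ forall n, (1 <= n)%nat -> z <> RtoC (- (2 * INR n - 1)))).
  { intros z. destruct (excluded_middle_informative (z = 1)) as [H1|H1]; [auto|].
    destruct (excluded_middle_informative (exists n, (1 <= n)%nat /\ z = RtoC (- (2 * INR n - 1)))) as [H2|H2]; [auto|].
    right. right. split; [assumption|]. intros n Hn E0. apply H2. eauto. }
  exists Z. split; [|split; [|split; [|split; [|split; [|split; [|split]]]]]].
  - intros s Hs. eapply is_Cseries_ext; [|apply (HZ1 s Hs)]. intros k. reflexivity.
  - intros z. destruct (Hcases z) as [->|[(n & Hn & ->)|[H1 H2]]].
    + right. exists 2%nat. exact Hone.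
    + right. exists 1%nat. apply Hodd, Hn.
    + left.
      destruct (exceptional_discrete z) as (d & Hd & H).
      { intros [|k] E0.
        - apply H1. rewrite E0. simpl. Ceq_ring.
        - apply (H2 (S k)); [lia|]. rewrite E0. f_equal. ring. }
      apply (holomorphic_at_disc Z z d Hd). intros s Hs. apply Hreg.
      * intros E0. apply (H s Hs 0%nat). rewrite E0. simpl. Ceq_ring.
      * intros n Hn E0. apply (H s Hs n). rewrite E0. f_equal. ring.
  - exact Hone.
  - exists 2%nat, polar_one. split; [lia|]. split; [|reflexivity]. apply (continued_pole_one b); auto.
  - apply (continued_pole_one b); auto. apply polar_one_sum.
  - intros n Hn. split; [apply Hodd, Hn|]. split.
    + apply (continued_pole_odd b); auto.
    + intros s Hs.
      assert (Hs0 : (s + 2 * INR n - 1)%C <> 0).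
      { intros E0. apply Hs. replace s with ((s + 2 * INR n - 1) - (2 * INR n - 1))%C by ring.
        rewrite E0, RtoC_opp, RtoC_minus, RtoC_mult. ring. }
      assert (Hm1 : 1 <= INR n) by (apply (le_INR 1), Hn).
      (* The exponent [2 * n - 1] is a truncated subtraction in [nat], which is exact since
         [1 <= n]. *)
      replace (powerRZ 2 (1 - 2 * Z.of_nat n)) with (1 / 2 ^ (2 * n - 1)).
      2:{ replace (1 - 2 * Z.of_nat n)%Z with (- Z.of_nat (2 * n - 1))%Z by lia.
          rewrite powerRZ_neg', <- pow_powerRZ. field. apply pow_nonzero; lra. }
      rewrite coef_double by assumption. rewrite RtoC_mult, RtoC_div, !RtoC_mult by lra.
      replace (RtoC 4) with (2 * 2)%C by Ceq_ring.
      assert (Hn0 : RtoC (INR n) <> 0) by (apply RtoC_neq_0; lra).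
      field. repeat split; auto using RtoC_PI_neq_0, Ctwo_neq_0.
  - intros z Hz. destruct (Hcases z) as [->|[H|[H1 H2]]]; [auto|auto|].
    exfalso. exact (not_pole_of_diffable Z z (Hreg z H1 H2) Hz).
  - intros n. split.
    + rewrite (continued_even_value b Z n HZ). unfold b, sgn, Rdiv. rewrite !RtoC_mult, RtoC_inv by lra.
      unfold Cdiv. ring.
    + rewrite coef_succ_double. replace (2 * n + 3)%nat with (S (2 * n + 2)) by lia.
      rewrite <- tech_pow_Rmult.
      field. apply pow_nonzero; lra.
Qed.
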